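(* Let $\beta>0$, $\beta'=\beta/2$, and let $(a_n)_n,(b_n)_n$ be positive parameters with $$\frac{\beta' n}{a_n}\xrightarrow[n\to\infty]{}\tau\in(0,1],\qquad \frac{b_n}{n}\xrightarrow[n\to\infty]{}\infty .$$ For each $n$ let $(\lambda_1,\dots,\lambda_n;w_1,\dots,w_n)\sim\mathcal{J}\beta\mathcal{E}(a_n,b_n)$ (all on one probability space). Then the spectral measure $\sum_i w_i\delta_{(b_n/a_n)\lambda_i}$ and the empirical measure $\frac1n\sum_i\delta_{(b_n/a_n)\lambda_i}$ of the rescaled eigenvalues $\frac{b_n}{a_n}\lambda_i$ converge weakly, almost surely, to the Marchenko–Pastur law $\mathrm{MP}(\tau)$.
   Context: Jacobi ensemble $\mathcal{J}\beta\mathcal{E}(a,b)$ in dimension $n$ (with $\beta>0$, $\beta'=\beta/2$, parameters $a,b>\beta'(n-1)$): the joint law of a random eigenvalue vector $(\lambda_1,\dots,\lambda_n)$ with Lebesgue density $$c_{a,b,\beta}\prod_{i<j}|\lambda_i-\lambda_j|^\beta\prod_{i=1}^n\lambda_i^{a-e_\beta}(1-\lambda_i)^{b-e_\beta}\mathbb{1}_{\{0<\lambda_i<1\}},\qquad e_\beta=\tfrac{\beta}{2}(n-1)+1,$$ ($c_{a,b,\beta}$ the normalising constant), together with an independent weight vector $(w_1,\dots,w_n)$ having the Dirichlet distribution with all $n$ parameters equal to $\beta'$. The spectral measure is $\mu_n=\sum_i w_i\delta_{\lambda_i}$; when eigenvalues are rescaled the weights are kept. The Marchenko–Pastur law $\mathrm{MP}(\tau)$,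 $\tau\in(0,1]$, has density $\frac{1}{2\pi\tau x}\sqrt{(x-\tau^-)(\tau^+-x)}\,\mathbb{1}_{\{\tau^-<x<\tau^+\}}$ with $\tau^\pm=(\sqrt\tau\pm1)^2$. *)

(* Defs.v *)
From HB Require Import structures.
From mathcomp Require Import all_boot all_order all_algebra.
From mathcomp Require Import all_classical all_reals all_analysis.
Set Implicit Arguments.
Unset Strict Implicit.
Unset Printing Implicit Defensive.
Import Order.TTheory GRing.Theory Num.Theory.
Import numFieldNormedType.Exports.
Local Open Scope classical_set_scope.
Local Open Scope ring_scope.

Section Defs.
Variable R : realType.

(* Iterated Lebesgue integral over R^n of a nonnegative function of the
   coordinate list s = [:: x_0; ...; x_(n-1)]:
   iint n F = \int dx_0 \int dx_1 ... \int dx_(n-1) F [:: x_0; ...; x_(n-1)].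
   (By Tonelli this is the integral w.r.t. n-dimensional Lebesgue measure.) *)
Fixpoint iint (n : nat) (F : seq R -> \bar R) : \bar R :=
  match n with
  | 0 => F [::]
  | n'.+1 => (\int[@lebesgue_measure R]_x iint n' (fun s => F (x :: s)))%E
  end.

Definition jac_dens (beta a b : R) (s : seq R) : R :=
  let n := size s in
  let e := beta / 2 * (n.-1)%:R + 1 in
  (\prod_(i < n) \prod_(j < n | (i < j)%N) (`|s`_i - s`_j| `^ beta)) *
  (\prod_(i < n) (s`_i `^ (a - e) * (1 - s`_i) `^ (b - e) *
                   \1_[set x : R | 0 < x < 1] s`_i)).

Definition jac_prob (beta a b : R) (n : nat) (A : 'I_n -> set R) : \bar R :=
  (iint n (fun s => (jac_dens beta a b s *
                     \1_[set s : seq R | forall i : 'I_n, A i s`_i] s)%:E) *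
   ((fine (iint n (fun s => (jac_dens beta a b s)%:E)))^-1)%:E)%E.

(* Unnormalised Dirichlet(c,...,c) density (n parameters) expressed in the
   first n-1 coordinates u = [:: w_0; ...; w_(n-2)], w_(n-1) = 1 - sum u. *)
Definition dir_dens (c : R) (u : seq R) : R :=
  (\prod_(i < size u) (u`_i `^ (c - 1))) *
  ((1 - \sum_(i < size u) u`_i) `^ (c - 1)) *
  \1_[set v : seq R | (forall i : 'I_(size v), 0 < v`_i) /\
                      \sum_(i < size v) v`_i < 1] u.

Definition dir_ext (n : nat) (u : seq R) (i : 'I_n) : R :=
  if (i < n.-1)%N then u`_i else 1 - \sum_(k < n.-1) u`_k.

Definition dir_prob (c : R) (n : nat) (B : 'I_n -> set R) : \bar R :=
  (iint n.-1 (fun u => (dir_dens c u *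
                  \1_[set v : seq R | forall i : 'I_n, B i (dir_ext v i)] u)%:E) *
   ((fine (iint n.-1 (fun u => (dir_dens c u)%:E)))^-1)%:E)%E.

Definition mp_minus (tau : R) : R := (Num.sqrt tau - 1) ^+ 2.
Definition mp_plus (tau : R) : R := (Num.sqrt tau + 1) ^+ 2.
Definition mp_dens (tau : R) (x : R) : R :=
  Num.sqrt ((x - mp_minus tau) * (mp_plus tau - x)) / (2 * pi * tau * x) *
  \1_`]mp_minus tau, mp_plus tau[ x.

Definition mp_int (tau : R) (f : R -> R) : R :=
  Rintegral (@lebesgue_measure R) setT (fun x => f x * mp_dens tau x).

(* weak convergence of a sequence of (finite, atomic) measures
   mu_n = sum_(i < n) m n i delta_(x n i) to MP(tau):
   int f d mu_n -> int f dMP(tau) for every bounded continuous f *)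
Definition weak_cvg_MP (m x : forall n, 'I_n -> R) (tau : R) : Prop :=
  forall f : R -> R, continuous f -> (exists M, forall y, `|f y| <= M) ->
    (fun n => \sum_(i < n) m n i * f (x n i)) @ \oo --> mp_int tau f.

End Defs.

(* Main.v *)
(* Deform the Jacobi density by the maps x |-> x + e x^(k+1) (1 - x) of (0, 1) applied to every
   eigenvalue. The total mass does not depend on e, and the second order expansion in e gives
   E[L_k] = 0 and an exact formula for E[L_k^2], where the loop function L_k is a quadratic
   polynomial in the power sums p_j of the eigenvalues. Writing theta = a_n / b_n, the first
   identity bounds E[p_k] by C n theta^k, after which the second one bounds the second moment of
   L_k / (n^2 theta^k) by C / n^2; these bounds are summable, so that this quantity tends to 0
   almost surely. Hence the moments p_k / (n theta^k) of the rescaled empirical measure converge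
   to the solution of m_0 = 1, m_(k+1) = (1 - tau) m_k + tau sum_(p <= k) m_p m_(k-p).

   Conditionally on the eigenvalues, the moments of the spectral measure are Dirichlet averages;
   their fourth centred moment is explicit, of order p_(4k) / n^3, so that almost surely the two
   measures have the same limiting moments.

   With x = 1 + tau - 2 sqrt(tau) cos t the moments of MP(tau) become trigonometric integrals, for
   which integration by parts gives a three-term linear recursion; a generating function argument
   turns it into the quadratic recursion above. Since MP(tau) has compact support, convergence of
   all moments implies weak convergence, by Bernstein approximation. *)

Require Import Defs.
From HB Require Import structures.
From mathcomp Require Import all_boot all_order all_algebra.
From mathcomp Require Import all_classical all_reals all_analysis.
From mathcomp Require Import measurable_realfun ring lra.
Set Implicit Arguments.
Unset Strict Implicit.
Unset Printing Implicit Defensive.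
Import Order.TTheory GRing.Theory Num.Theory.
Import numFieldNormedType.Exports.
Local Open Scope classical_set_scope.
Local Open Scope ring_scope.
(** * Daniell functionals and iterated integrals *)

Section daniell_functional.
Local Open Scope ereal_scope.
Context (R : realType) (d : measure_display) (X : measurableType d).

Record daniell (L : (X -> \bar R) -> \bar R) : Prop := Daniell {
  daniell0 : L (cst 0) = 0;
  daniell_ge0 : forall f : X -> \bar R, (forall x, 0 <= f x) -> 0 <= L f;
  daniellD : forall f g : X -> \bar R, (forall x, 0 <= f x) -> (forall x, 0 <= g x) ->
    measurable_fun setT f -> measurable_fun setT g ->
    L (fun x => f x + g x) = L f + L g;
  daniellZl : forall (k : R) (f : X -> \bar R), (0 <= k)%R -> (forall x, 0 <= f x) ->
    measurable_fun setT f -> L (fun x => k%:E * f x) = k%:E * L f;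
  daniell_lim : forall f : nat -> X -> \bar R, (forall n x, 0 <= f n x) ->
    (forall n, measurable_fun setT (f n)) ->
    (forall x, nondecreasing_seq (f ^~ x)) ->
    L (fun x => limn (f ^~ x)) = limn (fun n => L (f n)) }.

Variables (L : (X -> \bar R) -> \bar R) (dL : daniell L).

Lemma daniell_sum (I : Type) (s : seq I) (f : I -> X -> \bar R) :
  (forall i x, 0 <= f i x) -> (forall i, measurable_fun setT (f i)) ->
  L (fun x => \sum_(i <- s) f i x) = \sum_(i <- s) L (f i).
Proof.
move=> f0 mf; elim: s => [|i s IH].
  rewrite big_nil -[RHS](daniell0 dL); congr L; apply/funext => x.
  by rewrite big_nil.
rewrite big_cons -IH -(daniellD dL)//.
- by congr L; apply/funext => x; rewrite big_cons.
- by move=> x; apply: sume_ge0.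
- exact: emeasurable_sum.
Qed.

Definition daniell_measure of daniell L :=
  fun A : set X => L (EFin \o \1_A : X -> \bar R).
Let mu := daniell_measure dL.

Let measurable_EFin_indic (A : set X) : measurable A ->
  measurable_fun setT (fun x => (\1_A x)%:E : \bar R).
Proof. by move=> mA; exact/measurable_EFinP/measurable_indic. Qed.

Let daniell_measure0 : mu set0 = 0.
Proof.
rewrite /mu /daniell_measure -[RHS](daniell0 dL); congr L; apply/funext => x /=.
by rewrite indicE in_set0.
Qed.

Let daniell_measure_ge0 A : 0 <= mu A.
Proof. by apply: (daniell_ge0 dL) => x; rewrite lee_fin. Qed.

Let daniell_measure_semi_sigma_additive : semi_sigma_additive mu.
Proof.
move=> F mF tF mUF.
have -> : mu (\bigcup_n F n) = limn (fun n => \sum_(0 <= i < n) mu (F i)).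
  transitivity (L (fun x => limn (fun n => \sum_(0 <= i < n) (\1_(F i) x)%:E))).
    by congr L; apply/funext => x /=; rewrite indic_bigcup.
  rewrite (daniell_lim dL); first last.
  - by move=> x; apply: ereal_nondecreasing_series => i _ _; rewrite lee_fin.
  - by move=> n; apply: emeasurable_sum => i; exact: measurable_EFin_indic.
  - by move=> n x; apply: sume_ge0 => i _; rewrite lee_fin.
  congr (limn _); apply/funext => n.
  rewrite (daniell_sum _ (f := fun i x => (\1_(F i) x)%:E))// => i.
  exact: measurable_EFin_indic.
by apply: is_cvg_ereal_nneg_natsum => i _; exact: daniell_measure_ge0.
Qed.

HB.instance Definition _ := isMeasure.Build d X R (daniell_measure dL)
  daniell_measure0 daniell_measure_ge0 daniell_measure_semi_sigma_additive.

Import HBNNSimple.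

Let daniell_nnsfun (g : {nnsfun X >-> R}) :
  L (EFin \o g) = \int[daniell_measure dL]_x (g x)%:E.
Proof.
rewrite integralT_nnsfun sintegralE.
have -> : EFin \o g = fun x => \sum_(r <- finmap.enum_fset (fset_set (range g)))
    (`|r|%:E * (\1_(g @^-1` [set r]) x)%:E).
  apply/funext => x /=; rewrite fimfunE -fsumEFin// fsbig_finite//=.
  rewrite big_seq [RHS]big_seq; apply: eq_bigr => r.
  rewrite in_fset_set// inE => -[y _ <-].
  by rewrite EFinM ger0_norm.
rewrite (daniell_sum _ (f := fun r x => `|r|%:E * (\1_(g @^-1` [set r]) x)%:E)).
- rewrite fsbig_finite//= big_seq [RHS]big_seq; apply: eq_bigr => r.
  rewrite in_fset_set// inE => -[y _ <-].
  by rewrite (daniellZl dL)// ?ger0_norm//; exact: measurable_EFin_indic.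
- by move=> r x; rewrite mule_ge0 ?lee_fin.
- by move=> r; apply: emeasurable_funM => //; exact: measurable_EFin_indic.
Qed.

Lemma integral_daniell_measure (f : X -> \bar R) : (forall x, 0 <= f x) ->
  measurable_fun setT f -> \int[daniell_measure dL]_x f x = L f.
Proof.
move=> f0 mf; pose g := nnsfun_approx measurableT mf.
have nd_g x : nondecreasing_seq (fun n => (g n x)%:E).
  by move=> m n mn; rewrite lee_fin; exact/lefP/nd_nnsfun_approx.
have mg n : measurable_fun setT (fun x => (g n x)%:E).
  exact/measurable_EFinP/measurable_funP.
have -> : f = fun x => limn (fun n => (g n x)%:E).
  by apply/funext => x; apply/esym/cvg_lim => //; exact: cvg_nnsfun_approx.
have g0 n x : 0 <= (g n x)%:E by rewrite lee_fin.
rewrite monotone_convergence// (daniell_lim dL)//.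
by congr (limn _); apply/funext => n; rewrite -daniell_nnsfun.
Qed.

End daniell_functional.

Lemma daniell_integral (R : realType) d (X : measurableType d)
    (mu : {measure set X -> \bar R}) (D : set X) : measurable D ->
  daniell (fun f : X -> \bar R => \int[mu]_(x in D) f x)%E.
Proof.
move=> mD; split.
- exact: integral0.
- by move=> f f0; exact: integral_ge0.
- by move=> f g f0 g0 mf mg; rewrite ge0_integralD//; exact: measurable_funTS.
- by move=> k f k0 f0 mf; rewrite ge0_integralZl_EFin//; exact: measurable_funTS.
- move=> f f0 mf ndf; rewrite monotone_convergence// => n.
  exact: measurable_funTS.
Qed.

Lemma daniell_density (R : realType) d (X : measurableType d) d' (Y : measurableType d')
    (L : (X -> \bar R) -> \bar R) (phi : X -> Y) (rho : X -> R) :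
  daniell L -> measurable_fun setT phi -> measurable_fun setT rho ->
  (forall x, 0 <= rho x) ->
  daniell (fun f : Y -> \bar R => L (fun x => f (phi x) * (rho x)%:E)%E).
Proof.
move=> dL mphi mrho rho0.
have mf_rho (f : Y -> \bar R) : measurable_fun setT f ->
    measurable_fun setT (fun x => f (phi x) * (rho x)%:E)%E.
  move=> mf; apply: emeasurable_funM; first exact: measurableT_comp.
  exact/measurable_EFinP.
have f_rho0 (f : Y -> \bar R) x : (forall y, 0 <= f y)%E -> (0 <= f (phi x) * (rho x)%:E)%E.
  by move=> f0; rewrite mule_ge0// lee_fin.
split.
- by under eq_fun do rewrite mul0e; exact: (daniell0 dL).
- by move=> f f0; apply: (daniell_ge0 dL) => x; exact: f_rho0.
- move=> f g f0 g0 mf mg; rewrite -(daniellD dL).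
  + by congr L; apply/funext => x; rewrite ge0_muleDl.
  + by move=> x; exact: f_rho0.
  + by move=> x; exact: f_rho0.
  + exact: mf_rho.
  + exact: mf_rho.
- move=> k f k0 f0 mf; rewrite -(daniellZl dL)//.
  + by congr L; apply/funext => x; rewrite muleA.
  + by move=> x; exact: f_rho0.
  + exact: mf_rho.
- move=> f f0 mf ndf; rewrite -(daniell_lim dL).
  + congr L; apply/funext => x; rewrite -limeMr//.
    exact: ereal_nondecreasing_is_cvgn.
  + by move=> n x; exact: f_rho0.
  + by move=> n; exact: mf_rho.
  + by move=> x n m nm; apply: lee_wpmul2r; [rewrite lee_fin|exact: ndf].
Qed.

Section iterated_integral.
Local Open Scope ereal_scope.
Context (R : realType).
Implicit Types (F G : seq R -> \bar R) (n : nat).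

Definition measurable_at n F := measurable_fun setT (fun t : n.-tuple R => F t).

Lemma measurable_at_EFin n (f : seq R -> R) :
  measurable_fun setT (fun t : n.-tuple R => f t) -> measurable_at n (fun s => (f s)%:E).
Proof. by move=> mf; exact/measurable_EFinP. Qed.

Lemma eq_iint n F G : (forall s, size s = n -> F s = G s) -> iint n F = iint n G.
Proof.
elim: n F G => [|n IH] F G FG /=; first exact: FG.
by apply: eq_integral => x _; apply: IH => s sn; apply: FG; rewrite /= sn.
Qed.

Lemma iint0 n : iint n (fun=> 0 : \bar R) = 0.
Proof. by elim: n => //= n ->; rewrite integral0. Qed.

Lemma iint_ge0 n F : (forall s, 0 <= F s) -> 0 <= iint n F.
Proof.
elim: n F => [|n IH] F F0 /=; first exact: F0.
by apply: integral_ge0 => x _; apply: IH => s.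
Qed.

Lemma measurable_iint n d (X : measurableType d) (F : X -> seq R -> \bar R) :
  (forall x s, 0 <= F x s) ->
  measurable_fun setT (fun p : X * n.-tuple R => F p.1 p.2) ->
  measurable_fun setT (fun x => iint n (F x)).
Proof.
elim: n d X F => [|n IH] d X F F0 mF /=.
  rewrite (_ : (fun x => _) =
      (fun p : X * 0.-tuple R => F p.1 p.2) \o (fun x => (x, [tuple])))//.
  by apply: measurableT_comp => //; apply: measurable_fun_pair.
pose G (q : X * R) s := F q.1 (q.2 :: s).
apply: (@measurable_fun_fubini_tonelli_F _ _ _ _ _ (@lebesgue_measure R)
    (fun q : X * R => iint n (G q))) => //; last first.
  by move=> q; apply: iint_ge0 => s; exact: F0.
apply: IH => [q s|]; first exact: F0.
rewrite (_ : (fun p => _) = (fun p : X * n.+1.-tuple R => F p.1 p.2) \o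
    (fun p : (X * R) * n.-tuple R => (p.1.1, [tuple of p.1.2 :: p.2])))//.
apply: measurableT_comp => //; apply: measurable_fun_pair => //=.
  exact: measurableT_comp.
by apply: measurable_cons => //; exact: measurableT_comp.
Qed.

Lemma measurable_at_cons n F x : measurable_at n.+1 F ->
  measurable_at n (fun s => F (x :: s)).
Proof.
move=> mF; rewrite /measurable_at (_ : (fun t => _) =
  (fun t : n.+1.-tuple R => F t) \o (fun t : n.-tuple R => [tuple of x :: t]))//.
by apply: measurableT_comp => //; exact: measurable_cons.
Qed.

Lemma measurable_iint_cons n F : (forall s, 0 <= F s) -> measurable_at n.+1 F ->
  measurable_fun setT (fun x => iint n (fun s => F (x :: s))).
Proof.
move=> F0 mF; apply: (@measurable_iint n _ _ (fun x s => F (x :: s))) => //.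
rewrite (_ : (fun p => _) = (fun t : n.+1.-tuple R => F t) \o
   (fun p : R * n.-tuple R => [tuple of p.1 :: p.2]))//.
by apply: measurableT_comp => //; exact: measurable_cons.
Qed.

Lemma iintD n F G : (forall s, 0 <= F s) -> (forall s, 0 <= G s) ->
  measurable_at n F -> measurable_at n G ->
  iint n (fun s => F s + G s) = iint n F + iint n G.
Proof.
elim: n F G => [|n IH] F G F0 G0 mF mG //=.
rewrite -ge0_integralD//; first last.
- exact: measurable_iint_cons.
- by move=> x _; exact: iint_ge0.
- exact: measurable_iint_cons.
- by move=> x _; exact: iint_ge0.
by apply: eq_integral => x _; apply: IH => //; exact: measurable_at_cons.
Qed.

Lemma iintZl n F (k : R) : (0 <= k)%R -> (forall s, 0 <= F s) ->
  measurable_at n F -> iint n (fun s => k%:E * F s) = k%:E * iint n F.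
Proof.
move=> k0; elim: n F => [|n IH] F F0 mF //=.
rewrite -ge0_integralZl_EFin//; first last.
- exact: measurable_iint_cons.
- by move=> x _; exact: iint_ge0.
by apply: eq_integral => x _; apply: IH => //; exact: measurable_at_cons.
Qed.

Lemma le_iint n F G : (forall s, 0 <= F s) -> (forall s, size s = n -> F s <= G s) ->
  (forall s, 0 <= G s) ->
  measurable_at n F -> measurable_at n G -> iint n F <= iint n G.
Proof.
elim: n F G => [|n IH] F G F0 FG G0 mF mG /=; first exact: FG.
apply: ge0_le_integral => //.
- by move=> x _; exact: iint_ge0.
- exact: measurable_iint_cons.
- exact: measurable_iint_cons.
- move=> x _; apply: IH => //; try exact: measurable_at_cons.
  by move=> s sn; apply: FG; rewrite /= sn.
Qed.

Lemma iint_lim n (f : nat -> seq R -> \bar R) : (forall k s, 0 <= f k s) ->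
  (forall k, measurable_at n (f k)) ->
  (forall s, nondecreasing_seq (f ^~ s)) ->
  iint n (fun s => limn (f ^~ s)) = limn (fun k => iint n (f k)).
Proof.
elim: n f => [|n IH] f f0 mf ndf //=.
rewrite -monotone_convergence//; first last.
- move=> x _ k l kl; apply: le_iint => //; try exact: measurable_at_cons.
  by move=> s _; exact: ndf.
- by move=> k x _; exact: iint_ge0.
- by move=> k; exact: measurable_iint_cons.
apply: eq_integral => x _; apply: (IH (fun k s => f k (x :: s))) => //.
by move=> k; exact: measurable_at_cons.
Qed.

Lemma iint_sum n m (F : 'I_m -> seq R -> \bar R) : (forall i s, 0 <= F i s) ->
  (forall i, measurable_at n (F i)) ->
  iint n (fun s => \sum_(i < m) F i s) = \sum_(i < m) iint n (F i).
Proof.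
elim: m F => [|m IH] F F0 mF.
  by rewrite big_ord0 -[RHS](iint0 n); apply: eq_iint => s _; rewrite big_ord0.
rewrite big_ord_recr/= -IH// -iintD//.
- by apply: eq_iint => s _; rewrite big_ord_recr.
- by move=> s; apply: sume_ge0.
- by apply: emeasurable_sum => i; exact: mF.
Qed.

Definition to_tuple n (s : seq R) : n.-tuple R := [tuple s`_i | i < n].

Lemma tnth_to_tuple n (s : seq R) i : tnth (to_tuple n s) i = (s`_i)%R.
Proof. exact: tnth_mktuple. Qed.

Lemma to_tuple_id n (t : n.-tuple R) : to_tuple n t = t.
Proof. by apply: eq_from_tnth => i; rewrite tnth_to_tuple (tnth_nth 0%R). Qed.

Lemma to_tupleK n (s : seq R) : size s = n -> to_tuple n s = s :> seq R.
Proof. by move=> /eqP sn; rewrite -[s]/(val (Tuple sn)) to_tuple_id. Qed.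

Lemma measurable_to_tuple n : measurable_fun setT (fun t : n.-tuple R => to_tuple n t).
Proof. by under eq_fun do rewrite to_tuple_id; exact: measurable_id. Qed.

Lemma measurable_nth n j : measurable_fun setT (fun t : n.-tuple R => (t`_j)%R).
Proof.
have [jn|jn] := ltnP j n.
  rewrite (_ : (fun t => _) = (fun t : n.-tuple R => tnth t (Ordinal jn))).
    exact: measurable_tnth.
  by apply/funext => t; rewrite (tnth_nth 0%R).
rewrite (_ : (fun t => _) = cst 0%R)//.
by apply/funext => t; rewrite nth_default// size_tuple.
Qed.

Lemma measurable_mktuple d (X : measurableType d) n (f : X -> 'I_n -> R) :
  (forall i, measurable_fun setT (f ^~ i)) ->
  measurable_fun setT (fun x => [tuple f x i | i < n]).
Proof.
move=> mf; apply/measurable_fun_tnthP => i.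
rewrite (_ : _ \o _ = f ^~ i)//.
by apply/funext => x /=; rewrite tnth_mktuple.
Qed.

Lemma daniell_iint n :
  daniell (fun f : n.-tuple R -> \bar R => iint n (fun s => f (to_tuple n s))).
Proof.
have mf_to (f : n.-tuple R -> \bar R) : measurable_fun setT f ->
    measurable_at n (fun s => f (to_tuple n s)).
  by move=> mf; rewrite /measurable_at; under eq_fun do rewrite to_tuple_id.
split.
- exact: iint0.
- by move=> f f0; exact: iint_ge0.
- by move=> f g f0 g0 mf mg; rewrite iintD//; exact: mf_to.
- by move=> k f k0 f0 mf; rewrite iintZl//; exact: mf_to.
- move=> f f0 mf ndf; rewrite (iint_lim (f := fun k s => f k (to_tuple n s)))//.
  by move=> k; exact: mf_to.
Qed.

Section iint_substitution.
Variables (psi jac : R -> R) (D : set R).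
Hypothesis mpsi : measurable_fun setT psi.
Hypothesis mjac : measurable_fun setT jac.
Hypothesis jac_ge0 : forall x, (0 <= jac x)%R.
(* [jac] is the Jacobian of [psi] on [D], extended by 0. *)
Hypothesis integral_psi : forall h : R -> \bar R, (forall x, 0 <= h x) ->
  measurable_fun setT h -> (forall x, ~ D x -> h x = 0) ->
  \int[@lebesgue_measure R]_x h x =
  \int[@lebesgue_measure R]_x (h (psi x) * (jac x)%:E).

Let measurable_map_density n F x : measurable_at n.+1 F ->
  measurable_at n (fun s => F (psi x :: map psi s) * (\prod_(y <- s) jac y)%:E).
Proof.
move=> mF; apply: emeasurable_funM.
  rewrite (_ : (fun t => _) = (fun t : n.+1.-tuple R => F t) \o
    (fun t : n.-tuple R => [tuple of psi x :: [tuple of map psi t]]))//.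
  apply: measurableT_comp => //; apply: measurable_cons => //.
  apply/measurable_fun_tnthP => i.
  rewrite (_ : _ \o _ = fun t : n.-tuple R => psi (tnth t i)).
    by apply: measurableT_comp => //; exact: measurable_tnth.
  by apply/funext => t /=; rewrite tnth_map.
apply/measurable_EFinP => /=.
under eq_fun do rewrite big_tuple.
by apply: measurable_prod => i _; apply: measurableT_comp => //; exact: measurable_tnth.
Qed.

Lemma iint_change_of_variables n F : (forall s, 0 <= F s) -> measurable_at n F ->
    (forall s x, x \in s -> ~ D x -> F s = 0) ->
  iint n F = iint n (fun s => F (map psi s) * (\prod_(x <- s) jac x)%:E).
Proof.
elim: n F => [|n IH] F F0 mF FD /=; first by rewrite big_nil mule1.
have mh := measurable_iint_cons F0 mF.
rewrite integral_psi//; last 2 first.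
- by move=> x; exact: iint_ge0.
- move=> x Dx; rewrite -[RHS](iint0 n); apply: eq_iint => s _.
  by apply: (FD _ x) => //; rewrite mem_head.
apply: eq_integral => x _.
rewrite (IH (fun s => F (psi x :: s)))//; last 2 first.
- exact: measurable_at_cons.
- by move=> s y ys Dy; apply: (FD _ y) => //; rewrite inE ys orbT.
rewrite muleC -iintZl//; last exact: measurable_map_density.
  by apply: eq_iint => s _; rewrite big_cons EFinM muleCA.
by move=> s; rewrite mule_ge0// lee_fin prodr_ge0.
Qed.

End iint_substitution.

End iterated_integral.

(** * Integration on open intervals *)

(* The rules of the library, for functions written as abstractions. *)
Section derivation_rules.
Context (R : realType).
Implicit Types (f g : R -> R) (x k df dg : R).

Lemma is_derive1_cst k x : is_derive x (1 : R) (fun _ : R => k) 0.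
Proof. exact: is_derive_cst. Qed.

Lemma is_derive1D f g x df dg : is_derive x (1 : R) f df -> is_derive x (1 : R) g dg ->
  is_derive x (1 : R) (fun y => f y + g y) (df + dg).
Proof. exact: is_deriveD. Qed.

Lemma is_derive1B f g x df dg : is_derive x (1 : R) f df -> is_derive x (1 : R) g dg ->
  is_derive x (1 : R) (fun y => f y - g y) (df - dg).
Proof. exact: is_deriveB. Qed.

Lemma is_derive1M f g x df dg : is_derive x (1 : R) f df -> is_derive x (1 : R) g dg ->
  is_derive x (1 : R) (fun y => f y * g y) (f x * dg + g x * df).
Proof. exact: is_deriveM. Qed.

Lemma is_derive1Zl k f x df : is_derive x (1 : R) f df ->
  is_derive x (1 : R) (fun y => k * f y) (k * df).
Proof. exact: is_deriveZ. Qed.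

Lemma is_derive1X n f x df : is_derive x (1 : R) f df ->
  is_derive x (1 : R) (fun y => f y ^+ n.+1) (n.+1%:R * f x ^+ n * df).
Proof.
move=> Df; rewrite (_ : (fun y => _) = f ^+ n.+1); first exact: is_deriveX.
by apply/funext => y; rewrite exprfctE.
Qed.

Lemma is_derive1V f x df : f x != 0 -> is_derive x (1 : R) f df ->
  is_derive x (1 : R) (fun y => (f y)^-1) (- df / f x ^+ 2).
Proof.
move=> fx0 Df; apply: (is_derive_eq (is_deriveV fx0 Df)).
by rewrite /GRing.scale/= mulNr mulNr mulrC.
Qed.

Lemma is_derive1_mull k x : is_derive x (1 : R) (fun y => k * y) k.
Proof. by apply: (is_derive_eq (is_derive1Zl k (is_derive_id x 1))); rewrite mulr1. Qed.

Lemma is_derive1_mulr k x : is_derive x (1 : R) (fun y => y * k) k.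
Proof. by under eq_fun do rewrite mulrC; exact: is_derive1_mull. Qed.

Lemma is_derive1_sum (I : Type) (s : seq I) (f : I -> R -> R) (df : I -> R) x :
  (forall i, is_derive x (1 : R) (f i) (df i)) ->
  is_derive x (1 : R) (fun y => \sum_(i <- s) f i y) (\sum_(i <- s) df i).
Proof.
move=> Df; elim: s => [|i s IH].
  by under eq_fun do rewrite big_nil; rewrite big_nil; exact: is_derive_cst.
by under eq_fun do rewrite big_cons; rewrite big_cons; exact: is_derive1D.
Qed.

Lemma is_derive1_prod_log (I : Type) (s : seq I) (f : I -> R -> R) (l : I -> R) x :
  (forall i, is_derive x (1 : R) (f i) (l i * f i x)) ->
  is_derive x (1 : R) (fun y => \prod_(i <- s) f i y)
    ((\sum_(i <- s) l i) * \prod_(i <- s) f i x).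
Proof.
move=> Df; elim: s => [|i s IH].
  by under eq_fun do rewrite big_nil; rewrite !big_nil mul0r; exact: is_derive_cst.
under eq_fun do rewrite big_cons.
by rewrite !big_cons; apply: (is_derive_eq (is_derive1M (Df i) IH)); ring.
Qed.

End derivation_rules.

Section open_interval.
Context (R : realType).
Notation mu := (@lebesgue_measure R).
Implicit Types (f g F : R -> R) (a b u : R).

Lemma is_derive1_continuous F x (l : R) :
  is_derive x (1 : R) F l -> {for x, continuous F}.
Proof. by case=> dF _; exact/differentiable_continuous/derivable1_diffP. Qed.

Lemma integral_segment_FTC2 f F a b : a < b ->
  (forall x, a <= x <= b -> {for x, continuous f}) ->
  (forall x, a <= x <= b -> is_derive x (1 : R) F (f x)) ->
  (\int[mu]_(x in `[a, b]) (f x)%:E = (F b - F a)%:E)%E.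
Proof.
move=> ab cf dF.
have dF_oo x : x \in `]a, b[ -> is_derive x (1 : R) F (f x).
  by rewrite in_itv/= => /andP[ax xb]; apply: dF; rewrite !ltW.
rewrite (@continuous_FTC2 _ f F a b)//.
- by apply: continuous_in_subspaceT => x; rewrite inE/= in_itv/=; exact: cf.
- split.
  + by move=> x /dF_oo[].
  + by apply/cvg_at_right_filter/is_derive1_continuous/dF; rewrite lexx ltW.
  + by apply/cvg_at_left_filter/is_derive1_continuous/dF; rewrite lexx ltW.
- by move=> x /dF_oo ?; rewrite derive1E derive_val.
Qed.

Definition inner_segment a b n : set R :=
  `[a + (b - a) / n.+3%:R, b - (b - a) / n.+3%:R]%classic.

Section inner_segment.
Variables (a b : R).
Hypothesis ab : a < b.

Lemma inner_segment_lt n : a + (b - a) / n.+3%:R < b - (b - a) / n.+3%:R.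
Proof.
have gap_lt : (b - a) / n.+3%:R < (b - a) / 2.
  by rewrite ltr_pM2l ?subr_gt0// ltf_pV2 ?posrE// ltr_nat.
by rewrite ltrBrDr -addrA -ltrBrDl (lt_le_trans (ltrD gap_lt gap_lt))// -splitr.
Qed.

Lemma inner_segment_sub n x : inner_segment a b n x -> a < x < b.
Proof.
have gap_gt0 : 0 < (b - a) / n.+3%:R by rewrite divr_gt0 ?subr_gt0.
rewrite /inner_segment/= in_itv/= => /andP[ax xb]; apply/andP; split.
  by rewrite (lt_le_trans _ ax)// ltrDl.
by rewrite (le_lt_trans xb)// ltrBlDr ltrDl.
Qed.

Lemma nondecreasing_inner_segment : nondecreasing_seq (inner_segment a b).
Proof.
move=> m n mn; apply/subsetPset => x; rewrite /inner_segment/= !in_itv/= => /andP[xa xb].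
have gap_le : (b - a) / n.+3%:R <= (b - a) / m.+3%:R.
  by rewrite ler_pM2l ?subr_gt0// lef_pV2 ?posrE// ler_nat !ltnS.
by rewrite (le_trans _ xa) ?(le_trans xb)// ?lerD2l// lerN2.
Qed.

Lemma cvg_inner_segment_gap : (b - a) / n.+3%:R @[n --> \oo] --> (0 : R).
Proof.
rewrite -[X in _ --> X](mulr0 (b - a)); apply: cvgM; first exact: cvg_cst.
have := @cvg_harmonic R; rewrite -(cvg_shiftn 2) => cvg_harmonic2.
rewrite (_ : (fun x => _) = [sequence harmonic (n + 2)%N]_n)//.
by apply/funext => n; rewrite /= addn2.
Qed.

Lemma bigcup_inner_segment : \bigcup_n inner_segment a b n = `]a, b[%classic.
Proof.
apply/seteqP; split => [x|x].
  by case=> n _ /inner_segment_sub; rewrite /= in_itv.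
rewrite /= in_itv/= => /andP[ax xb].
have : \forall n \near \oo, (b - a) / n.+3%:R < Num.min (x - a) (b - x).
  apply: (cvgr_lt (0 : R)); first exact: cvg_inner_segment_gap.
  by rewrite lt_min !subr_gt0 ax xb.
case=> N _ /(_ N (leqnn N)) /=; rewrite lt_min => /andP[gap_left gap_right].
exists N => //; rewrite /inner_segment/= in_itv/=.
by move: (_ / _) gap_left gap_right => gap gap_left gap_right; apply/andP; split; lra.
Qed.

Lemma cvg_integral_inner_segment f : (forall x, a < x < b -> 0 <= f x) ->
  (forall x, a < x < b -> {for x, continuous f}) ->
  (\int[mu]_(x in inner_segment a b n) (f x)%:E @[n --> \oo] -->
    \int[mu]_(x in `]a, b[) (f x)%:E)%E.
Proof.
move=> f0 cf; rewrite -bigcup_inner_segment.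
apply: ge0_nondecreasing_set_cvg_integral.
- exact: nondecreasing_inner_segment.
- by move=> n; exact: measurable_itv.
- move=> n; apply/measurable_EFinP.
  apply: (@measurable_funS _ _ _ _ `]a, b[%classic) => //.
    by move=> x /inner_segment_sub; rewrite /= in_itv.
  apply: open_continuous_measurable_fun => // x.
  by rewrite mem_setE in_itv/=; exact: cf.
- by move=> n x /inner_segment_sub; rewrite lee_fin; exact: f0.
Qed.

End inner_segment.

(* The two integrals may be infinite, so that the difference cannot be integrated directly;
   on each inner segment all the terms are finite. *)
Lemma ge0_FTC2_ooB f g F a b la lb : a < b ->
  (forall x, a < x < b -> 0 <= f x) -> (forall x, a < x < b -> 0 <= g x) ->
  (forall x, a < x < b -> {for x, continuous f}) ->
  (forall x, a < x < b -> {for x, continuous g}) ->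
  (forall x, a < x < b -> is_derive x (1 : R) F (f x - g x)) ->
  F x @[x --> a^'+] --> la -> F x @[x --> b^'-] --> lb ->
  (\int[mu]_(x in `]a, b[) (f x)%:E = \int[mu]_(x in `]a, b[) (g x)%:E + (lb - la)%:E)%E.
Proof.
move=> ab f0 g0 cf cg dF Fa Fb.
pose an n : R := a + (b - a) / n.+3%:R; pose bn n : R := b - (b - a) / n.+3%:R.
have sub n x : an n <= x <= bn n -> a < x < b.
  by move=> xn; apply: (inner_segment_sub ab (n := n)); rewrite /inner_segment/= in_itv.
have integral_inner n : (\int[mu]_(x in inner_segment a b n) (f x)%:E =
    \int[mu]_(x in inner_segment a b n) (g x)%:E + (F (bn n) - F (an n))%:E)%E.
  have iC (h : R -> R) : (forall x, a < x < b -> {for x, continuous h}) ->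
      mu.-integrable (inner_segment a b n) (EFin \o h).
    move=> ch; apply: continuous_compact_integrable; first exact: segment_compact.
    by apply: continuous_in_subspaceT => x; rewrite inE => /(inner_segment_sub ab)/ch.
  have cfg x : a < x < b -> {for x, continuous (fun x => f x - g x)}.
    by move=> xab; apply: continuousB; [exact: cf|exact: cg].
  have <- : (\int[mu]_(x in inner_segment a b n) (f x - g x)%:E =
      (F (bn n) - F (an n))%:E)%E.
    apply: integral_segment_FTC2; first exact: inner_segment_lt.
      by move=> x /sub/cfg.
    by move=> x /sub/dF.
  rewrite -integralD; [|exact: measurable_itv|exact: iC|exact: iC].
  by apply: eq_integral => x _; rewrite -EFinD addrC subrK.
have cvg_inner : (F (bn n) - F (an n))%:E @[n --> \oo] --> ((lb - la)%:E : \bar R).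
  apply: cvg_EFin; first exact: nearW.
  have gap := @cvg_inner_segment_gap a b; have gap0 n : 0 < (b - a) / n.+3%:R.
    by rewrite divr_gt0 ?subr_gt0.
  apply: cvgB.
  - move/cvg_at_leftP: Fb; apply; split => [n|]; first by rewrite ltrBlDr ltrDl.
    by rewrite -[X in _ --> X]subr0; apply: cvgB gap; exact: cvg_cst.
  - move/cvg_at_rightP: Fa; apply; split => [n|]; first by rewrite ltrDl.
    by rewrite -[X in _ --> X]addr0; apply: cvgD gap; exact: cvg_cst.
have cvg_f := cvg_integral_inner_segment ab f0 cf.
apply: (cvg_unique _ cvg_f) => //.
rewrite (_ : (fun n => _) = fun n =>
  (\int[mu]_(x in inner_segment a b n) (g x)%:E + (F (bn n) - F (an n))%:E)%E).
  by apply: cvgeD cvg_inner; [rewrite fin_num_adde_defl|exact: cvg_integral_inner_segment].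
exact/funext.
Qed.

Lemma ge0_FTC2_oo f F a b la lb : a < b ->
  (forall x, a < x < b -> 0 <= f x) ->
  (forall x, a < x < b -> {for x, continuous f}) ->
  (forall x, a < x < b -> is_derive x (1 : R) F (f x)) ->
  F x @[x --> a^'+] --> la -> F x @[x --> b^'-] --> lb ->
  (\int[mu]_(x in `]a, b[) (f x)%:E = (lb - la)%:E)%E.
Proof.
move=> ab f0 cf dF Fa Fb.
have := @ge0_FTC2_ooB f (fun=> 0) F a b la lb ab f0 (fun _ _ => lexx 0) cf _ _ Fa Fb.
rewrite integral0 add0e; apply=> x xab; first exact: cst_continuous.
by rewrite subr0; exact: dF.
Qed.

End open_interval.

Section change_of_variables.
Context (R : realType).
Notation mu := (@lebesgue_measure R).
Variables (F f : R -> R) (a b : R).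
Hypothesis ab : a < b.
Hypothesis cF : continuous F.
Hypothesis cf : continuous f.
Hypothesis dF : forall x, a < x < b -> is_derive x (1 : R) F (f x).
Hypothesis f0 : forall x, a < x < b -> 0 <= f x.
Hypothesis Finc : forall x y, a <= x -> y <= b -> x < y -> F x < F y.

Let F_le x y : a <= x -> y <= b -> x <= y -> F x <= F y.
Proof.
move=> ax yb; rewrite le_eqVlt => /predU1P[->//|xy].
by apply: ltW; exact: Finc.
Qed.

Let ray_preimage u : exists2 c, a <= c <= b &
  `]a, b[ `&` F @^-1` `]u, +oo[ = `]c, b[%classic /\
  `]F a, F b[ `&` `]u, +oo[ = `]F c, F b[%classic.
Proof.
suff [c cab [preimageE imageE]] : exists2 c, a <= c <= b &
    (forall x, a < x < b -> (u < F x) = (c < x)) /\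
    (forall y, F a < y < F b -> (u < y) = (F c < y)).
  have [ac cb] := andP cab; exists c => //.
  split; apply/seteqP; split => x /=; rewrite !in_itv/= ?andbT.
  - by move=> [xab]; rewrite preimageE// => ->; case/andP: xab.
  - move=> /andP[cx xb]; have xab : a < x < b by rewrite xb (le_lt_trans ac).
    by rewrite preimageE.
  - by move=> [xab]; rewrite imageE// => ->; case/andP: xab.
  - move=> /andP[cx xb]; have xab : F a < x < F b by rewrite xb (le_lt_trans _ cx)// F_le.
    by rewrite imageE.
have [uFa|Fau] := leP u (F a).
  exists a; first by rewrite lexx ltW.
  split=> [x /andP[ax xb]|y /andP[ay yb]]; last by rewrite ay (le_lt_trans uFa).
  by rewrite ax (le_lt_trans uFa)// Finc// ltW.
have [Fbu|uFb] := leP (F b) u.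
  exists b; first by rewrite lexx ltW.
  split=> [x /andP[ax xb]|y /andP[ay yb]].
    by rewrite !ltNge (ltW xb) (le_trans _ Fbu)// F_le// ltW.
  by rewrite !ltNge (ltW yb) (le_trans (ltW yb)).
have [||c] := @IVT R F a b u (ltW ab).
- exact: continuous_subspaceT.
- by rewrite ge_min le_max (ltW Fau) (ltW uFb) orbT.
rewrite in_itv/= => /andP[ac cb] Fc; exists c; first by rewrite ac.
split=> [x /andP[ax xb]|y _]; last by rewrite Fc.
rewrite -Fc; have [cx|xc] := ltP c x; first by rewrite Finc// ltW.
by apply/negbTE; rewrite -leNgt F_le// ltW.
Qed.

Let integral_derivative c : a <= c <= b ->
  (\int[mu]_(x in `]c, b[) (f x)%:E = mu `]F c, F b[%classic)%E.
Proof.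
move=> /andP[ac]; rewrite le_eqVlt => /predU1P[->|cb].
  by rewrite !set_itvoo0 ?lexx// integral_set0 measure0.
rewrite lebesgue_measure_itv/= lte_fin Finc// -EFinB.
apply: (@ge0_FTC2_oo _ f F) => //.
- by move=> x /andP[cx xb]; apply: f0; rewrite (le_lt_trans ac).
- by move=> x _; exact: cf.
- by move=> x /andP[cx xb]; apply: dF; rewrite xb (le_lt_trans ac).
- by apply: cvg_at_right_filter; exact: cF.
- by apply: cvg_at_left_filter; exact: cF.
Qed.

Let daniell_image :
  @daniell R _ (measurableTypeR R) (fun h => \int[mu]_(x in `]a, b[) (h (F x) * (f x)%:E))%E.
Proof.
pose rho x := f x * \1_(`]a, b[%classic : set R) x.
rewrite (_ : (fun h => _) = fun h : R -> \bar R => (\int[mu]_x (h (F x) * (rho x)%:E))%E).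
  apply: (daniell_density (daniell_integral mu measurableT)).
  - exact: continuous_measurable_fun.
  - by apply: measurable_funM; [exact: continuous_measurable_fun|exact: measurable_indic].
  - move=> x; rewrite /rho indicE; case: (boolP (_ \in _)); last by rewrite mulr0.
    by rewrite inE/= in_itv/= => /f0; rewrite mulr1.
apply/funext => h; rewrite integral_mkcond; apply: eq_integral => x _.
by rewrite patchE /rho indicE; case: ifPn => _; rewrite ?mulr1 ?mulr0 ?mule0.
Qed.

Let daniell_target : @daniell R _ (measurableTypeR R) (fun h => \int[mu]_(y in `]F a, F b[) h y)%E.
Proof. by apply: daniell_integral; exact: measurable_itv. Qed.

(* The rays generate the Borel sets. *)
Let eq_image_target (A : set (measurableTypeR R)) : measurable A ->
  daniell_measure daniell_target A = daniell_measure daniell_image A.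
Proof.
apply: (@measure_unique _ R (measurableTypeR R) (@RGenOInfty.G R)
  (fun k => `]- k%:R, +oo[%classic)).
- exact: RGenOInfty.measurableE.
- move=> _ _ [x ->] [y ->]; exists (Num.max x y).
  apply/seteqP; split => z /=; rewrite !in_itv/= !andbT gt_max.
    by case=> -> ->.
  by move=> /andP[].
- by move=> k; exists (- k%:R).
- apply/seteqP; split => // x _.
  exists (Num.truncn `|x|).+1 => //=; rewrite in_itv/= andbT ltrNl.
  by rewrite (le_lt_trans (ler_norm _))// normrN truncnS_gt.
- move=> _ [u ->]; have [c cab [preimageE imageE]] := ray_preimage u.
  rewrite /= /daniell_measure integral_indic//= setIC imageE -integral_derivative// -preimageE.
  rewrite [LHS]integral_mkcondr; apply: eq_integral => x _.
  rewrite patchE /= indicE (_ : (x \in _) = (F x \in `]u, +oo[%classic)).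
    by case: (_ \in _); rewrite ?mul1e ?mul0e.
  by apply/idP/idP; rewrite !inE.
- move=> k; rewrite /= /daniell_measure integral_indic//=.
  apply: (@le_lt_trans _ _ (mu `]F a, F b[%classic)).
    by apply: le_measure; rewrite ?inE//; apply: measurableI.
  by rewrite lebesgue_measure_itv/=; case: ifP => _; rewrite -?EFinB ltry.
Qed.

Lemma change_of_variables (h : R -> \bar R) :
  (forall x, 0 <= h x)%E -> measurable_fun setT h ->
  (\int[mu]_(y in `]F a, F b[) h y = \int[mu]_(x in `]a, b[) (h (F x) * (f x)%:E))%E.
Proof.
move=> h0 mh; transitivity (\int[daniell_measure daniell_target]_x h x)%E.
  by rewrite integral_daniell_measure.
transitivity (\int[daniell_measure daniell_image]_x h x)%E; last first.
  by rewrite integral_daniell_measure.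
by apply: eq_measure_integral => A mA _; exact: eq_image_target.
Qed.

End change_of_variables.

(** * The law of eigenvalues and weights *)

Section box.
Context (R : realType).
Implicit Types n m : nat.

Definition box n (A : 'I_n -> set R) : set (n.-tuple R) :=
  [set x | forall i, A i (tnth x i)].

Lemma box_setT n : box (fun _ : 'I_n => setT) = setT.
Proof. exact/seteqP. Qed.

Lemma boxI n (A B : 'I_n -> set R) : box A `&` box B = box (fun i => A i `&` B i).
Proof.
apply/seteqP; split => x /=; first by move=> [xA xB] i.
by move=> xAB; split => i; have [] := xAB i.
Qed.

Lemma measurable_box n (A : 'I_n -> set R) :
  (forall i, measurable (A i)) -> measurable (box A).
Proof.
move=> mA.
rewrite (_ : box A = \bigcap_(i in setT) [set x : n.-tuple R | A i (tnth x i)]).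
  apply: fin_bigcap_measurable => // i _.
  by have := @measurable_tnth _ R n i measurableT (A i) (mA i); rewrite setTI.
by apply/seteqP; split=> [x xA i _|x xA i]; [exact: xA|exact: (xA i)].
Qed.

Definition box_pairs n m : set (set (n.-tuple R * m.-tuple R)) :=
  [set C | exists A B, [/\ forall i, measurable (A i), forall i, measurable (B i) &
    C = box A `*` box B]].

Lemma measurable_tuple_pairE n m :
  @measurable _ (n.-tuple R * m.-tuple R)%type = <<s @box_pairs n m >>.
Proof.
apply/seteqP; split; last first.
  apply: smallest_sub; first exact: sigma_algebra_measurable.
  by move=> _ [A [B [mA mB ->]]]; apply: measurableX; exact: measurable_box.
have boxX1 (i : 'I_n) (A : set R) : measurable A ->
    box_pairs (n := n) (m := m) [set x | A (tnth x.1 i)].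
  move=> mA; exists (fun j => if j == i then A else setT), (fun=> setT).
  split=> [j||]; [by case: ifP|by []|].
  rewrite box_setT; apply/seteqP; split=> x /=.
    by move=> Ax; split => // j; case: eqP => [->|].
  by move=> [/(_ i)]; rewrite eqxx.
have boxX2 (i : 'I_m) (A : set R) : measurable A ->
    box_pairs (n := n) (m := m) [set x | A (tnth x.2 i)].
  move=> mA; exists (fun=> setT), (fun j => if j == i then A else setT).
  split=> [|j|]; [by []|by case: ifP|].
  rewrite box_setT; apply/seteqP; split=> x /=.
    by move=> Ax; split => // j; case: eqP => [->|].
  by move=> [_ /(_ i)]; rewrite eqxx.
pose G := g_sigma_algebraType (@box_pairs n m).
have mid : @measurable_fun _ _ G (n.-tuple R * m.-tuple R)%type setT
    (fun x => (x.1, x.2)).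
  apply: measurable_fun_pair; apply/measurable_fun_tnthP => i _ A mA;
    rewrite setTI; apply: sub_sigma_algebra; [exact: boxX1|exact: boxX2].
move=> C mC; have := mid measurableT C mC; rewrite setTI.
by rewrite (_ : _ @^-1` C = C)//; apply/seteqP; split => -[].
Qed.

Lemma eq_measure_box_pairs n m (mu nu : {measure set (n.-tuple R * m.-tuple R) -> \bar R}) :
  (mu setT < +oo)%E ->
  (forall A B, (forall i, measurable (A i)) -> (forall i, measurable (B i)) ->
    mu (box A `*` box B) = nu (box A `*` box B)) ->
  forall C, measurable C -> mu C = nu C.
Proof.
move=> mu_fin munu C mC.
have setTE : box (fun _ : 'I_n => setT) `*` box (fun _ : 'I_m => setT) = setT :> set (_ * _).
  by rewrite !box_setT setXTT.
apply: (@measure_unique _ R _ (@box_pairs n m) (fun=> setT)) mC => //.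
- exact: measurable_tuple_pairE.
- move=> _ _ [A1 [B1 [mA1 mB1 ->]]] [A2 [B2 [mA2 mB2 ->]]].
  exists (fun i => A1 i `&` A2 i), (fun i => B1 i `&` B2 i); split.
  + by move=> i; exact: measurableI.
  + by move=> i; exact: measurableI.
  + by rewrite -setXI !boxI.
- by move=> _; exists (fun=> setT), (fun=> setT).
- by apply/seteqP; split => // x _; exists 0%N.
- by move=> _ [A [B [mA mB ->]]]; exact: munu.
Qed.

End box.

(* The image under [phi] of the probability on R^n with density proportional to [rho]; the law
   has total mass 0 when [rho] cannot be normalised. *)
Section density_law.
Local Open Scope ereal_scope.
Context (R : realType) (n m : nat).
Variables (phi : seq R -> m.-tuple R) (rho : seq R -> R).
Hypothesis mphi : measurable_fun setT (fun t : n.-tuple R => phi t).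
Hypothesis mrho : measurable_fun setT (fun t : n.-tuple R => rho t).
Hypothesis rho0 : forall s, (0 <= rho s)%R.

Definition density_mass : \bar R := iint n (fun s => (rho s)%:E).

Definition normalized_density s : R := (rho s / fine density_mass)%R.

Let density_mass_ge0 : 0 <= density_mass.
Proof. by apply: iint_ge0 => s; rewrite lee_fin. Qed.

Let invr_density_mass_ge0 : (0 <= (fine density_mass)^-1)%R.
Proof. by rewrite invr_ge0 fine_ge0. Qed.

Lemma daniell_density_law : daniell (fun f : m.-tuple R -> \bar R =>
  iint n (fun s => f (phi (to_tuple n s)) * (normalized_density (to_tuple n s))%:E)).
Proof.
have mnd : measurable_fun setT (fun t : n.-tuple R => normalized_density t).
  exact: measurable_funM.
have nd0 (t : n.-tuple R) : (0 <= normalized_density t)%R by rewrite mulr_ge0.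
exact: (daniell_density (daniell_iint R n) mphi mnd nd0).
Qed.

Definition density_law := daniell_measure daniell_density_law.
HB.instance Definition _ := Measure.on density_law.

Lemma integral_density_law (f : m.-tuple R -> \bar R) : (forall x, 0 <= f x) ->
  measurable_fun setT f ->
  \int[density_law]_x f x =
  iint n (fun s => f (phi s) * (rho s)%:E) * ((fine density_mass)^-1)%:E.
Proof.
move=> f0 mf; rewrite integral_daniell_measure// muleC -iintZl//.
- by apply: eq_iint => s sn; rewrite to_tupleK// EFinM muleA muleC.
- by move=> s; rewrite mule_ge0 ?lee_fin.
- apply: emeasurable_funM; first exact: (measurableT_comp mf mphi).
  exact/measurable_EFinP.
Qed.

Lemma density_lawE (A : set (m.-tuple R)) : measurable A ->
  density_law A = iint n (fun s => (rho s * \1_A (phi s))%:E) * ((fine density_mass)^-1)%:E.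
Proof.
move=> mA; rewrite -[A in LHS]setIT -integral_indic// integral_density_law//.
  by congr (_ * _); apply: eq_iint => s _; rewrite -EFinM mulrC.
exact/measurable_EFinP/measurable_indic.
Qed.

Lemma density_law_setT : density_law setT = density_mass * ((fine density_mass)^-1)%:E.
Proof.
rewrite density_lawE//; congr (_ * _); apply: eq_iint => s _.
by rewrite indicE in_setT mulr1.
Qed.

Lemma density_law_setT01 : density_law setT = 0 \/ density_law setT = 1.
Proof.
rewrite density_law_setT; move: density_mass density_mass_ge0 => [z|_|]//.
  rewrite lee_fin => z0; have [->|zn0] := eqVneq z 0%R; first by left; rewrite mul0e.
  by right; rewrite -EFinM divff.
by left; rewrite invr0 mule0.
Qed.

Let density_law_setT_le1 : density_law setT <= 1.
Proof. by case: density_law_setT01 => ->; rewrite ?lee01. Qed.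

HB.instance Definition _ := Measure_isSubProbability.Build _ _ _ density_law density_law_setT_le1.

Lemma density_mass_gt0 : density_law setT = 1 ->
  exists2 z : R, (0 < z)%R & density_mass = z%:E.
Proof.
rewrite density_law_setT; move: density_mass density_mass_ge0 => [z|_|]//.
  rewrite lee_fin le_eqVlt => /predU1P[<-|z0 _]; last by exists z.
  by rewrite /= mul0e => /esym/eqP; rewrite onee_eq0.
by rewrite invr0 mule0 => /esym/eqP; rewrite onee_eq0.
Qed.

End density_law.

Section jacobi_density.
Context (R : realType).
Implicit Types (beta a b : R) (n : nat).

(* The exponent [e_beta] of the Jacobi ensemble. *)
Definition exponent_shift beta n : R := beta / 2 * (n.-1)%:R + 1.

Lemma jac_densE n beta a b (s : seq R) : size s = n ->
  jac_dens beta a b s =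
  (\prod_(i < n) \prod_(j < n | (i < j)%N) (`|s`_i - s`_j| `^ beta)) *
  (\prod_(i < n) (s`_i `^ (a - exponent_shift beta n) *
     (1 - s`_i) `^ (b - exponent_shift beta n) * \1_[set x : R | 0 < x < 1] s`_i)).
Proof. by move=> <-. Qed.

Lemma jac_dens_ge0 beta a b (s : seq R) : 0 <= jac_dens beta a b s.
Proof.
apply: mulr_ge0; apply: prodr_ge0 => i _.
  by apply: prodr_ge0 => j _; exact: powR_ge0.
by rewrite !mulr_ge0 ?powR_ge0.
Qed.

Lemma jac_dens_eq0 beta a b (s : seq R) (x : R) :
  x \in s -> ~~ (0 < x < 1) -> jac_dens beta a b s = 0.
Proof.
move=> xs x01; rewrite /jac_dens; apply/eqP; rewrite mulf_eq0; apply/orP; right.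
have ix : (index x s < size s)%N by rewrite index_mem.
rewrite (bigD1 (Ordinal ix))//= nth_index//.
have -> : \1_[set x : R | 0 < x < 1] x = 0 :> R by rewrite indicE memNset//; exact/negP.
by rewrite mulr0 mul0r.
Qed.

Lemma measurable_jac_dens n beta a b :
  measurable_fun setT (fun t : n.-tuple R => jac_dens beta a b t).
Proof.
under eq_fun => t do rewrite (jac_densE beta a b (size_tuple t)).
apply: measurable_funM.
  apply: measurable_prod => i _; under eq_fun do rewrite big_mkcond/=.
  apply: measurable_prod => j _; case: (i < j)%N => //.
  apply: (measurableT_comp (measurable_powR _)); apply: measurableT_comp => //.
  by apply: measurable_funB; exact: measurable_nth.
apply: measurable_prod => i _; apply: measurable_funM; first apply: measurable_funM.
- by apply: (measurableT_comp (measurable_powR _)); exact: measurable_nth.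
- apply: (measurableT_comp (measurable_powR _)).
  by apply: measurable_funB => //; exact: measurable_nth.
- apply: measurableT_comp; last exact: measurable_nth.
  apply: measurable_indic.
  rewrite (_ : [set x : R | _] = `]0, 1[%classic); first exact: measurable_itv.
  by apply/seteqP; split => x /=; rewrite in_itv.
Qed.

Definition jac_law beta a b n := @density_law R n n (to_tuple n) (jac_dens beta a b)
  (@measurable_to_tuple R n) (@measurable_jac_dens n beta a b) (jac_dens_ge0 beta a b).
HB.instance Definition _ beta a b n := SubProbability.on (@jac_law beta a b n).

Lemma jac_law_box n beta a b (A : 'I_n -> set R) : (forall i, measurable (A i)) ->
  @jac_law beta a b n (box A) = jac_prob beta a b A.
Proof.
move=> mA; rewrite /jac_law density_lawE; last exact: measurable_box.
congr (_ * _)%E; apply: eq_iint => s sn; congr (_ * _)%:E.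
rewrite !indicE; congr ((nat_of_bool _)%:R); apply/idP/idP; rewrite !inE => sA i.
  by have := sA i; rewrite tnth_to_tuple.
by rewrite tnth_to_tuple; exact: sA.
Qed.

Lemma jac_law_support n beta a b :
  @jac_law beta a b n (box (fun=> `]0, 1[%classic)) = @jac_law beta a b n setT.
Proof.
rewrite -box_setT !jac_law_box//; congr (_ * _)%E; apply: eq_iint => s sn.
have [s01|] := pselect (forall i : 'I_n, `]0, 1[%classic s`_i).
  by rewrite !indicE !mem_set.
move=> /existsNP[i]; rewrite /= in_itv/= => /negP si.
by rewrite (jac_dens_eq0 beta a b _ si) ?mul0r// mem_nth// sn.
Qed.

End jacobi_density.
Arguments jac_law {R} beta a b n A.

Section dirichlet_density.
Context (R : realType).
Implicit Types (c : R) (n m : nat).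

Lemma dir_densE m c (u : seq R) : size u = m ->
  dir_dens c u = (\prod_(i < m) (u`_i `^ (c - 1))) *
  ((1 - \sum_(i < m) u`_i) `^ (c - 1)) *
  ((\prod_(i < m) \1_(`]0, +oo[%classic : set R) u`_i) *
   \1_(`]-oo, 1[%classic : set R) (\sum_(i < m) u`_i)).
Proof.
move=> <-; rewrite /dir_dens; congr (_ * _).
rewrite [LHS]indicE; case: (boolP (u \in _)).
  rewrite inE/= => -[u0 u1].
  rewrite big1 ?mul1r; last first.
    by move=> i _; rewrite indicE mem_setE in_itv/= u0.
  by rewrite indicE mem_setE in_itv/= u1.
rewrite notin_setE/=.
have [u1 /not_andP[|//]|u1 _] := ltP (\sum_(i < size u) u`_i) 1; last first.
  by rewrite [X in _ * X]indicE mem_setE in_itv/= ltNge u1/= mulr0.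
move=> /existsNP[i /negP ui].
by rewrite (bigD1 i)//= indicE mem_setE in_itv/= andbT (negbTE ui) !mul0r.
Qed.

Lemma dir_dens_ge0 c (u : seq R) : 0 <= dir_dens c u.
Proof.
rewrite /dir_dens !mulr_ge0 ?powR_ge0//.
by apply: prodr_ge0 => i _; exact: powR_ge0.
Qed.

Lemma dir_dens_eq0 m c (u : seq R) : size u = m ->
  ~ ((forall i : 'I_m, 0 < u`_i) /\ \sum_(i < m) u`_i < 1) -> dir_dens c u = 0.
Proof. by move=> <- h; rewrite /dir_dens indicE memNset// mulr0. Qed.

Lemma measurable_dir_dens m c :
  measurable_fun setT (fun t : m.-tuple R => dir_dens c t).
Proof.
under eq_fun => t do rewrite (dir_densE c (size_tuple t)).
have ms : measurable_fun setT (fun t : m.-tuple R => \sum_(i < m) t`_i).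
  by apply: measurable_sum => i; exact: measurable_nth.
apply: measurable_funM; first apply: measurable_funM.
- apply: measurable_prod => i _.
  by apply: (measurableT_comp (measurable_powR _)); exact: measurable_nth.
- apply: (measurableT_comp (measurable_powR _)).
  exact: measurable_funB.
- apply: measurable_funM; last first.
    by apply: measurableT_comp => //; exact: measurable_indic.
  apply: measurable_prod => i _; apply: measurableT_comp; last exact: measurable_nth.
  exact: measurable_indic.
Qed.

Definition dir_tuple n (u : seq R) : n.-tuple R := [tuple dir_ext u i | i < n].

Lemma measurable_dir_tuple n :
  measurable_fun setT (fun t : n.-1.-tuple R => dir_tuple n t).
Proof.
apply: measurable_mktuple => i; rewrite /dir_ext; case: (i < n.-1)%N; first exact: measurable_nth.
by apply: measurable_funB => //; apply: measurable_sum => j; exact: measurable_nth.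
Qed.

Definition dir_law c n := @density_law R n.-1 n (dir_tuple n) (dir_dens c)
  (@measurable_dir_tuple n) (@measurable_dir_dens n.-1 c) (dir_dens_ge0 c).
HB.instance Definition _ c n := SubProbability.on (@dir_law c n).

Lemma dir_law_box n c (B : 'I_n -> set R) : (forall i, measurable (B i)) ->
  @dir_law c n (box B) = dir_prob c B.
Proof.
move=> mB; rewrite /dir_law density_lawE; last exact: measurable_box.
congr (_ * _)%E; apply: eq_iint => s _; congr (_ * _)%:E.
rewrite !indicE; congr ((nat_of_bool _)%:R); apply/idP/idP; rewrite !inE => sB i.
  by have := sB i; rewrite tnth_mktuple.
by rewrite tnth_mktuple; exact: sB.
Qed.

Lemma dir_law_support n c :
  @dir_law c n (box (fun=> `]0, +oo[%classic)) = @dir_law c n setT.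
Proof.
rewrite -box_setT !dir_law_box//; congr (_ * _)%E; apply: eq_iint => u un; congr (_%:E).
have [[u0 u1]|notin_simplex] := pselect
    ((forall i : 'I_n.-1, 0 < u`_i) /\ \sum_(i < n.-1) u`_i < 1); last first.
  by rewrite (dir_dens_eq0 c un notin_simplex) !mul0r.
rewrite !indicE !mem_set// => i /=; rewrite in_itv/= andbT /dir_ext.
case: ifPn => [in1|_]; last by rewrite subr_gt0.
exact: (u0 (Ordinal in1)).
Qed.

End dirichlet_density.
Arguments dir_law {R} c n A.

(* The weights are Dirichlet with all the parameters equal to [c], which is [beta / 2] in the
   theorem. *)
Record jacobi_ensemble (R : realType) (d : measure_display) (T : measurableType d)
    (P : probability T R) (beta a b c : R) (n : nat) (lam w : T -> 'I_n -> R) : Prop :=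
  JacobiEnsemble {
    measurable_eigenvalue : forall i, measurable_fun setT (fun t => lam t i);
    measurable_weight : forall i, measurable_fun setT (fun t => w t i);
    ensemble_prob : forall A B : 'I_n -> set R,
      (forall i, measurable (A i)) -> (forall i, measurable (B i)) ->
      P [set t | forall i : 'I_n, A i (lam t i) /\ B i (w t i)] =
      (jac_prob beta a b A * dir_prob c B)%E }.

Section ensemble_law.
Local Open Scope ereal_scope.
Context (R : realType) (d : measure_display) (T : measurableType d).
Variables (P : probability T R) (beta a b c : R) (n : nat) (lam w : T -> 'I_n -> R).
Hypothesis ensP : jacobi_ensemble P beta a b c lam w.

Definition eigenvalue_tuple t : n.-tuple R := [tuple lam t i | i < n].
Definition weight_tuple t : n.-tuple R := [tuple w t i | i < n].

Definition eigenvalue_weight t := (eigenvalue_tuple t, weight_tuple t).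

Let measurable_eigenvalue_weight : measurable_fun setT eigenvalue_weight.
Proof.
apply: measurable_fun_pair; apply: measurable_mktuple.
- exact: measurable_eigenvalue ensP.
- exact: measurable_weight ensP.
Qed.

Let preimage_boxX (A B : 'I_n -> set R) :
  eigenvalue_weight @^-1` (box A `*` box B) =
  [set t | forall i, A i (lam t i) /\ B i (w t i)].
Proof.
apply/seteqP; split => t /=.
  by move=> [tA tB] i; have := tA i; have := tB i; rewrite !tnth_mktuple.
by move=> tAB; split => i; rewrite tnth_mktuple; have [] := tAB i.
Qed.

Let prob_boxX (A B : 'I_n -> set R) :
  (forall i, measurable (A i)) -> (forall i, measurable (B i)) ->
  P [set t | forall i, A i (lam t i) /\ B i (w t i)] =
  jac_law beta a b n (box A) * dir_law c n (box B).
Proof. by move=> mA mB; rewrite (ensemble_prob ensP)// jac_law_box// dir_law_box. Qed.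

Let mass_prod : jac_law beta a b n setT * dir_law c n setT = 1.
Proof.
rewrite -box_setT -prob_boxX// -[RHS](@probability_setT _ _ _ P).
by congr (P _); apply/seteqP; split.
Qed.

Lemma ensemble_jac_law_setT : jac_law beta a b n setT = 1.
Proof.
have [mass0|//] : jac_law beta a b n setT = 0 \/ jac_law beta a b n setT = 1.
  exact: density_law_setT01.
by have := mass_prod; rewrite mass0 mul0e => /esym/eqP; rewrite onee_eq0.
Qed.

Lemma ensemble_dir_law_setT : dir_law c n setT = 1.
Proof. by have := mass_prod; rewrite ensemble_jac_law_setT mul1e. Qed.

Lemma ensemble_jac_mass :
  exists2 z : R, (0 < z)%R & density_mass n (jac_dens beta a b) = z%:E.
Proof.
exact: (@density_mass_gt0 _ _ _ _ _ (@measurable_to_tuple R n) (@measurable_jac_dens R n beta a b)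
  (jac_dens_ge0 beta a b) ensemble_jac_law_setT).
Qed.

Lemma ensemble_joint_law (C : set (n.-tuple R * n.-tuple R)) : measurable C ->
  P (eigenvalue_weight @^-1` C) =
  (jac_law beta a b n \x dir_law c n) C.
Proof.
rewrite -[LHS]/(pushforward P eigenvalue_weight C).
apply: eq_measure_box_pairs => [|A B mA mB].
  by rewrite /= /pushforward preimage_setT probability_setT ltry.
by rewrite /= /pushforward preimage_boxX prob_boxX// product_measure1E//; exact: measurable_box.
Qed.

Lemma ensemble_integral (f : n.-tuple R * n.-tuple R -> \bar R) :
  (forall x, 0 <= f x) -> measurable_fun setT f ->
  \int[P]_t f (eigenvalue_weight t) =
  \int[jac_law beta a b n]_x \int[dir_law c n]_y f (x, y).
Proof.
move=> f0 mf; rewrite -fubini_tonelli1//.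
rewrite -(ge0_integral_pushforward measurable_eigenvalue_weight P (D := setT))//.
by apply: eq_measure_integral => C mC _; exact: ensemble_joint_law.
Qed.

Lemma ensemble_integral_eigenvalue (f : n.-tuple R -> \bar R) :
  (forall x, 0 <= f x) -> measurable_fun setT f ->
  \int[P]_t f (eigenvalue_tuple t) = \int[jac_law beta a b n]_x f x.
Proof.
move=> f0 mf; rewrite (ensemble_integral (f := f \o fst))//=; last exact: measurableT_comp.
by apply: eq_integral => x _; rewrite integral_cst//= ensemble_dir_law_setT mule1.
Qed.

Lemma ensemble_support :
  {ae P, forall t, forall i, (0 < lam t i < 1)%R /\ (0 < w t i)%R}.
Proof.
pose A (_ : 'I_n) : set R := `]0%R, 1%R[%classic.
pose B (_ : 'I_n) : set R := `]0%R, +oo[%classic.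
have mA i : measurable (A i) by exact: measurable_itv.
have mB i : measurable (B i) by exact: measurable_itv.
have mS : measurable (eigenvalue_weight @^-1` (box A `*` box B)).
  rewrite -[X in measurable X]setTI.
  by apply: measurable_eigenvalue_weight => //; apply: measurableX; exact: measurable_box.
rewrite preimage_boxX in mS; exists (~` [set t | forall i, A i (lam t i) /\ B i (w t i)]); split.
- exact: measurableC.
- by rewrite probability_setC// prob_boxX// jac_law_support dir_law_support mass_prod subee.
- move=> t; apply: contra_not => tS i.
  by have := tS i; rewrite /A /B/= !in_itv/= andbT.
Qed.

End ensemble_law.

(** * Second order expansions *)

Section taylor.
Context (R : realType).
Implicit Types (r x y : R) (n : nat).

Lemma norm_le_expr_of_derive (f df : R -> R) A r n y :
  (forall x, `|x| <= r -> is_derive x (1 : R) f (df x)) -> f 0 = 0 ->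
  (forall x, `|x| <= r -> `|df x| <= A * `|x| ^+ n) ->
  `|y| <= r -> `|f y| <= A * `|y| ^+ n.+1.
Proof.
move=> Df f0 dfA yr.
have Dfy (s : R) : 0 <= s <= 1 -> is_derive s (1 : R) (fun s => f (s * y)) (df (s * y) * y).
  move=> /andP[s0 s1]; apply: (@is_derive1_comp _ f (fun s => s * y)).
    by apply: Df; rewrite normrM (ger0_norm s0) (le_trans _ yr)// ler_piMl.
  by apply: is_derive_eq; rewrite scaler0 add0r /GRing.scale/= mulr1.
have [||s] := @MVT_segment R (fun s => f (s * y)) (fun s => df (s * y) * y) 0 1 ler01.
- by move=> s; rewrite in_itv/= => /andP[s0 s1]; apply: Dfy; rewrite !ltW.
- apply: derivable_within_continuous => s; rewrite in_itv/= => s01.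
  by have [] := Dfy s s01.
rewrite in_itv/= => /andP[s0 s1]; rewrite mul0r f0 mul1r !subr0 mulr1 => ->.
have sy : `|s * y| <= `|y| by rewrite normrM (ger0_norm s0) ler_piMl.
rewrite normrM exprSr mulrA ler_wpM2r// (le_trans (dfA _ (le_trans sy yr)))//.
have [->|yn0] := eqVneq y 0; first by rewrite mulr0.
have A0 : 0 <= A.
  by have := le_trans (normr_ge0 _) (dfA y yr); rewrite pmulr_lge0// exprn_gt0 ?normr_gt0.
by rewrite ler_wpM2l// lerXn2r ?nnegrE.
Qed.

Definition taylor_poly (g : nat -> R -> R) n : {poly R} :=
  \poly_(i < n) (g i 0 / i`!%:R).

Lemma deriv_taylor_poly g n :
  (taylor_poly g n.+1)^`() = taylor_poly (fun i => g i.+1) n.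
Proof.
apply/polyP => i; rewrite coef_deriv !coef_poly ltnS.
case: ifP => _; last by rewrite mul0rn.
by rewrite -[_ *+ i.+1]mulr_natr factS natrM invfM mulrA mulrAC divfK ?pnatr_eq0.
Qed.

Lemma taylor_norm_le (g : nat -> R -> R) A r n y :
  (forall i x, (i < n)%N -> `|x| <= r -> is_derive x (1 : R) (g i) (g i.+1 x)) ->
  (forall x, `|x| <= r -> `|g n x| <= A) -> `|y| <= r ->
  `|g 0%N y - (taylor_poly g n).[y]| <= A * `|y| ^+ n.
Proof.
elim: n g y => [|n IH] g y Dg gA yr.
  by rewrite /taylor_poly horner_poly big_ord0 subr0 expr0 mulr1; exact: gA.
have r0 : 0 <= r by apply: le_trans yr.
apply: (@norm_le_expr_of_derive (fun x => g 0%N x - (taylor_poly g n.+1).[x])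
  (fun x => g 1%N x - (taylor_poly (fun i => g i.+1) n).[x]) _ r) => //.
- move=> x xr; rewrite -deriv_taylor_poly; apply: is_deriveB; first exact: Dg.
- by rewrite horner_poly big_ord_recl big1 ?fact0 ?expr0 ?divr1 ?mulr1 ?addr0 ?subrr// => i _;
    rewrite expr0n mulr0.
- move=> x xr; apply: (IH (fun i => g i.+1)) => // i z i_n; exact: Dg.
Qed.

Lemma powR_le_2powR_norm x (p : R) : 2^-1 <= x <= 2 -> x `^ p <= 2 `^ `|p|.
Proof.
move=> /andP[x1 x2]; have x0 : 0 < x by rewrite (lt_le_trans _ x1).
have [p0|p0] := leP 0 p; first by rewrite ger0_norm// ge0_ler_powR ?nnegrE// ltW.
rewrite ltr0_norm// -[p in leLHS]opprK powRN -[2 `^ _]invrK lef_pV2 ?posrE ?invr_gt0 ?powR_gt0//.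
rewrite -powR_inv1 ?powR_ge0// -powRrM mulrC powRrM powR_inv1//.
by rewrite ge0_ler_powR ?nnegrE ?oppr_ge0// ltW.
Qed.

Section power_product.
Variables (I : finType) (c t : I -> R).
Implicit Types (e : R) (j : nat).

Definition power_product e : R := \prod_i (1 + e * t i) `^ c i.

(* Up to sign and factorials, the derivatives of the logarithm of [power_product]. *)
Definition log_moment j e : R := \sum_i c i * (t i / (1 + e * t i)) ^+ j.

Lemma is_derive_affine e i : is_derive e (1 : R) (fun e => 1 + e * t i) (t i).
Proof.
apply: (is_derive_eq (is_derive1D (is_derive1_cst 1 e) (is_derive1_mulr (t i) e))).
by rewrite add0r.
Qed.

Lemma is_derive_log_moment j e : (forall i, 0 < 1 + e * t i) ->
  is_derive e (1 : R) (log_moment j) (- j%:R * log_moment j.+1 e).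
Proof.
move=> pos; rewrite /log_moment mulr_sumr.
apply: (@is_derive1_sum _ _ _ (fun i e => c i * (t i / (1 + e * t i)) ^+ j)) => i.
have an0 : 1 + e * t i != 0 by rewrite gt_eqF.
have Dq : is_derive e (1 : R) (fun e => t i / (1 + e * t i)) (- (t i / (1 + e * t i)) ^+ 2).
  apply: (is_derive_eq (is_derive1Zl (t i)
    (is_derive1V (f := fun e => 1 + e * t i) an0 (is_derive_affine e i)))).
  by rewrite exprMn exprVn; ring.
case: j => [|j]; first by rewrite oppr0 mul0r; under eq_fun do rewrite expr0; exact: is_derive_cst.
apply: (is_derive_eq (is_derive1Zl (c i) (is_derive1X j Dq))).
by rewrite !exprS; ring.
Qed.

Lemma is_derive_power_product e : (forall i, 0 < 1 + e * t i) ->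
  is_derive e (1 : R) power_product (log_moment 1 e * power_product e).
Proof.
move=> pos; apply: (@is_derive1_prod_log _ _ _ (fun i e => (1 + e * t i) `^ c i)
  (fun i => c i * (t i / (1 + e * t i)) ^+ 1)) => i.
have Dp := @is_derive1_powR R (c i) (1 + e * t i) (pos i).
apply: (is_derive_eq (@is_derive1_comp R (fun x => x `^ c i) (fun e => 1 + e * t i) e _ _
  Dp (is_derive_affine e i))).
rewrite expr1 -[X in _ = _ * _ `^ X](subrK 1 (c i)) [in RHS]powRD ?(gt_eqF (pos i)) ?implybT//.
by rewrite powRr1 ?(ltW (pos i))//; field; rewrite gt_eqF.
Qed.

Definition power_product_derive n e : R := match n with
  | 0 => power_product e
  | 1 => log_moment 1 e * power_product e
  | 2 => (log_moment 1 e ^+ 2 - log_moment 2 e) * power_product e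
  | _ => (log_moment 1 e ^+ 3 - 3 * log_moment 1 e * log_moment 2 e + 2 * log_moment 3 e) *
         power_product e
  end.

Lemma is_derive_power_product_derive n e : (n < 3)%N -> (forall i, 0 < 1 + e * t i) ->
  is_derive e (1 : R) (power_product_derive n) (power_product_derive n.+1 e).
Proof.
move=> n3 pos; have DW := is_derive_power_product pos.
have D1 := is_derive_log_moment 1 pos; have D2 := is_derive_log_moment 2 pos.
case: n n3 => [_|[_|[_|//]]] /=; first exact: DW.
  apply: (is_derive_eq (is_derive1M D1 DW)).
  by move: (log_moment 1 e) (log_moment 2 e) (power_product e) => m1 m2 W; ring.
apply: (is_derive_eq (is_derive1M (is_derive1B (is_derive1X 1 D1) D2) DW)).
by move: (log_moment 1 e) (log_moment 2 e) (log_moment 3 e) (power_product e) => m1 m2 m3 W; ring.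
Qed.

Variable K : R.
Hypothesis K0 : 0 <= K.
Hypothesis tK : forall i, `|t i| <= K.

Let mulr_le_half e i : `|e| <= (2 * (K + 1))^-1 -> `|e * t i| <= 2^-1.
Proof.
move=> er; have K1 : 0 < K + 1 by rewrite ltr_wpDl.
rewrite normrM (@le_trans _ _ ((2 * (K + 1))^-1 * K))// ?ler_pM//.
by rewrite invfM -mulrA ler_piMr// ler_pdivrMl// mulr1 lerDl.
Qed.

Lemma affine_itv e i : `|e| <= (2 * (K + 1))^-1 -> 2^-1 <= 1 + e * t i <= 2.
Proof. by move=> /(mulr_le_half i); rewrite ler_norml => /andP[]; lra. Qed.

Lemma norm_log_moment_le j e : `|e| <= (2 * (K + 1))^-1 ->
  `|log_moment j e| <= (\sum_i `|c i|) * (2 * K) ^+ j.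
Proof.
move=> er; rewrite (le_trans (ler_norm_sum _ _ _))// mulr_suml; apply: ler_sum => i _.
have /andP[h _] := affine_itv i er; have a0 : 0 < 1 + e * t i by rewrite (lt_le_trans _ h).
rewrite normrM ler_wpM2l// normrX lerXn2r ?nnegrE ?mulr_ge0//.
rewrite normrM normfV (gtr0_norm a0) ler_pdivrMr// (le_trans (tK i))//.
by rewrite mulrAC ler_peMl// mulrC -ler_pdivrMr// div1r.
Qed.

Lemma power_product_itv e : `|e| <= (2 * (K + 1))^-1 ->
  0 <= power_product e <= \prod_i 2 `^ `|c i|.
Proof.
move=> er; apply/andP; split; first by apply: prodr_ge0 => i _; exact: powR_ge0.
by apply: ler_prod => i _; rewrite powR_ge0/= powR_le_2powR_norm// affine_itv.
Qed.

End power_product.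

Lemma power_product_expansion (I : finType) (c : I -> R) (K : R) : 0 <= K ->
  exists C, forall (t : I -> R) (e : R),
    (forall i, `|t i| <= K) -> `|e| <= (2 * (K + 1))^-1 ->
    `|power_product c t e - 1 - e * (\sum_i c i * t i) -
      e ^+ 2 * (((\sum_i c i * t i) ^+ 2 - \sum_i c i * t i ^+ 2) / 2)| <= C * `|e| ^+ 3.
Proof.
move=> K0; pose S : R := \sum_i `|c i|; pose B : R := \prod_i 2 `^ `|c i|; pose M : R := 2 * K.
exists (((S * M) ^+ 3 + 3 * (S * M) * (S * M ^+ 2) + 2 * (S * M ^+ 3)) * B) => t e tK er.
have mom0 j : log_moment c t j 0 = \sum_i c i * t i ^+ j.
  by apply: eq_bigr => i _; rewrite mul0r addr0 divr1.
have W0 : power_product c t 0 = 1 by apply: big1 => i _; rewrite mul0r addr0 powR1.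
have -> : power_product c t e - 1 - e * (\sum_i c i * t i) -
    e ^+ 2 * (((\sum_i c i * t i) ^+ 2 - \sum_i c i * t i ^+ 2) / 2) =
    power_product_derive c t 0 e - (taylor_poly (power_product_derive c t) 3).[e].
  rewrite horner_poly !big_ord_recl big_ord0 /= W0 !mom0 /bump/=.
  under [\sum_i c i * t i ^+ 1]eq_bigr do rewrite expr1.
  rewrite fact0 -[(1 + (1 + 0))`!]/2%N -[(1 + 0)`!]/1%N.
  by move: (power_product c t e) (\sum_i _) (\sum_i _) => W s1 s2; field.
apply: (taylor_norm_le (r := (2 * (K + 1))^-1)) er => [n x n3 xr|x xr].
  apply: is_derive_power_product_derive => // i.
  by have /andP[h _] := affine_itv K0 tK i xr; rewrite (lt_le_trans _ h).
have mom_le j := norm_log_moment_le c K0 tK j xr.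
have /andP[W_ge0 W_le] := power_product_itv c K0 tK xr.
rewrite /= normrM (ger0_norm W_ge0) ler_pM//.
rewrite (le_trans (ler_normD _ _))// lerD//; last by rewrite normrM ger0_norm// ler_wpM2l// mom_le.
have m1 := mom_le 1%N; rewrite expr1 in m1.
rewrite (le_trans (ler_normB _ _))// lerD//.
  by rewrite normrX lerXn2r ?nnegrE// (le_trans _ m1).
rewrite !normrM (ger0_norm (ler0n R 3)) -mulrA -[leRHS]mulrA ler_wpM2l//.
by rewrite ler_pM// mom_le.
Qed.

Lemma quadratic_norm_le_cube_eq0 (x y C d : R) : 0 < d -> 0 <= C ->
  (forall e : R, `|e| <= d -> `|e * x + e ^+ 2 * y| <= C * `|e| ^+ 3) ->
  x = 0 /\ y = 0.
Proof.
move=> d0 C0 small.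
have norm_le_lin_eq0 (u D : R) : 0 <= D ->
    (forall e : R, 0 < e -> e <= d -> `|u| <= D * e) -> u = 0.
  move=> D0 uD; apply/eqP; rewrite -normr_le0; apply/ler_addgt0Pl => z z0.
  rewrite addr0; pose e := Num.min d (z / (D + 1)).
  have D1 : 0 < D + 1 by rewrite ltr_wpDl.
  have e0 : 0 < e by rewrite /e lt_min d0 divr_gt0.
  apply: (le_trans (uD e e0 _)); first by rewrite /e ge_min lexx.
  apply: (@le_trans _ _ ((D + 1) * (z / (D + 1)))).
    by rewrite ler_pM// ?(ltW e0)// ?lerDl// /e ge_min lexx orbT.
  by rewrite mulrC divfK// gt_eqF.
have x0 : x = 0.
  apply: (norm_le_lin_eq0 x (C * d + `|y|)); first by rewrite addr_ge0// mulr_ge0// ltW.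
  move=> e e0 ed.
  have := small e; rewrite gtr0_norm// => /(_ ed).
  have -> : e * x + e ^+ 2 * y = e * (x + e * y) by ring.
  rewrite normrM gtr0_norm// exprS mulrCA ler_pM2l// => h.
  have -> : x = (x + e * y) - e * y by ring.
  apply: (le_trans (ler_normB _ _)); rewrite mulrDl lerD//.
    by apply: le_trans h _; rewrite expr2 mulrA ler_wpM2r ?(ltW e0)// ler_wpM2l.
  by rewrite normrM gtr0_norm// mulrC.
split=> //; apply: (norm_le_lin_eq0 y C) => // e e0 ed.
have := small e; rewrite gtr0_norm// => /(_ ed).
rewrite x0 mulr0 add0r normrM normrX (gtr0_norm e0) => h.
by rewrite -(ler_pM2r (exprn_gt0 2 e0)) mulrC (le_trans h)// -mulrA -exprS.
Qed.

End taylor.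

Section second_order_identities.
Context (R : realType) d (T : measurableType d) (P : probability T R).

Lemma bounded_integrable (f : T -> R) (C : R) : measurable_fun setT f ->
  (forall x, `|f x| <= C) -> P.-integrable setT (EFin \o f).
Proof.
move=> mf fC; apply: measurable_bounded_integrable => //.
  by rewrite [ltLHS](@probability_setT _ _ _ P) ltry.
exists C; split; first exact: num_real.
by move=> M CM x _; rewrite /= (le_trans (fC x))// ltW.
Qed.

Lemma Rintegral_prob_cst (k : R) : \int[P]_x k = k.
Proof. by rewrite Rintegral_cst// [X in fine X](@probability_setT _ _ _ P) mulr1. Qed.

Lemma Rintegral_second_order_eq0 (W : R -> T -> R) (A B : T -> R) (C K d0 : R) :
  0 < d0 -> measurable_fun setT A -> measurable_fun setT B ->
  (forall x, `|A x| <= K) -> (forall x, `|B x| <= K) ->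
  (forall e, `|e| <= d0 -> measurable_fun setT (W e)) ->
  (forall e x, `|e| <= d0 -> `|W e x - 1 - e * A x - e ^+ 2 * B x| <= C * `|e| ^+ 3) ->
  (forall e, `|e| <= d0 -> \int[P]_x W e x = 1) ->
  \int[P]_x A x = 0 /\ \int[P]_x B x = 0.
Proof.
move=> d00 mA mB bA bB mW expW intW.
have iZ (k : R) (f : T -> R) : measurable_fun setT f -> (forall x, `|f x| <= K) ->
    P.-integrable setT (EFin \o (fun x => k * f x)).
  move=> mf fC; apply: (@bounded_integrable _ (`|k| * K)); first exact: measurable_funM.
  by move=> x; rewrite normrM ler_wpM2l.
have iC (k : R) : P.-integrable setT (EFin \o (fun=> k)).
  by apply: (@bounded_integrable _ `|k|).
have iA := bounded_integrable mA bA; have iB := bounded_integrable mB bB.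
apply: (@quadratic_norm_le_cube_eq0 _ _ _ `|C| d0) => // e ed.
pose rem x := W e x - 1 - e * A x - e ^+ 2 * B x.
have mrem : measurable_fun setT rem.
  apply: measurable_funB; last exact: measurable_funM.
  by apply: measurable_funB; [apply: measurable_funB => //; exact: mW|exact: measurable_funM].
have rem_le x : `|rem x| <= `|C| * `|e| ^+ 3.
  by rewrite (le_trans (expW e x ed))// ler_wpM2r ?exprn_ge0// ler_norm.
have irem := bounded_integrable mrem rem_le.
have i1 := iC 1; have ieA := iZ e A mA bA; have ieB := iZ (e ^+ 2) B mB bB.
have i1A : P.-integrable setT (EFin \o (fun x => 1 + e * A x)).
  exact: (integrableD measurableT i1 ieA).
have i1AB : P.-integrable setT (EFin \o (fun x => 1 + e * A x + e ^+ 2 * B x)).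
  exact: (integrableD measurableT i1A ieB).
have -> : e * \int[P]_x A x + e ^+ 2 * \int[P]_x B x = - \int[P]_x rem x.
  have := intW e ed.
  rewrite (_ : W e = fun x => (1 + e * A x + e ^+ 2 * B x) + rem x); last first.
    by apply/funext => x; rewrite /rem; ring.
  rewrite RintegralD// RintegralD// RintegralD//.
  by rewrite Rintegral_prob_cst RintegralZl// RintegralZl//; lra.
rewrite normrN (le_trans (le_normr_Rintegral _ irem))// -[leRHS]Rintegral_prob_cst.
by apply: le_Rintegral => //; exact: (integrable_norm irem).
Qed.

(* Expanding [e |-> E (prod (1 + e t_i) ^ c_i) = 1] to second order in [e]. *)
Lemma power_product_identities (I : finType) (c : I -> R) (t : I -> T -> R) (K d0 : R) :
  0 < d0 -> (forall i x, `|t i x| <= K) -> (forall i, measurable_fun setT (t i)) ->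
  (forall e : R, `|e| <= d0 -> \int[P]_x power_product c (t ^~ x) e = 1) ->
  \int[P]_x (\sum_i c i * t i x) = 0 /\
  \int[P]_x ((\sum_i c i * t i x) ^+ 2) = \int[P]_x (\sum_i c i * t i x ^+ 2).
Proof.
move=> d00 tK mt mean_constant.
have tK' i x : `|t i x| <= `|K| by rewrite (le_trans (tK i x))// ler_norm.
have [C expW] := power_product_expansion c (normr_ge0 K).
pose A x := \sum_i c i * t i x; pose Q x := \sum_i c i * t i x ^+ 2.
pose B x := (A x ^+ 2 - Q x) / 2.
have mA : measurable_fun setT A by apply: measurable_sum => i; exact: measurable_funM.
have mQ : measurable_fun setT Q.
  by apply: measurable_sum => i; apply: measurable_funM => //; exact: measurable_funX.
have mB : measurable_fun setT B.
  by apply: measurable_funM => //; apply: measurable_funB => //; exact: measurable_funX.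
pose bA := \sum_i `|c i| * `|K|; pose bQ := \sum_i `|c i| * `|K| ^+ 2.
have A_le x : `|A x| <= bA.
  rewrite (le_trans (ler_norm_sum _ _ _))//; apply: ler_sum => i _.
  by rewrite normrM ler_wpM2l.
have Q_le x : `|Q x| <= bQ.
  rewrite (le_trans (ler_norm_sum _ _ _))//; apply: ler_sum => i _.
  by rewrite normrM ler_wpM2l// normrX lerXn2r ?nnegrE.
have A2_le x : `|A x ^+ 2| <= bA ^+ 2.
  by rewrite normrX lerXn2r ?nnegrE// (le_trans _ (A_le x)).
have B_le x : `|B x| <= (bA ^+ 2 + bQ) / 2.
  by rewrite normrM (ger0_norm (_ : 0 <= 2^-1))// ler_wpM2r// (le_trans (ler_normB _ _))// lerD.
have [||||||||intA intB] := @Rintegral_second_order_eq0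
  (fun e x => power_product c (t ^~ x) e) A B C (Num.max bA ((bA ^+ 2 + bQ) / 2))
  (Num.min d0 (2 * (`|K| + 1))^-1).
- by rewrite lt_min d00 invr_gt0 mulr_gt0// ltr_wpDl.
- exact: mA.
- exact: mB.
- by move=> x; rewrite le_max A_le.
- by move=> x; rewrite le_max B_le orbT.
- move=> e _; apply: measurable_prod => i _; apply: (measurableT_comp (measurable_powR _)).
  by apply: measurable_funD => //; exact: measurable_funM.
- by move=> e x; rewrite le_min => /andP[_]; apply: expW => i; exact: tK'.
- by move=> e; rewrite le_min => /andP[+ _]; exact: mean_constant.
split=> //; have iA2 := bounded_integrable (measurable_funX 2 mA) A2_le.
have iQ := bounded_integrable mQ Q_le.
have : \int[P]_x (2 * B x) = 0.
  by rewrite RintegralZl// ?intB ?mulr0//; exact: bounded_integrable B_le.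
rewrite (_ : (fun x => 2 * B x) = fun x => A x ^+ 2 - Q x); last first.
  by apply/funext => x; rewrite /B; field.
by rewrite RintegralB// => /eqP; rewrite subr_eq0 => /eqP.
Qed.

End second_order_identities.

(** * Loop equations *)

Section divided_difference.
Context (R : realFieldType).
Implicit Types (x y : R) (m p q : nat).

Definition divdiff m x y : R := \sum_(i < m) x ^+ (m.-1 - i) * y ^+ i.

Lemma divdiffC m x y : divdiff m x y = divdiff m y x.
Proof.
rewrite /divdiff (reindex_inj rev_ord_inj)/=; apply: eq_bigr => i _.
rewrite mulrC; congr (_ * _); congr (_ ^+ _); case: m i => [[]//|m] i /=.
all: by rewrite subSS ?subKn// -ltnS.
Qed.

Lemma divdiffxx m x : divdiff m x x = m%:R * x ^+ m.-1.
Proof.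
rewrite /divdiff (eq_bigr (fun=> x ^+ m.-1)).
  by rewrite sumr_const card_ord mulr_natl.
move=> i _; rewrite -exprD subnK//; case: m i => [[]//|m] i /=.
by rewrite -ltnS ltn_ord.
Qed.

Lemma ler_exprM_exprD x y p q : 0 <= x -> 0 <= y ->
  x ^+ p * y ^+ q <= x ^+ (p + q) + y ^+ (p + q).
Proof.
move=> x0 y0; have [xy|/ltW xy] := leP x y.
  apply: (@le_trans _ _ (y ^+ p * y ^+ q)); last by rewrite -exprD lerDr exprn_ge0.
  by rewrite ler_wpM2r ?exprn_ge0// lerXn2r// nnegrE.
apply: (@le_trans _ _ (x ^+ p * x ^+ q)); last by rewrite -exprD lerDl exprn_ge0.
by rewrite ler_wpM2l ?exprn_ge0// lerXn2r// nnegrE.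
Qed.

Lemma divdiff_ge0 m x y : 0 <= x -> 0 <= y -> 0 <= divdiff m x y.
Proof. by move=> x0 y0; apply: sumr_ge0 => i _; rewrite mulr_ge0// exprn_ge0. Qed.

Lemma divdiff_le m x y : 0 <= x -> 0 <= y ->
  divdiff m x y <= m%:R * (x ^+ m.-1 + y ^+ m.-1).
Proof.
move=> x0 y0; rewrite -[X in X%:R](card_ord m) mulr_natl -sumr_const.
apply: ler_sum => i _; have -> : m.-1 = (m.-1 - i + i)%N.
  by rewrite subnK//; case: m i => [[]//|m] i; rewrite -ltnS ltn_ord.
by rewrite addnK; exact: ler_exprM_exprD.
Qed.

End divided_difference.

Section power_sums.
Context (R : realFieldType) (n : nat).
Implicit Types (x : 'I_n -> R) (k m p q : nat).

Lemma sum_ltn_sym (F : 'I_n -> 'I_n -> R) : (forall i j, F i j = F j i) ->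
  \sum_(i < n) \sum_(j < n | (i < j)%N) F i j =
  2^-1 * (\sum_i \sum_j F i j - \sum_i F i i).
Proof.
move=> Fsym.
have split_diag : \sum_i \sum_j F i j = \sum_(i < n) \sum_(j < n | (i < j)%N) F i j +
    \sum_(i < n) \sum_(j < n | (j < i)%N) F i j + \sum_i F i i.
  rewrite -!big_split/=; apply: eq_bigr => i _.
  rewrite (bigID (fun j : 'I_n => (i < j)%N))/= -addrA; congr (_ + _).
  rewrite (bigD1 i) ?ltnn//= addrC; congr (_ + _); apply: eq_bigl => j.
  by rewrite -leqNgt andbC -ltn_neqAle.
have lower_upper : \sum_(i < n) \sum_(j < n | (j < i)%N) F i j =
    \sum_(i < n) \sum_(j < n | (i < j)%N) F i j.
  rewrite (exchange_big_dep predT)//=; apply: eq_bigr => i _.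
  by apply: eq_bigr => j _; rewrite Fsym.
by rewrite split_diag lower_upper; field.
Qed.

Definition power_sum x m : R := \sum_i x i ^+ m.

Definition power_sum_conv x m : R := \sum_(p < m.+1) power_sum x (m - p) * power_sum x p.

Lemma power_sum0 x : power_sum x 0 = n%:R.
Proof. by rewrite /power_sum (eq_bigr (fun=> 1))// sumr_const card_ord. Qed.

Lemma power_sum_convS x k : power_sum_conv x k.+1 = 2 * n%:R * power_sum x k.+1 +
  \sum_(p < k) power_sum x (k - p) * power_sum x p.+1.
Proof.
rewrite /power_sum_conv big_ord_recl big_ord_recr/= subn0 power_sum0 /bump/= add1n subnn power_sum0.
rewrite (eq_bigr (fun p : 'I_k => power_sum x (k - p) * power_sum x p.+1)); last first.
  by move=> p _; rewrite /bump/= add1n subSS.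
by lra.
Qed.

Lemma sum_divdiff x m : \sum_i \sum_j divdiff m.+1 (x i) (x j) = power_sum_conv x m.
Proof.
rewrite /divdiff /power_sum_conv.
under eq_bigr => i _ do rewrite exchange_big/=.
rewrite exchange_big/=; apply: eq_bigr => p _.
rewrite /power_sum mulr_suml; apply: eq_bigr => i _.
by rewrite mulr_sumr.
Qed.

Section nonnegative.
Variable x : 'I_n -> R.
Hypothesis x0 : forall i, 0 <= x i.

Lemma power_sum_ge0 m : 0 <= power_sum x m.
Proof. by apply: sumr_ge0 => i _; rewrite exprn_ge0. Qed.

Lemma power_sumM_le p q :
  power_sum x p * power_sum x q <= 2 * n%:R * power_sum x (p + q).
Proof.
apply: (@le_trans _ _ (\sum_i \sum_j (x i ^+ (p + q) + x j ^+ (p + q)))).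
  rewrite /power_sum mulr_suml; apply: ler_sum => i _.
  by rewrite mulr_sumr; apply: ler_sum => j _; exact: ler_exprM_exprD.
under eq_bigr do rewrite big_split/= sumr_const card_ord.
rewrite big_split/= sumr_const card_ord sumrMnl -/(power_sum x (p + q)).
by rewrite -[power_sum x (p + q) *+ n]mulr_natl; lra.
Qed.

Lemma power_sum_conv_le k : power_sum_conv x k <= 2 * n%:R * k.+1%:R * power_sum x k.
Proof.
apply: (@le_trans _ _ (\sum_(p < k.+1) 2 * n%:R * power_sum x k)).
  apply: ler_sum => p _; rewrite (le_trans (power_sumM_le _ _))// subnK//.
  by rewrite -ltnS.
by rewrite sumr_const card_ord -mulr_natr; lra.
Qed.

Lemma power_sum_conv_ge k : 2 * n%:R * power_sum x k.+1 <= power_sum_conv x k.+1.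
Proof.
by rewrite power_sum_convS lerDl; apply: sumr_ge0 => p _; rewrite mulr_ge0 ?power_sum_ge0.
Qed.

End nonnegative.

Lemma power_sum_le x m : (forall i, 0 < x i < 1) -> power_sum x m <= n%:R.
Proof.
move=> x01; rewrite -[X in X%:R](card_ord n) -sumr_const; apply: ler_sum => i _.
by have /andP[/ltW ? /ltW ?] := x01 i; rewrite exprn_ile1.
Qed.

End power_sums.

Section deformation.
Context (R : realType).
Implicit Types (x y e : R) (k : nat).

Definition deformation k e x : R := x + e * (x ^+ k.+1 - x ^+ k.+2).

(* The divided difference of the vector field [x ^ (k+1) - x ^ (k+2)]; on the diagonal, its
   derivative. *)
Definition field_slope k x y : R := divdiff k.+1 x y - divdiff k.+2 x y.

Definition slope_bound k : R := k.+1%:R + k.+2%:R.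

Lemma slope_bound_gt0 k : 0 < slope_bound k.
Proof. by rewrite /slope_bound -natrD. Qed.

Lemma slope_bound_ge1 k : 1 <= slope_bound k.
Proof. by rewrite /slope_bound -natrD ler1n. Qed.

Lemma field_slopeC k x y : field_slope k x y = field_slope k y x.
Proof. by rewrite /field_slope divdiffC (divdiffC k.+2). Qed.

Lemma field_slopexx k x : field_slope k x x = k.+1%:R * x ^+ k - k.+2%:R * x ^+ k.+1.
Proof. by rewrite /field_slope !divdiffxx. Qed.

Lemma norm_field_slope_le k x y : 0 <= x <= 1 -> 0 <= y <= 1 ->
  `|field_slope k x y| <= slope_bound k * (x ^+ k + y ^+ k).
Proof.
move=> /andP[x0 x1] /andP[y0 y1].
rewrite /field_slope (le_trans (ler_normB _ _))// mulrDl lerD//.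
  by rewrite ger0_norm ?divdiff_ge0//; exact: divdiff_le.
rewrite ger0_norm ?divdiff_ge0// (le_trans (divdiff_le _ x0 y0))// ler_wpM2l//.
by rewrite lerD// exprS ler_piMl// exprn_ge0.
Qed.

Lemma norm_field_slope_le_bound k x y : 0 <= x <= 1 -> 0 <= y <= 1 ->
  `|field_slope k x y| <= slope_bound k * 2.
Proof.
move=> x01 y01; rewrite (le_trans (norm_field_slope_le k x01 y01))//.
move: x01 y01 => /andP[x0 x1] /andP[y0 y1].
by rewrite ler_wpM2l ?(ltW (slope_bound_gt0 k))// -[2]/(1 + 1) lerD// exprn_ile1.
Qed.

Lemma addr_mul_slope_gt0 k e t : `|e| <= (4 * slope_bound k)^-1 ->
  `|t| <= slope_bound k * 2 -> 0 < 1 + e * t.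
Proof.
move=> ed tb; have bp := slope_bound_gt0 k.
have : `|e * t| <= 2^-1.
  rewrite normrM (le_trans (ler_pM _ _ ed tb))//.
  by rewrite le_eqVlt; apply/predU1P; left; field; rewrite gt_eqF.
by rewrite ler_norml => /andP[+ _]; lra.
Qed.

Lemma deformation_ratio k e x : deformation k e x = x * (1 + e * (x ^+ k - x ^+ k.+1)).
Proof. by rewrite /deformation !exprS; ring. Qed.

Lemma onem_deformation_ratio k e x :
  1 - deformation k e x = (1 - x) * (1 + e * - x ^+ k.+1).
Proof. by rewrite /deformation !exprS; ring. Qed.

Lemma deformationB k e x y :
  deformation k e x - deformation k e y = (x - y) * (1 + e * field_slope k x y).
Proof.
rewrite /field_slope /divdiff mulrDr mulr1 mulrCA mulrBr -!subrXX /deformation.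
by ring.
Qed.

Lemma deformation0 k e : deformation k e 0 = 0.
Proof. by rewrite /deformation !expr0n/= subrr mulr0 addr0. Qed.

Lemma deformation1 k e : deformation k e 1 = 1.
Proof. by rewrite /deformation !expr1n subrr mulr0 addr0. Qed.

Lemma deformation_lt k e x y : `|e| <= (4 * slope_bound k)^-1 ->
  0 <= x -> y <= 1 -> x < y -> deformation k e x < deformation k e y.
Proof.
move=> ed x0 y1 xy; rewrite -subr_gt0 deformationB mulr_gt0 ?subr_gt0//.
apply: addr_mul_slope_gt0 ed _; apply: norm_field_slope_le_bound.
  by rewrite y1 (le_trans x0 (ltW xy)).
by rewrite x0 (le_trans (ltW xy) y1).
Qed.

Lemma deformation_itv k e x : `|e| <= (4 * slope_bound k)^-1 ->
  0 < x < 1 -> 0 < deformation k e x < 1.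
Proof.
move=> ed /andP[x0 x1]; have := deformation_lt ed (lexx 0) (ltW x1) x0.
have := deformation_lt ed (ltW x0) (lexx 1) x1.
by rewrite deformation0 deformation1 => -> ->.
Qed.

Definition deformation_poly k e : {poly R} := 'X + e *: ('X^(k.+1) - 'X^(k.+2)).

Lemma horner_deformation_poly k e : horner (deformation_poly k e) = deformation k e.
Proof. by apply/funext => x; rewrite /deformation_poly !hornerE. Qed.

Lemma horner_deriv_deformation_poly k e :
  horner (deformation_poly k e)^`() = fun x => 1 + e * field_slope k x x.
Proof.
apply/funext => x; rewrite field_slopexx /deformation_poly.
rewrite derivD derivX derivZ derivB !derivXn hornerD hornerC hornerZ hornerD hornerN.
by rewrite !hornerMn !hornerXn !mulr_natl.
Qed.

Definition deformation_jacobian k e x : R :=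
  (1 + e * field_slope k x x) * \1_(`]0, 1[%classic : set R) x.

Lemma measurable_deformation k e : measurable_fun setT (deformation k e).
Proof. by rewrite -horner_deformation_poly;
  apply: continuous_measurable_fun; exact: continuous_horner. Qed.

Lemma measurable_deformation_jacobian k e : measurable_fun setT (deformation_jacobian k e).
Proof.
apply: measurable_funM; last exact: measurable_indic.
by rewrite -horner_deriv_deformation_poly; apply: continuous_measurable_fun;
  exact: continuous_horner.
Qed.

Lemma deformation_jacobian_ge0 k e x : `|e| <= (4 * slope_bound k)^-1 ->
  0 <= deformation_jacobian k e x.
Proof.
move=> ed; rewrite /deformation_jacobian indicE.
case: (boolP (x \in _)); last by rewrite mulr0.
rewrite mem_setE in_itv/= => /andP[/ltW x0 /ltW x1]; rewrite mulr1 ltW//.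
by apply: addr_mul_slope_gt0 ed _; apply: norm_field_slope_le_bound; rewrite x0.
Qed.

Lemma integral_deformation k e (h : R -> \bar R) : `|e| <= (4 * slope_bound k)^-1 ->
  (forall x, 0 <= h x)%E -> measurable_fun setT h ->
  (forall x, ~ (`]0, 1[%classic : set R) x -> h x = 0%E) ->
  (\int[@lebesgue_measure R]_x h x =
   \int[@lebesgue_measure R]_x (h (deformation k e x) * (deformation_jacobian k e x)%:E))%E.
Proof.
move=> ed h0 mh h_out.
transitivity (\int[@lebesgue_measure R]_(x in
    `]deformation k e 0, deformation k e 1[) h x)%E.
  rewrite [RHS]integral_mkcond; apply: eq_integral => x _.
  rewrite patchE deformation0 deformation1.
  by case: ifPn => //; rewrite notin_setE => /h_out.
transitivity (\int[@lebesgue_measure R]_(x in `]0%R, 1%R[)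
    (h (deformation k e x) * (1 + e * field_slope k x x)%:E))%E; last first.
  rewrite integral_mkcond; apply: eq_integral => x _.
  rewrite patchE /deformation_jacobian indicE.
  by case: ifPn => _; rewrite ?mulr1 ?mulr0 ?mule0.
have cp (p : {poly R}) : continuous (horner p) by exact: continuous_horner.
rewrite -horner_deformation_poly.
apply: (@change_of_variables _ _ (fun x => 1 + e * field_slope k x x)) => //.
- by rewrite -horner_deriv_deformation_poly.
- move=> x _; rewrite -[1 + _]/((fun x => 1 + e * field_slope k x x) x).
  by rewrite -horner_deriv_deformation_poly; exact: is_derive_poly.
- move=> x /andP[/ltW x0 /ltW x1]; rewrite ltW//.
  by apply: addr_mul_slope_gt0 ed _; apply: norm_field_slope_le_bound; rewrite x0.
- by move=> x y x0 y1 xy; rewrite horner_deformation_poly deformation_lt.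
Qed.

End deformation.

Section clamp.
Context (R : realType).
Implicit Types x : R.

(* The identity on (0, 1); it spares discarding the null event where an eigenvalue lies outside. *)
Definition clamp x : R := if 0 < x < 1 then x else 2^-1.

Lemma clamp_itv x : 0 < clamp x < 1.
Proof.
by rewrite /clamp; case: ifPn => //; rewrite invr_gt0 invf_lt1// ltr0n ltr1n.
Qed.

Lemma clamp_id x : 0 < x < 1 -> clamp x = x.
Proof. by rewrite /clamp => ->. Qed.

Lemma measurable_clamp : measurable_fun setT clamp.
Proof.
apply: measurable_fun_ifT => //; apply: measurable_and; exact: measurable_fun_ltr.
Qed.

End clamp.

(* Applying [deformation k e] to all the coordinates multiplies each factor of the density, and
   the Jacobian, by [1 + e * factor_slope k x u]. The factors are the differences
   [x i - x j], the coordinates [x i], their complements [1 - x i] and the Jacobians, in this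
   order. *)
Section density_factors.
Context (R : realType) (n : nat).
Implicit Types (x : 'I_n -> R) (k : nat) (e : R).

Definition factor := (('I_n * 'I_n) + 'I_n + ('I_n + 'I_n))%type.

Definition factor_exponent (beta a b : R) (u : factor) : R := match u with
  | inl (inl p) => if (p.1 < p.2)%N then beta else 0
  | inl (inr i) => a - exponent_shift beta n
  | inr (inl i) => b - exponent_shift beta n
  | inr (inr i) => 1 end.

Definition factor_slope k x (u : factor) : R := match u with
  | inl (inl p) => field_slope k (x p.1) (x p.2)
  | inl (inr i) => x i ^+ k - x i ^+ k.+1
  | inr (inl i) => - x i ^+ k.+1
  | inr (inr i) => field_slope k (x i) (x i) end.

Lemma norm_factor_slope_le k x u : (forall i, 0 < x i < 1) ->
  `|factor_slope k x u| <= slope_bound R k * 2.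
Proof.
move=> x01; have b2 : 1 <= slope_bound R k * 2.
  by have := slope_bound_ge1 R k; lra.
have x01' i : 0 <= x i <= 1 by have /andP[/ltW -> /ltW ->] := x01 i.
have xX i m : 0 <= x i ^+ m <= 1 by have /andP[? ?] := x01' i; rewrite exprn_ge0// exprn_ile1.
case: u => [[[i j]|i]|[i|i]] /=; try exact: norm_field_slope_le_bound.
- by rewrite (le_trans _ b2)// ler_norml; have := xX i k; have := xX i k.+1; lra.
- by rewrite (le_trans _ b2)// ler_norml; have := xX i k.+1; lra.
Qed.

Lemma measurable_factor_slope d (T : measurableType d) (X : T -> 'I_n -> R) k u :
  (forall i, measurable_fun setT (fun t => X t i)) ->
  measurable_fun setT (fun t => factor_slope k (X t) u).
Proof.
move=> mX.
have mdivdiff m i j : measurable_fun setT (fun t => divdiff m (X t i) (X t j)).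
  by apply: measurable_sum => l; apply: measurable_funM; exact: measurable_funX.
case: u => [[[i j]|i]|[i|i]] /=.
- exact: measurable_funB.
- by apply: measurable_funB; exact: measurable_funX.
- by apply: measurableT_comp => //; exact: measurable_funX.
- exact: measurable_funB.
Qed.

Variables (beta a b : R).

Definition loop_function k x : R :=
  beta / 2 * (power_sum_conv x k - power_sum_conv x k.+1) +
  (1 - beta / 2) * (k.+1%:R * power_sum x k - k.+2%:R * power_sum x k.+1) +
  (a - exponent_shift beta n) * power_sum x k -
  (a + b - 2 * exponent_shift beta n) * power_sum x k.+1.

Lemma sum_factor_slope k x :
  \sum_u factor_exponent beta a b u * factor_slope k x u = loop_function k x.
Proof.
rewrite !big_sumType/=.
have -> : \sum_(p : 'I_n * 'I_n) (if (p.1 < p.2)%N then beta else 0) *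
      field_slope k (x p.1) (x p.2) =
    beta * \sum_(i < n) \sum_(j < n | (i < j)%N) field_slope k (x i) (x j).
  rewrite -(pair_bigA _ (fun i j : 'I_n => (if (i < j)%N then beta else 0) *
    field_slope k (x i) (x j)))/= mulr_sumr; apply: eq_bigr => i _.
  rewrite mulr_sumr [RHS]big_mkcond/=; apply: eq_bigr => j _.
  by case: ifP; rewrite ?mul0r.
rewrite sum_ltn_sym; last by move=> i j; exact: field_slopeC.
have -> : \sum_i \sum_j field_slope k (x i) (x j) = power_sum_conv x k - power_sum_conv x k.+1.
  rewrite -!sum_divdiff -sumrB; apply: eq_bigr => i _.
  by rewrite -sumrB.
under [\sum_i 1 * _]eq_bigr do rewrite mul1r.
have -> : \sum_i field_slope k (x i) (x i) =
    k.+1%:R * power_sum x k - k.+2%:R * power_sum x k.+1.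
  rewrite /power_sum !mulr_sumr -sumrB; apply: eq_bigr => i _.
  exact: field_slopexx.
rewrite -!mulr_sumr sumrB sumrN -/(power_sum x k) -/(power_sum x k.+1) /loop_function.
by field.
Qed.

Section sum_sqr.
Variables (k : nat) (x : 'I_n -> R).
Hypothesis x01 : forall i, 0 < x i < 1.
Local Notation B := (slope_bound R k).

Let x0 i : 0 <= x i. Proof. by have /andP[/ltW] := x01 i. Qed.
Let x1 i : x i <= 1. Proof. by have /andP[_ /ltW] := x01 i. Qed.
Let B0 : 0 <= B. Proof. exact/ltW/slope_bound_gt0. Qed.
Let expr2X i m : x i ^+ (2 * m) = (x i ^+ m) ^+ 2. Proof. by rewrite mulnC exprM. Qed.

Let field_slope_sqr_le i j :
  field_slope k (x i) (x j) ^+ 2 <= 2 * B ^+ 2 * (x i ^+ (2 * k) + x j ^+ (2 * k)).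
Proof.
rewrite -real_normK ?num_real//.
apply: (@le_trans _ _ ((B * (x i ^+ k + x j ^+ k)) ^+ 2)).
  rewrite lerXn2r ?nnegrE// ?mulr_ge0// ?addr_ge0 ?exprn_ge0//.
  by apply: norm_field_slope_le; rewrite x0 x1.
rewrite exprMn -[leRHS]mulrA [leRHS]mulrCA ler_wpM2l ?exprn_ge0// !expr2X.
have := sqr_ge0 (x i ^+ k - x j ^+ k); lra.
Qed.

Lemma sum_pair_slope_sqr_le : 0 <= beta ->
  \sum_(p : 'I_n * 'I_n) (if (p.1 < p.2)%N then beta else 0) *
    field_slope k (x p.1) (x p.2) ^+ 2 <= 4 * beta * n%:R * B ^+ 2 * power_sum x (2 * k).
Proof.
move=> beta0.
apply: (@le_trans _ _ (\sum_(p : 'I_n * 'I_n) 2 * beta * B ^+ 2 *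
    (x p.1 ^+ (2 * k) + x p.2 ^+ (2 * k)))).
  apply: ler_sum => -[i j] _ /=; case: ifP => _; last first.
    by rewrite mul0r !mulr_ge0// ?exprn_ge0// addr_ge0// exprn_ge0.
  rewrite (le_trans (ler_wpM2l beta0 (field_slope_sqr_le i j)))//.
  by rewrite !mulrA [beta * 2]mulrC.
rewrite -(pair_bigA _ (fun i j : 'I_n => 2 * beta * B ^+ 2 *
    (x i ^+ (2 * k) + x j ^+ (2 * k))))/=.
under eq_bigr do rewrite -mulr_sumr big_split/= sumr_const card_ord.
rewrite -mulr_sumr big_split/= sumr_const card_ord sumrMnl -/(power_sum x (2 * k)).
rewrite -[power_sum x (2 * k) *+ n]mulr_natl.
by rewrite le_eqVlt; apply/predU1P; left; ring.
Qed.

Lemma sum_coord_slope_sqr_le (r : R) :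
  \sum_i r * (x i ^+ k - x i ^+ k.+1) ^+ 2 <= `|r| * power_sum x (2 * k).
Proof.
rewrite /power_sum mulr_sumr; apply: ler_sum => i _.
apply: (@le_trans _ _ (`|r| * (x i ^+ k - x i ^+ k.+1) ^+ 2)).
  by rewrite ler_wpM2r ?sqr_ge0// ler_norm.
rewrite ler_wpM2l// expr2X lerXn2r ?nnegrE ?exprn_ge0//.
  by rewrite subr_ge0 exprS ler_piMl ?exprn_ge0.
by rewrite lerBlDr lerDl exprn_ge0.
Qed.

Lemma sum_onem_slope_sqr_le (r : R) :
  \sum_i r * (- x i ^+ k.+1) ^+ 2 <= `|r| * power_sum x (2 * k.+1).
Proof.
rewrite /power_sum mulr_sumr; apply: ler_sum => i _.
by rewrite sqrrN expr2X ler_wpM2r ?sqr_ge0// ler_norm.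
Qed.

Lemma sum_diag_slope_sqr_le :
  \sum_i 1 * field_slope k (x i) (x i) ^+ 2 <= 4 * B ^+ 2 * power_sum x (2 * k).
Proof.
rewrite /power_sum mulr_sumr; apply: ler_sum => i _.
rewrite mul1r (le_trans (field_slope_sqr_le i i))//.
by move: (x i ^+ _) => y; lra.
Qed.

Lemma sum_factor_slope_sqr_le : 0 <= beta ->
  \sum_u factor_exponent beta a b u * factor_slope k x u ^+ 2 <=
  (4 * beta * n%:R * B ^+ 2 + `|a - exponent_shift beta n| + 4 * B ^+ 2) *
    power_sum x (2 * k) + `|b - exponent_shift beta n| * power_sum x (2 * k.+1).
Proof.
move=> beta0; rewrite !big_sumType/= !mulrDl.
have := lerD
  (lerD (sum_pair_slope_sqr_le beta0) (sum_coord_slope_sqr_le (a - exponent_shift beta n)))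
  (lerD (sum_onem_slope_sqr_le (b - exponent_shift beta n)) sum_diag_slope_sqr_le).
by move=> /le_trans; apply; lra.
Qed.

End sum_sqr.

Section deformed_density.
Variables (k : nat) (e : R) (s : seq R).
Hypothesis sn : size s = n.
Hypothesis ed : `|e| <= (4 * slope_bound R k)^-1.
Hypothesis s01 : forall i : 'I_n, 0 < s`_i < 1.
Local Notation slope := (factor_slope k (fun i : 'I_n => s`_i)).

Let slope_gt0 u : 0 < 1 + e * slope u.
Proof. by apply: addr_mul_slope_gt0 ed _; exact: norm_factor_slope_le. Qed.

Let nth_deformation (i : 'I_n) : (map (deformation k e) s)`_i = deformation k e s`_i.
Proof. by rewrite (nth_map 0)// sn. Qed.

Let pair_deformation (i j : 'I_n) :
  `|(map (deformation k e) s)`_i - (map (deformation k e) s)`_j| `^ beta =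
  (1 + e * slope (inl (inl (i, j)))) `^ beta * `|s`_i - s`_j| `^ beta.
Proof.
have pair_gt0 := slope_gt0 (inl (inl (i, j))); rewrite /= in pair_gt0.
rewrite !nth_deformation deformationB normrM mulrC (gtr0_norm pair_gt0).
by rewrite powRM ?(ltW pair_gt0).
Qed.

Let coordinate_deformation (p q : R) (i : 'I_n) :
  (map (deformation k e) s)`_i `^ p * (1 - (map (deformation k e) s)`_i) `^ q *
    \1_[set x : R | 0 < x < 1] (map (deformation k e) s)`_i * deformation_jacobian k e s`_i =
  (1 + e * slope (inl (inr i))) `^ p *
    ((1 + e * slope (inr (inl i))) `^ q * (1 + e * slope (inr (inr i))) `^ 1) *
    (s`_i `^ p * (1 - s`_i) `^ q * \1_[set x : R | 0 < x < 1] s`_i).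
Proof.
have /andP[s0 s1] := s01 i; have ds01 := deformation_itv ed (s01 i).
have /= coord_gt0 := slope_gt0 (inl (inr i)); have /= onem_gt0 := slope_gt0 (inr (inl i)).
have /= diag_gt0 := slope_gt0 (inr (inr i)).
rewrite nth_deformation /deformation_jacobian !indicE !mem_set//= ?in_itv//=.
rewrite onem_deformation_ratio deformation_ratio powRM ?(ltW s0) ?(ltW coord_gt0)//.
rewrite powRM ?(ltW onem_gt0) ?subr_ge0 ?(ltW s1)// powRr1 ?(ltW diag_gt0)//.
by ring.
Qed.

Lemma jac_dens_deformation :
  jac_dens beta a b (map (deformation k e) s) * \prod_(x <- s) deformation_jacobian k e x =
  power_product (factor_exponent beta a b) slope e * jac_dens beta a b s.
Proof.
rewrite (jac_densE beta a b sn) (@jac_densE _ n) ?size_map//.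
rewrite /power_product (big_nth 0) sn big_mkord !big_sumType.
have -> : \prod_(p : 'I_n * 'I_n) (1 + e * slope (inl (inl p))) `^
      factor_exponent beta a b (inl (inl p)) =
    \prod_(i < n) \prod_(j < n | (i < j)%N) (1 + e * slope (inl (inl (i, j)))) `^ beta.
  rewrite -(pair_bigA _ (fun i j : 'I_n => (1 + e * slope (inl (inl (i, j)))) `^
    (if (i < j)%N then beta else 0)))/=; apply: eq_bigr => i _.
  rewrite [RHS]big_mkcond/=; apply: eq_bigr => j _.
  by case: ifP; rewrite ?powRr0.
rewrite [X in X * _ * _ = _](eq_bigr _ (fun i _ => eq_bigr _ (fun j _ => pair_deformation i j))).
under eq_bigr do rewrite big_split/=.
rewrite -[LHS]mulrA -big_split/= (eq_bigr _ (fun i _ =>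
  coordinate_deformation (a - exponent_shift beta n) (b - exponent_shift beta n) i)).
by rewrite !big_split/=; ring.
Qed.

End deformed_density.

Lemma iint_jac_dens_deformation k e : `|e| <= (4 * slope_bound R k)^-1 ->
  iint n (fun s => (power_product (factor_exponent beta a b)
    (factor_slope k (fun i => clamp s`_i)) e * jac_dens beta a b s)%:E) =
  iint n (fun s => (jac_dens beta a b s)%:E).
Proof.
move=> ed.
rewrite [RHS](@iint_change_of_variables R (deformation k e) (deformation_jacobian k e)
  (`]0, 1[%classic)).
- apply: eq_iint => s sn; rewrite -EFinM; congr EFin.
  have [s01|] := pselect (forall i : 'I_n, 0 < s`_i < 1).
    rewrite (jac_dens_deformation sn ed s01); congr (power_product _ (factor_slope _ _) _ * _).
    by apply/funext => i; rewrite clamp_id.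
  move=> /existsNP[i /negP si]; have ins : s`_i \in s by rewrite mem_nth// sn.
  rewrite (jac_dens_eq0 beta a b ins si) mulr0.
  rewrite (big_rem _ ins)/= {1}/deformation_jacobian indicE memNset ?mulr0 ?mul0r ?mulr0//.
  by rewrite /= in_itv/=; apply/negP.
- exact: measurable_deformation.
- exact: measurable_deformation_jacobian.
- by move=> x; exact: deformation_jacobian_ge0.
- by move=> h h0 mh h_out; exact: integral_deformation.
- by move=> s; rewrite lee_fin jac_dens_ge0.
- by apply: measurable_at_EFin; exact: measurable_jac_dens.
- move=> s x xs; rewrite /= in_itv/= => /negP x01.
  by rewrite (jac_dens_eq0 beta a b xs x01).
Qed.

End density_factors.

Section loop_equations.
Context (R : realType) (d : measure_display) (T : measurableType d).
Variables (P : probability T R) (beta a b c : R) (n : nat) (lam w : T -> 'I_n -> R).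
Hypothesis ensP : jacobi_ensemble P beta a b c lam w.
Implicit Types (k m : nat).

Definition clamped (X : T -> 'I_n -> R) t i : R := clamp (X t i).
Local Notation x := (clamped lam).

Lemma clamped_itv t i : 0 < x t i < 1.
Proof. exact: clamp_itv. Qed.

Let x0 t i : 0 <= x t i. Proof. by have /andP[/ltW] := clamped_itv t i. Qed.

Lemma measurable_clamped i : measurable_fun setT (fun t => x t i).
Proof.
by apply: measurableT_comp; [exact: measurable_clamp|exact: (measurable_eigenvalue ensP)].
Qed.

Lemma measurable_power_sum m : measurable_fun setT (fun t => power_sum (x t) m).
Proof. by apply: measurable_sum => i; apply: measurable_funX; exact: measurable_clamped. Qed.

Lemma integrable_power_sum m : P.-integrable setT (EFin \o (fun t => power_sum (x t) m)).
Proof.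
apply: (bounded_integrable P (C := n%:R)); first exact: measurable_power_sum.
by move=> t; rewrite ger0_norm ?power_sum_ge0// power_sum_le// => i; exact: clamped_itv.
Qed.

Lemma measurable_loop_function k :
  measurable_fun setT (fun t => loop_function beta a b k (x t)).
Proof.
under eq_fun do rewrite -sum_factor_slope.
apply: measurable_sum => u; apply: measurable_funM => //.
by apply: measurable_factor_slope; exact: measurable_clamped.
Qed.

Lemma loop_function_bounded k : exists C, forall t, `|loop_function beta a b k (x t)| <= C.
Proof.
exists (\sum_(u : factor n) `|factor_exponent beta a b u| * (slope_bound R k * 2)) => t.
rewrite -sum_factor_slope (le_trans (ler_norm_sum _ _ _))//; apply: ler_sum => u _.
by rewrite normrM ler_wpM2l//; apply: norm_factor_slope_le => i; exact: clamped_itv.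
Qed.

Lemma integrable_loop_function k :
  P.-integrable setT (EFin \o (fun t => loop_function beta a b k (x t))).
Proof.
have [C loopC] := loop_function_bounded k.
exact: (bounded_integrable P (measurable_loop_function k) loopC).
Qed.

Lemma integrable_loop_function_sqr k :
  P.-integrable setT (EFin \o (fun t => loop_function beta a b k (x t) ^+ 2)).
Proof.
have [C loopC] := loop_function_bounded k.
apply: (bounded_integrable P (C := C ^+ 2)).
  by apply: measurable_funX; exact: measurable_loop_function.
by move=> t; rewrite normrX lerXn2r ?nnegrE// (le_trans _ (loopC t)).
Qed.

Lemma power_product_mean k (e : R) : `|e| <= (4 * slope_bound R k)^-1 ->
  \int[P]_t power_product (factor_exponent beta a b) (factor_slope k (x t)) e = 1.
Proof.
move=> ed.
pose f (s : n.-tuple R) : R := power_product (factor_exponent beta a b)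
  (factor_slope k (fun i => clamp (tnth s i))) e.
have f0 s : 0 <= f s by apply: prodr_ge0 => u _; exact: powR_ge0.
have mf : measurable_fun setT f.
  apply: measurable_prod => u _; apply: (measurableT_comp (measurable_powR _)).
  apply: measurable_funD => //; apply: measurable_funM => //.
  apply: (@measurable_factor_slope _ _ _ _ (fun (s : n.-tuple R) i => clamp (tnth s i))) => i.
  by apply: measurableT_comp; [exact: measurable_clamp|exact: measurable_tnth].
rewrite /Rintegral.
have -> : (\int[P]_t (power_product (factor_exponent beta a b) (factor_slope k (x t)) e)%:E =
    \int[P]_t (f (eigenvalue_tuple lam t))%:E)%E.
  apply: eq_integral => t _; congr (power_product _ (factor_slope _ _) _)%:E.
  by apply/funext => i; rewrite tnth_mktuple.
rewrite (ensemble_integral_eigenvalue ensP (f := EFin \o f))//=; last exact/measurable_EFinP.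
have [z z0 mass_z] := ensemble_jac_mass ensP.
rewrite integral_density_law//=; last exact/measurable_EFinP.
rewrite mass_z (_ : iint n _ = z%:E); first by rewrite -EFinM /= divff// gt_eqF.
rewrite -mass_z -[RHS](iint_jac_dens_deformation n beta a b ed).
apply: eq_iint => s _; rewrite -EFinM; congr ((power_product _ (factor_slope _ _) _ * _)%:E).
by apply/funext => i; rewrite tnth_to_tuple.
Qed.

Let loop_identities k : \int[P]_t loop_function beta a b k (x t) = 0 /\
  \int[P]_t (loop_function beta a b k (x t)) ^+ 2 =
  \int[P]_t (\sum_u factor_exponent beta a b u * factor_slope k (x t) u ^+ 2).
Proof.
have [||||mean var] := @power_product_identities R _ T P _ (factor_exponent beta a b)
  (fun u t => factor_slope k (x t) u) (slope_bound R k * 2) (4 * slope_bound R k)^-1.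
- by rewrite invr_gt0 mulr_gt0// slope_bound_gt0.
- by move=> u t; apply: norm_factor_slope_le => i; exact: clamped_itv.
- by move=> u; apply: measurable_factor_slope; exact: measurable_clamped.
- exact: power_product_mean.
split; [rewrite -[RHS]mean|rewrite -var];
  by apply: eq_Rintegral => t _; rewrite sum_factor_slope.
Qed.

Lemma loop_function_mean k : \int[P]_t loop_function beta a b k (x t) = 0.
Proof. exact: (loop_identities k).1. Qed.

Lemma loop_function_sqr_mean_le k : 0 <= beta ->
  \int[P]_t (loop_function beta a b k (x t)) ^+ 2 <=
  (4 * beta * n%:R * slope_bound R k ^+ 2 + `|a - exponent_shift beta n| +
    4 * slope_bound R k ^+ 2) * \int[P]_t power_sum (x t) (2 * k) +
  `|b - exponent_shift beta n| * \int[P]_t power_sum (x t) (2 * k.+1).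
Proof.
move=> beta0; rewrite (loop_identities k).2.
set A := (_ + _ + _); set B := `|b - _|.
have iZ (C : R) m : P.-integrable setT (EFin \o (fun t => C * power_sum (x t) m)).
  by have := integrableZl measurableT C (integrable_power_sum m).
rewrite -!RintegralZl//; try exact: integrable_power_sum.
rewrite -RintegralD//; apply: le_Rintegral => //.
- apply: (bounded_integrable P
    (C := \sum_(u : factor n) `|factor_exponent beta a b u| * (slope_bound R k * 2) ^+ 2)).
    apply: measurable_sum => u; apply: measurable_funM => //; apply: measurable_funX.
    by apply: measurable_factor_slope; exact: measurable_clamped.
  move=> t; apply: (le_trans (ler_norm_sum _ _ _)); apply: ler_sum => u _.
  rewrite normrM ler_wpM2l// normrX lerXn2r ?nnegrE// ?mulr_ge0// ?(ltW (slope_bound_gt0 _ _))//.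
  by apply: norm_factor_slope_le => i; exact: clamped_itv.
- by have := integrableD measurableT (iZ A (2 * k)%N) (iZ B (2 * k.+1)%N).
- by move=> t _; apply: sum_factor_slope_sqr_le => // i; exact: clamped_itv.
Qed.

End loop_equations.

(** * Concentration of the power sums *)

Section almost_sure.
Context (R : realType) d (T : measurableType d) (P : probability T R).

Lemma sum_inv_sqr_le (m : nat) : \sum_(0 <= i < m) (i.+1%:R ^- 2 : R) <= 2.
Proof.
case: m => [|m]; first by rewrite big_nil.
suff : \sum_(0 <= i < m.+1) (i.+1%:R ^- 2 : R) <= 2 - m.+1%:R^-1.
  by move=> /le_trans; apply; rewrite lerBlDr lerDl invr_ge0.
elim: m => [|m IH].
  by rewrite big_nat1 expr1n invr1; lra.
rewrite big_nat_recr//= (le_trans (lerD IH (lexx _)))// -addrA lerD2l.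
have -> : m.+2%:R = m.+1%:R + 1 :> R by rewrite -natr1.
have : 0 < m.+1%:R :> R by [].
move: m.+1%:R => x x0.
have x1 : 0 < x + 1 by rewrite ltr_wpDr.
suff : (x + 1) ^- 2 <= x^-1 - (x + 1)^-1 by lra.
have -> : x^-1 - (x + 1)^-1 = x^-1 * (x + 1)^-1.
  by field; rewrite !gt_eqF.
rewrite expr2 invfM ler_pM2r ?invr_gt0// lef_pV2 ?posrE//.
by rewrite lerDl.
Qed.

(* The sum of the [X n] has a finite mean, hence is almost surely finite. *)
Lemma ae_cvg0_of_mean_le_inv_sqr (X : nat -> T -> R) (C : R) :
  (forall n, measurable_fun setT (X n)) -> (forall n t, 0 <= X n t) ->
  (\forall n \near \oo, (\int[P]_t (X n t)%:E <= (C / n%:R ^+ 2)%:E)%E) ->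
  {ae P, forall t, X n t @[n --> \oo] --> 0}.
Proof.
move=> mX X0 [N _ mean_le].
pose Y n t : \bar R := (X (n + N.+1)%N t)%:E.
have mY n : measurable_fun setT (Y n) by exact/measurable_EFinP.
have Y0 n t : (0 <= Y n t)%E by rewrite lee_fin.
pose S t : \bar R := (\sum_(0 <= n <oo) Y n t)%E.
have mS : measurable_fun setT S.
  exact: (@ge0_emeasurable_sum _ _ _ setT Y predT (fun k x _ _ => Y0 k x) (fun k _ => mY k)).
have S0 t : (0 <= S t)%E by exact: nneseries_ge0.
have C0 : 0 <= C.
  have : (0 <= (C / N.+1%:R ^+ 2)%:E)%E.
    by apply: le_trans (mean_le N.+1 _) => //=; apply: integral_ge0 => t _; rewrite lee_fin.
  by rewrite lee_fin pmulr_lge0// invr_gt0 exprn_gt0.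
have iS : P.-integrable setT S.
  apply/integrableP; split => //.
  under eq_integral => t _ do rewrite gee0_abs//.
  rewrite /S integral_nneseries//.
  apply: (@le_lt_trans _ _ (C * 2)%:E); last exact: ltry.
  apply: lime_le.
    by apply: is_cvg_nneseries => n _ _; exact: integral_ge0.
  apply: nearW => m.
  apply: (@le_trans _ _ (\sum_(0 <= i < m) (C * (i.+1%:R ^- 2))%:E)%E).
    apply: lee_sum => i _.
    apply: (le_trans (mean_le (i + N.+1)%N _)); first by rewrite /= addnS -addSn leq_addl.
    rewrite lee_fin ler_wpM2l// lef_pV2 ?posrE ?exprn_gt0 ?ltr0n ?addn_gt0 ?orbT//.
    by rewrite lerXn2r ?nnegrE// ler_nat addnS ltnS leq_addr.
  by rewrite sumEFin lee_fin -mulr_sumr ler_wpM2l// sum_inv_sqr_le.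
have := integrable_ae measurableT iS; apply: filterS => t /(_ I) St.
have Stoo : (\sum_(0 <= n <oo) Y n t < +oo)%E by rewrite -ge0_fin_numE// S0.
have Yt : Y n t @[n --> \oo] --> (0 : \bar R).
  apply: (@squeeze_cvge _ _ _ _ (fun=> 0%E) _ (fun n => \sum_(n <= k <oo) Y k t)%E).
  - apply: nearW => n; rewrite Y0/=.
    have := @nneseries_lim_ge R (Y ^~ t) predT n n.+1 (fun k _ _ => Y0 k t).
    by rewrite big_nat1.
  - exact: cvg_cst.
  - by apply: (nneseries_tail_cvg Stoo) => k _.
by rewrite -(cvg_shiftn N.+1); move/fine_cvgP : Yt => [].
Qed.

Lemma cvg0_of_even_power (u : nat -> R) (m : nat) : (0 < m)%N ->
  u n ^+ m.*2 @[n --> \oo] --> (0 : R) -> u n @[n --> \oo] --> (0 : R).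
Proof.
move=> m0 um; apply/cvgrPdist_lt => e e0.
have em : 0 < e ^+ m.*2 by rewrite exprn_gt0.
move/cvgrPdist_lt : um => /(_ _ em); apply: filterS => n.
rewrite !sub0r !normrN normrX => h.
by rewrite -(@ltr_pXn2r _ m.*2) ?double_gt0 ?nnegrE// ltW.
Qed.

Lemma cvg_sumr (I : Type) (s : seq I) (f : I -> nat -> R) (l : I -> R) :
  (forall i, f i n @[n --> \oo] --> l i) ->
  \sum_(i <- s) f i n @[n --> \oo] --> \sum_(i <- s) l i.
Proof. by move=> fl; apply: cvg_big => //; exact: add_continuous. Qed.

End almost_sure.

Record jacobi_regime (R : realType) (beta tau : R) (a b : nat -> R) : Prop := JacobiRegime {
  regime_beta_gt0 : 0 < beta;
  regime_tau_gt0 : 0 < tau;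
  regime_param_gt : forall n, beta / 2 * (n.-1)%:R < a n /\ beta / 2 * (n.-1)%:R < b n;
  regime_cvg_tau : (fun n : nat => beta / 2 * n%:R / a n) @ \oo --> tau;
  regime_cvg_infty : (fun n : nat => b n / n%:R) @ \oo --> +oo }.

Definition eigenvalue_scale (R : realType) (a b : nat -> R) n : R := a n / b n.

Section regime.
Context (R : realType) (beta tau : R) (a b : nat -> R).
Hypothesis regP : jacobi_regime beta tau a b.
Local Notation theta := (eigenvalue_scale a b).

Let beta0 : 0 < beta := regime_beta_gt0 regP.
Let tau0 : 0 < tau := regime_tau_gt0 regP.
Let half_beta0 : 0 < beta / 2. Proof. by rewrite divr_gt0. Qed.

Lemma regime_a_gt0 n : 0 < a n.
Proof. by apply: le_lt_trans (regime_param_gt regP n).1; rewrite mulr_ge0// ltW. Qed.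

Lemma regime_b_gt0 n : 0 < b n.
Proof. by apply: le_lt_trans (regime_param_gt regP n).2; rewrite mulr_ge0// ltW. Qed.

Lemma eigenvalue_scale_gt0 n : 0 < theta n.
Proof. by rewrite divr_gt0 ?regime_a_gt0 ?regime_b_gt0. Qed.

Lemma cvg_invn : (n%:R^-1 : R) @[n --> \oo] --> (0 : R).
Proof.
apply/gtr0_cvgV0; last exact: cvgr_idn.
by apply: filterS (nbhs_infty_gt 0) => n n0; rewrite ltr0n.
Qed.

Lemma cvg_a_div_n : a n / n%:R @[n --> \oo] --> beta / 2 / tau.
Proof.
rewrite (_ : (fun n => _) = fun n => beta / 2 * (beta / 2 * n%:R / a n)^-1).
  apply: cvgM; first exact: cvg_cst.
  by apply: cvgV; [rewrite gt_eqF|exact: (regime_cvg_tau regP)].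
apply/funext => n; have [n0|n0] := eqVneq (n%:R : R) 0.
  by rewrite n0 mulr0 mul0r invr0 !mulr0.
by field; rewrite n0 !gt_eqF// regime_a_gt0.
Qed.

Lemma cvg_eigenvalue_scale : theta n @[n --> \oo] --> (0 : R).
Proof.
have hV : (b n / n%:R)^-1 @[n --> \oo] --> (0 : R).
  apply/gtr0_cvgV0; last exact: (regime_cvg_infty regP).
  by apply: filterS (nbhs_infty_gt 0) => n n0; rewrite divr_gt0 ?regime_b_gt0// ltr0n.
have cvg_product : (a n / n%:R) * (b n / n%:R)^-1 @[n --> \oo] --> beta / 2 / tau * 0.
  by apply: cvgM hV; exact: cvg_a_div_n.
rewrite mulr0 in cvg_product; apply: cvg_trans cvg_product; apply: near_eq_cvg.
apply: filterS (nbhs_infty_gt 0) => n n0.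
have nR_neq0 : n%:R != 0 :> R by rewrite pnatr_eq0 -lt0n.
by rewrite /eigenvalue_scale invfM invrK mulrACA mulVf// mulr1.
Qed.

Lemma cvg_exponent_shift_div_n : exponent_shift beta n / n%:R @[n --> \oo] --> beta / 2.
Proof.
have cvg_sum : beta / 2 + (1 - beta / 2) * n%:R^-1 @[n --> \oo] -->
    beta / 2 + (1 - beta / 2) * 0.
  by apply: cvgD; [exact: cvg_cst|apply: cvgM; [exact: cvg_cst|exact: cvg_invn]].
rewrite mulr0 addr0 in cvg_sum; apply: cvg_trans cvg_sum; apply: near_eq_cvg.
apply: filterS (nbhs_infty_gt 0) => n n0.
have nR_neq0 : n%:R != 0 :> R by rewrite pnatr_eq0 -lt0n.
have n1 : (n.-1)%:R = n%:R - 1 :> R by rewrite -[in RHS](prednK n0) -natr1 addrK.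
by rewrite /exponent_shift n1; field; rewrite nR_neq0.
Qed.

Lemma norm_exponent_shift_le n : (0 < n)%N -> `|exponent_shift beta n| <= (beta + 1) * n%:R.
Proof.
move=> n0; have n1 : 1 <= n%:R :> R by rewrite ler1n.
rewrite ger0_norm /exponent_shift; last by rewrite addr_ge0// mulr_ge0// ltW.
rewrite mulrDl mul1r lerD// ler_pM ?(ltW half_beta0)//; last by rewrite ler_nat leq_pred.
by have := beta0; lra.
Qed.

Lemma near_muln_le_b (C : R) : \forall n \near \oo, C * n%:R <= b n.
Proof.
have /cvgryPge/(_ C) := regime_cvg_infty regP; apply: filterS2 (nbhs_infty_gt 0) => n n0.
by rewrite ler_pdivlMr// ltr0n.
Qed.

Lemma near_a_comparable : exists2 K : R, 0 < K &
  \forall n \near \oo, n%:R <= K * a n /\ a n <= K * n%:R.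
Proof.
pose l := beta / 2 / tau; have l0 : 0 < l by rewrite divr_gt0.
have below : \forall n \near \oo, a n / n%:R < 2 * l.
  by apply: (cvgr_lt _ cvg_a_div_n); rewrite -/l ltr_pMl// ltr1n.
have above : \forall n \near \oo, l / 2 < a n / n%:R.
  apply: (cvgr_gt _ cvg_a_div_n); rewrite -/l.
  by rewrite ltr_pdivrMr// ltr_pMr// ltr1n.
exists (2 * l + 2 / l); first by rewrite addr_gt0 ?mulr_gt0 ?invr_gt0.
apply: filterS3 below above (nbhs_infty_gt 0) => n below above n0.
have nR_gt0 : 0 < n%:R :> R by rewrite ltr0n.
have an0 := regime_a_gt0 n; split.
- rewrite mulrDl (@le_trans _ _ (2 / l * a n))//; last first.
    by rewrite lerDr; apply: mulr_ge0; [apply: mulr_ge0 => //|]; exact: ltW.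
  move: above; rewrite ltr_pdivlMr// => /ltW above.
  rewrite mulrAC ler_pdivlMr// mulrC.
  by move: above; rewrite mulrAC ler_pdivrMr// [a n * 2]mulrC.
- rewrite mulrDl (@le_trans _ _ (2 * l * n%:R))//; last first.
    by rewrite lerDl mulr_ge0// divr_ge0// ltW.
  by move: below; rewrite ltr_pdivrMr// => /ltW.
Qed.

Section scaled_moments.
Variable x : forall n, 'I_n -> R.
Arguments x : clear implicits.

Definition scaled_moment k n : R := power_sum (x n) k / (n%:R * theta n ^+ k).

Definition scaled_loop k n : R :=
  loop_function beta (a n) (b n) k (x n) / (n%:R ^+ 2 * theta n ^+ k).

(* The coefficient of the highest moment when the loop function is solved for it. *)
Definition loop_coefficient k n : R := beta * theta n +
  (1 - beta / 2) * k.+2%:R * theta n / n%:R +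
  (theta n * (a n / n%:R) + a n / n%:R - 2 * (theta n * (exponent_shift beta n / n%:R))).

Definition loop_remainder k n : R :=
  beta / 2 * (\sum_(p < k.+1) scaled_moment (k - p) n * scaled_moment p n) -
  theta n * (beta / 2 * \sum_(p < k) scaled_moment (k - p) n * scaled_moment p.+1 n) +
  ((1 - beta / 2) * k.+1%:R / n%:R + a n / n%:R - exponent_shift beta n / n%:R) *
    scaled_moment k n -
  scaled_loop k n.

Lemma scaled_moment_conv k n (r : nat) (F : 'I_r -> nat) (G : 'I_r -> nat) :
  (forall p, (F p + G p)%N = k) ->
  \sum_(p < r) scaled_moment (F p) n * scaled_moment (G p) n =
  (\sum_(p < r) power_sum (x n) (F p) * power_sum (x n) (G p)) / (n%:R ^+ 2 * theta n ^+ k).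
Proof.
move=> FG; rewrite mulr_suml; apply: eq_bigr => p _.
by rewrite /scaled_moment mulrACA -invfM mulrACA -expr2 -exprD FG.
Qed.

Lemma loop_remainderE k n : (0 < n)%N ->
  loop_coefficient k n * scaled_moment k.+1 n = loop_remainder k n.
Proof.
move=> n0; have nR_neq0 : n%:R != 0 :> R by rewrite pnatr_eq0 -lt0n.
have th0 : theta n != 0 by rewrite gt_eqF// eigenvalue_scale_gt0.
have bn0 : b n != 0 by rewrite gt_eqF// regime_b_gt0.
rewrite /loop_remainder (scaled_moment_conv (k := k)) => [|p]; last by rewrite subnK// -ltnS.
rewrite (scaled_moment_conv (k := k.+1)) => [|p]; last by rewrite addnS subnK// ltnW.
have -> : \sum_(p < k) power_sum (x n) (k - p) * power_sum (x n) p.+1 =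
    power_sum_conv (x n) k.+1 - 2 * n%:R * power_sum (x n) k.+1.
  by rewrite power_sum_convS addrAC subrr add0r.
rewrite -/(power_sum_conv (x n) k) /scaled_loop /scaled_moment /loop_coefficient /loop_function.
rewrite !(exprSr (theta n) k).
have tk0 : theta n ^+ k != 0 by rewrite expf_neq0.
move: (theta n ^+ k) tk0 => tk tk0.
have -> : b n = a n / theta n.
  by rewrite /eigenvalue_scale; field; rewrite bn0 gt_eqF// regime_a_gt0.
move: (theta n) th0 => th th0.
by field; rewrite nR_neq0 th0 tk0.
Qed.

Lemma cvg_loop_coefficient k : loop_coefficient k n @[n --> \oo] --> beta / 2 / tau.
Proof.
rewrite [X in _ --> X](_ : _ = beta * 0 + (1 - beta / 2) * k.+2%:R * 0 * 0 +
  (0 * (beta / 2 / tau) + beta / 2 / tau - 2 * (0 * (beta / 2)))); last by ring.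
have cc (r : R) : (fun=> r) @ \oo --> r by exact: cvg_cst.
have ct := cvg_eigenvalue_scale; have ca := cvg_a_div_n.
apply: cvgD; first apply: cvgD.
- exact: cvgM.
- by apply: cvgM; [exact: cvgM|exact: cvg_invn].
- apply: cvgB; first by apply: cvgD => //; exact: cvgM.
  by apply: cvgM => //; apply: cvgM => //; exact: cvg_exponent_shift_div_n.
Qed.

Lemma cvg_loop_remainder (m : nat -> R) k :
  (forall p, (p <= k)%N -> scaled_moment p n @[n --> \oo] --> m p) ->
  scaled_loop k n @[n --> \oo] --> (0 : R) ->
  loop_remainder k n @[n --> \oo] --> beta / 2 * (\sum_(p < k.+1) m (k - p)%N * m p) +
    (beta / 2 / tau - beta / 2) * m k.
Proof.
move=> mom loop0.
have cc (r : R) : (fun=> r) @ \oo --> r by exact: cvg_cst.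
rewrite [X in _ --> X](_ : _ = beta / 2 * (\sum_(p < k.+1) m (k - p)%N * m p) -
  0 * (beta / 2 * \sum_(p < k) m (k - p)%N * m p.+1) +
  ((1 - beta / 2) * k.+1%:R * 0 + beta / 2 / tau - beta / 2) * m k - 0); last by ring.
apply: cvgB loop0; apply: cvgD; first apply: cvgB.
- apply: cvgM => //; apply: cvg_sumr => p.
  by apply: cvgM; apply: mom; rewrite ?leq_subr// -ltnS.
- apply: cvgM; first exact: cvg_eigenvalue_scale.
  apply: cvgM => //; apply: cvg_sumr => p.
  by apply: cvgM; apply: mom; rewrite ?leq_subr.
- apply: cvgM; last exact: mom.
  apply: cvgB; last exact: cvg_exponent_shift_div_n.
  apply: cvgD; last exact: cvg_a_div_n.
  by apply: cvgM => //; exact: cvg_invn.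
Qed.

(* In the limit the loop equation becomes the quadratic recursion. *)
Lemma cvg_scaled_moment (m : nat -> R) :
  m 0%N = 1 ->
  (forall k, m k.+1 = (1 - tau) * m k + tau * \sum_(p < k.+1) m (k - p)%N * m p) ->
  (forall k, scaled_loop k n @[n --> \oo] --> (0 : R)) ->
  forall k, scaled_moment k n @[n --> \oo] --> m k.
Proof.
move=> m0 mS loop0 k; elim/ltn_ind: k => -[_|k IH].
  have cvg1 : (fun=> 1 : R) @ \oo --> (1 : R) by exact: cvg_cst.
  rewrite m0; apply: cvg_trans cvg1; apply: near_eq_cvg.
  apply: filterS (nbhs_infty_gt 0) => n n0.
  by rewrite /scaled_moment power_sum0 expr0 mulr1 divff// pnatr_eq0 -lt0n.
have l0 : beta / 2 / tau != 0 by rewrite gt_eqF// divr_gt0.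
have -> : m k.+1 = (beta / 2 * (\sum_(p < k.+1) m (k - p)%N * m p) +
    (beta / 2 / tau - beta / 2) * m k) / (beta / 2 / tau).
  by rewrite mS; field; rewrite !gt_eqF.
have ccoef := cvg_loop_coefficient k.
apply: cvg_trans (cvgM (cvg_loop_remainder IH (loop0 k)) (cvgV l0 ccoef)).
apply: near_eq_cvg; near=> n.
rewrite /= -loop_remainderE; last by near: n; exact: nbhs_infty_gt.
rewrite mulrAC divff ?mul1r//.
by near: n; exact: (cvgr_neq0 _ ccoef).
Unshelve. all: by end_near. Qed.

End scaled_moments.

End regime.

Lemma loop_function_le (R : realType) n (x : 'I_n -> R) k (beta a b : R) :
  (forall i, 0 <= x i) -> (0 < n)%N -> 0 <= beta ->
  loop_function beta a b k x <=
  (beta * n%:R * k.+1%:R + (1 - beta / 2) * k.+1%:R + a - exponent_shift beta n) *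
    power_sum x k - (a + b + (1 - beta / 2) * k%:R) * power_sum x k.+1.
Proof.
move=> x0 n0 beta0.
have n1 : (n.-1)%:R = n%:R - 1 :> R by rewrite -[in RHS](prednK n0) -natr1 addrK.
have conv_le := power_sum_conv_le x0 k; have conv_ge := power_sum_conv_ge x0 k.
have k1 : k.+1%:R = k%:R + 1 :> R by rewrite natr1.
have k2 : k.+2%:R = k%:R + 1 + 1 :> R by rewrite !natr1.
rewrite /loop_function /exponent_shift n1 k2; rewrite k1 in conv_le *.
move: (power_sum_conv x k) (power_sum_conv x k.+1) (power_sum x k) (power_sum x k.+1)
  n%:R k%:R conv_le conv_ge => c1 c2 p1 p2 N K conv_le conv_ge.
rewrite -subr_ge0; set D := (X in 0 <= X).
have -> : D = beta / 2 * ((2 * N * (K + 1) * p1 - c1) + (c2 - 2 * N * p2)).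
  by rewrite /D; field.
by rewrite mulr_ge0 ?divr_ge0// addr_ge0// subr_ge0.
Qed.

Section concentration.
Context (R : realType) (d : measure_display) (T : measurableType d).
Variables (P : probability T R) (beta tau : R) (a b : nat -> R) (c : R).
Variables (lam w : forall n : nat, T -> 'I_n -> R).
Arguments lam : clear implicits.
Arguments w : clear implicits.
Hypothesis regP : jacobi_regime beta tau a b.
Hypothesis ensP : forall n, jacobi_ensemble P beta (a n) (b n) c (lam n) (w n).
Local Notation theta := (eigenvalue_scale a b).
Local Notation x t := (fun n => clamped (lam n) t).
Implicit Types n k : nat.

Let beta0 : 0 < beta := regime_beta_gt0 regP.

Let x0 n t i : 0 <= clamped (lam n) t i.
Proof. by have /andP[/ltW] := clamped_itv (lam n) t i. Qed.

Definition mean_power_sum n k : R := \int[P]_t power_sum (clamped (lam n) t) k.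

Lemma mean_power_sum_ge0 n k : 0 <= mean_power_sum n k.
Proof. by apply: Rintegral_ge0 => t _; exact: power_sum_ge0. Qed.

Lemma mean_power_sumS_le n k : (0 < n)%N ->
  (a n + b n + (1 - beta / 2) * k%:R) * mean_power_sum n k.+1 <=
  (beta * n%:R * k.+1%:R + (1 - beta / 2) * k.+1%:R + a n - exponent_shift beta n) *
    mean_power_sum n k.
Proof.
move=> n0; rewrite -subr_ge0 -(loop_function_mean (ensP n) k) /mean_power_sum.
have ip m := integrable_power_sum (ensP n) m.
set C1 := (X in _ <= X * _ - _); set C2 := (X in _ <= _ - X * _).
have iZ (C : R) m : P.-integrable setT (EFin \o (fun t => C * power_sum (clamped (lam n) t) m)).
  by have := integrableZl measurableT C (ip m).
rewrite -!RintegralZl// -RintegralB//; apply: le_Rintegral => //.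
- exact: integrable_loop_function.
- by have := integrableB measurableT (iZ C1 k) (iZ C2 k.+1).
- by move=> t _; apply: loop_function_le => //; exact: ltW.
Qed.

Let near_recursion_coef_le k : exists2 K : R, 0 <= K & \forall n \near \oo,
  beta * n%:R * k.+1%:R + (1 - beta / 2) * k.+1%:R + a n - exponent_shift beta n <= K * a n.
Proof.
have [K K0 na] := near_a_comparable regP.
exists ((beta + 1) * k.+1%:R * K + 1).
  by rewrite addr_ge0// !mulr_ge0// ?addr_ge0// ltW.
apply: filterS2 na (nbhs_infty_gt 0) => n [nK _] n0.
have n1 : 1 <= n%:R :> R by rewrite ler1n.
have muln_le_a : (beta + 1) * k.+1%:R * n%:R <= (beta + 1) * k.+1%:R * (K * a n).
  by rewrite ler_wpM2l// mulr_ge0// addr_ge0// ltW.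
have k_le_kn : k.+1%:R <= k.+1%:R * n%:R :> R by rewrite ler_peMr.
have half_beta_k_ge0 : 0 <= beta / 2 * k.+1%:R by rewrite mulr_ge0// divr_ge0// ltW.
have half_beta_n_ge0 : 0 <= beta / 2 * (n.-1)%:R by rewrite mulr_ge0// divr_ge0// ltW.
rewrite /exponent_shift.
move: muln_le_a k_le_kn half_beta_k_ge0 half_beta_n_ge0.
move: (k.+1%:R : R) ((n.-1)%:R : R) (n%:R : R) (a n) => u v N A.
have -> : ((beta + 1) * u * K + 1) * A = (beta + 1) * u * (K * A) + A by ring.
by lra.
Qed.

Let near_recursion_coef_ge k : \forall n \near \oo,
  b n / 2 <= a n + b n + (1 - beta / 2) * k%:R.
Proof.
apply: filterS2 (near_muln_le_b regP (beta * k%:R)) (nbhs_infty_gt 0) => n bn n0.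
have n1 : 1 <= n%:R :> R by rewrite ler1n.
have k_le_kn : beta * k%:R <= beta * k%:R * n%:R by rewrite ler_peMr// mulr_ge0// ltW.
have k0 : 0 <= k%:R :> R by []; have an0 := regime_a_gt0 regP n.
by move: (k%:R : R) k_le_kn k0 bn => u k_le_kn k0 bn; lra.
Qed.

Lemma mean_power_sum_le k : exists2 C : R, 0 <= C &
  \forall n \near \oo, mean_power_sum n k <= C * (n%:R * theta n ^+ k).
Proof.
elim: k => [|k [C C0 IH]].
  exists 1 => //; apply: nearW => n.
  rewrite /mean_power_sum; under eq_Rintegral do rewrite power_sum0.
  by rewrite Rintegral_prob_cst expr0 !mulr1 mul1r.
have [K K0 coef_le] := near_recursion_coef_le k.
exists (2 * K * C); first by rewrite !mulr_ge0.
apply: filterS3 (filterI IH coef_le) (near_recursion_coef_ge k) (nbhs_infty_gt 0).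
move=> n [{}IH {}coef_le] coef_ge n0.
have an0 := regime_a_gt0 regP n; have bn0 := regime_b_gt0 regP n.
have b20 : 0 < b n / 2 by rewrite divr_gt0.
have : b n / 2 * mean_power_sum n k.+1 <= K * a n * (C * (n%:R * theta n ^+ k)).
  apply: (le_trans (ler_wpM2r (mean_power_sum_ge0 _ _) coef_ge)).
  apply: (le_trans (mean_power_sumS_le k n0)).
  apply: (le_trans (ler_wpM2r (mean_power_sum_ge0 _ _) coef_le)).
  by rewrite ler_wpM2l// mulr_ge0// ltW.
rewrite mulrC -ler_pdivlMr// => /le_trans; apply.
rewrite le_eqVlt; apply/predU1P; left.
rewrite exprS; move: (theta n ^+ k) => tk; rewrite /eigenvalue_scale.
by field; rewrite gt_eqF.
Qed.

Let near_sqr_coef_a_le k : exists2 A : R, 0 <= A & \forall n \near \oo,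
  4 * beta * n%:R * slope_bound R k ^+ 2 + `|a n - exponent_shift beta n| +
    4 * slope_bound R k ^+ 2 <= A * n%:R.
Proof.
have [K K0 na] := near_a_comparable regP; set B := slope_bound R k.
have B2 : 0 <= B ^+ 2 by rewrite sqr_ge0.
exists (4 * beta * B ^+ 2 + (K + (beta + 1)) + 4 * B ^+ 2).
  have := mulr_ge0 (ltW beta0) B2; move: beta0 K0 B2.
  by move: (B ^+ 2) => sqB; lra.
apply: filterS2 na (nbhs_infty_gt 0) => n [_ aK] n0.
have n1 : 1 <= n%:R :> R by rewrite ler1n.
rewrite [leRHS]mulrDl [X in _ <= X + _]mulrDl; apply: lerD; first apply: lerD.
- by rewrite mulrAC.
- rewrite (le_trans (ler_normB _ _))// mulrDl lerD// ?(norm_exponent_shift_le regP)//.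
  by rewrite gtr0_norm// (regime_a_gt0 regP).
- by rewrite ler_peMr// mulr_ge0.
Qed.

Let near_sqr_coef_b_le : \forall n \near \oo, `|b n - exponent_shift beta n| <= 2 * b n.
Proof.
apply: filterS2 (near_muln_le_b regP (beta + 1)) (nbhs_infty_gt 0) => n bn n0.
have := ler_normB (b n) (exponent_shift beta n).
rewrite (gtr0_norm (regime_b_gt0 regP n)).
by have := le_trans (norm_exponent_shift_le regP n0) bn; lra.
Qed.

Let near_b_mul_scale_sqr_le : exists2 K : R, 0 <= K &
  \forall n \near \oo, b n * theta n ^+ 2 <= K * n%:R.
Proof.
have [K K0 na] := near_a_comparable regP; exists K; first exact: ltW.
apply: filterS2 na (near_muln_le_b regP K) => n [_ aK] bK.
have an0 := regime_a_gt0 regP n; have bn0 := regime_b_gt0 regP n.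
rewrite expr2 mulrA (_ : b n * theta n = a n); last first.
  by rewrite /eigenvalue_scale mulrC divfK// gt_eqF.
rewrite (le_trans _ aK)// ler_piMr ?(ltW an0)//.
by rewrite ler_pdivrMr// mul1r (le_trans aK).
Qed.

Lemma loop_function_sqr_mean_scale_le k : exists C : R, \forall n \near \oo,
  \int[P]_t (loop_function beta (a n) (b n) k (clamped (lam n) t)) ^+ 2 <=
  C * (n%:R ^+ 2 * theta n ^+ (2 * k)).
Proof.
have [C1 C10 mean1] := mean_power_sum_le (2 * k).
have [C2 C20 mean2] := mean_power_sum_le (2 * k.+1).
have [A A0 coef_a] := near_sqr_coef_a_le k; have [K K0 bth] := near_b_mul_scale_sqr_le.
exists (A * C1 + 2 * C2 * K).
apply: filterS3 (filterI mean1 mean2) (filterI coef_a near_sqr_coef_b_le) bth.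
move=> n [{}mean1 {}mean2] [{}coef_a coef_b] {}bth.
have th0 : 0 <= theta n by rewrite ltW ?(eigenvalue_scale_gt0 regP).
apply: (le_trans (loop_function_sqr_mean_le (ensP n) k (ltW beta0))).
rewrite [leRHS]mulrDl; apply: lerD.
  apply: (@le_trans _ _ (A * n%:R * (C1 * (n%:R * theta n ^+ (2 * k))))).
    apply: ler_pM => //; last exact: mean_power_sum_ge0.
    have B2 : 0 <= slope_bound R k ^+ 2 by rewrite sqr_ge0.
    by apply: addr_ge0; [apply: addr_ge0|] => //; rewrite mulr_ge0// !mulr_ge0// ltW.
  by rewrite le_eqVlt; apply/predU1P; left; ring.
apply: (@le_trans _ _ (2 * b n * (C2 * (n%:R * theta n ^+ (2 * k.+1))))).
  by apply: ler_pM => //; exact: mean_power_sum_ge0.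
have -> : 2 * b n * (C2 * (n%:R * theta n ^+ (2 * k.+1))) =
    2 * C2 * n%:R * theta n ^+ (2 * k) * (b n * theta n ^+ 2).
  by rewrite mulnS exprD; ring.
have -> : 2 * C2 * K * (n%:R ^+ 2 * theta n ^+ (2 * k)) =
    2 * C2 * n%:R * theta n ^+ (2 * k) * (K * n%:R) by ring.
by rewrite ler_wpM2l// !mulr_ge0// exprn_ge0.
Qed.

Lemma scaled_loop_sqr_mean_le k : exists C : R, \forall n \near \oo,
  (\int[P]_t (scaled_loop beta a b (x t) k n ^+ 2)%:E <= (C / n%:R ^+ 2)%:E)%E.
Proof.
have [C meanC] := loop_function_sqr_mean_scale_le k; exists C.
apply: filterS2 meanC (nbhs_infty_gt 0) => n {}meanC n0.
have nR_gt0 : 0 < n%:R :> R by rewrite ltr0n.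
have th0 : 0 < theta n := eigenvalue_scale_gt0 regP n.
pose q : R := (n%:R ^+ 2 * theta n ^+ k) ^- 2.
have q0 : 0 <= q by rewrite invr_ge0 exprn_ge0// mulr_ge0// exprn_ge0// ltW.
have iL := integrable_loop_function_sqr (ensP n) k.
rewrite (_ : (fun t => _) = (fun t => q%:E *
    ((loop_function beta (a n) (b n) k (clamped (lam n) t)) ^+ 2)%:E)%E); last first.
  by apply/funext => t; rewrite -EFinM /scaled_loop exprMn mulrC exprVn.
rewrite ge0_integralZl_EFin//; last 2 first.
- by move=> t _; rewrite lee_fin sqr_ge0.
- by have /integrableP[] := iL.
rewrite -[X in (_ * X)%E]fineK; last exact: integrable_fin_num iL.
rewrite -EFinM lee_fin; apply: (le_trans (ler_wpM2l q0 meanC)).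
rewrite le_eqVlt; apply/predU1P; left.
by rewrite /q mulnC exprM; field; rewrite gt_eqF//= expf_neq0// gt_eqF.
Qed.

Lemma scaled_loop_ae_cvg0 : {ae P, forall t, forall k,
  scaled_loop beta a b (x t) k n @[n --> \oo] --> (0 : R)}.
Proof.
apply: ae_foralln => k; have [C meanC] := scaled_loop_sqr_mean_le k.
have : {ae P, forall t, scaled_loop beta a b (x t) k n ^+ 2 @[n --> \oo] --> (0 : R)}.
  apply: (ae_cvg0_of_mean_le_inv_sqr (C := C)) => //.
  - move=> n; apply: measurable_funX; apply: measurable_funM => //.
    exact: (measurable_loop_function (ensP n)).
  - by move=> n t; rewrite sqr_ge0.
by apply: filterS => t; exact: (@cvg0_of_even_power _ _ 1).
Qed.

End concentration.

(** * The Beta integral *)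

Section beta_integral.
Context (R : realType).
Notation mu := (@lebesgue_measure R).
Implicit Types p q c u : R.

Definition beta_integrand p q u : R := u `^ (p - 1) * (1 - u) `^ (q - 1).

Definition Beta p q : \bar R := (\int[mu]_(u in `]0%R, 1%R[) (beta_integrand p q u)%:E)%E.

Lemma beta_integrand_ge0 p q u : 0 <= beta_integrand p q u.
Proof. by rewrite mulr_ge0 ?powR_ge0. Qed.

Lemma measurable_beta_integrand p q (D : set R) :
  measurable_fun D (EFin \o beta_integrand p q).
Proof.
apply: measurable_funTS; apply/measurable_EFinP; apply: measurable_funM => //.
by apply: (measurableT_comp (measurable_powR _)); exact: measurable_funB.
Qed.

Lemma Beta_ge0 p q : (0 <= Beta p q)%E.
Proof. by apply: integral_ge0 => u _; rewrite lee_fin beta_integrand_ge0. Qed.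

Lemma gt0_mulr_powRB1 p u : 0 < u -> u * u `^ (p - 1) = u `^ p.
Proof.
move=> u0; rewrite -[X in X * _]powRr1 ?(ltW u0)// -powRD ?(gt_eqF u0) ?implybT//.
by rewrite addrC subrK.
Qed.

Lemma beta_integrandD p q u : 0 < u < 1 ->
  beta_integrand (p + 1) q u + beta_integrand p (q + 1) u = beta_integrand p q u.
Proof.
move=> /andP[u0 u1]; rewrite /beta_integrand !addrK.
by rewrite -(gt0_mulr_powRB1 p u0) -(gt0_mulr_powRB1 q (_ : 0 < 1 - u)) ?subr_gt0//; ring.
Qed.

Lemma BetaD p q : (Beta (p + 1) q + Beta p (q + 1) = Beta p q)%E.
Proof.
rewrite /Beta -ge0_integralD//; try exact: measurable_beta_integrand; last 2 first.
- by move=> u _; rewrite lee_fin beta_integrand_ge0.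
- by move=> u _; rewrite lee_fin beta_integrand_ge0.
apply: eq_integral => u; rewrite inE/= in_itv/= => u01.
by rewrite -EFinD beta_integrandD.
Qed.

Lemma is_derive1_powR_1subr q u : u < 1 ->
  is_derive u (1 : R) (fun x => (1 - x) `^ q) (- (q * (1 - u) `^ (q - 1))).
Proof.
move=> u1; have Dpow := is_derive1_powR q (_ : 0 < 1 - u).
have Dsub : is_derive u (1 : R) (fun x => 1 - x) (0 - 1).
  exact: is_derive1B.
apply: (is_derive_eq (@is_derive1_comp R (fun y => y `^ q) (fun x => 1 - x) u _ _
  (Dpow _) Dsub)); first by rewrite subr_gt0.
by rewrite sub0r mulrN1.
Qed.

Lemma continuous_beta_integrand p q u : 0 < u < 1 ->
  {for u, continuous (beta_integrand p q)}.
Proof.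
move=> /andP[u0 u1]; apply: continuousM.
  exact: (is_derive1_continuous (is_derive1_powR (p - 1) u0)).
exact: (is_derive1_continuous (is_derive1_powR_1subr (q - 1) u1)).
Qed.

Lemma is_derive1_beta_primitive p q u : 0 < u < 1 ->
  is_derive u (1 : R) (fun x => x `^ p * (1 - x) `^ q)
    (p * beta_integrand p (q + 1) u - q * beta_integrand (p + 1) q u).
Proof.
move=> /andP[u0 u1].
apply: (is_derive_eq (is_derive1M (is_derive1_powR p u0) (is_derive1_powR_1subr q u1))).
by rewrite /beta_integrand !addrK; ring.
Qed.

Lemma cvg_beta_primitive0 p q : 0 < p ->
  u `^ p * (1 - u) `^ q @[u --> 0^'+] --> (0 : R).
Proof.
move=> p0; rewrite -[X in _ --> X](mul0r ((1 - 0) `^ q)).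
apply: cvgM; first exact: powR_cvg0.
apply: cvg_at_right_filter.
exact: (is_derive1_continuous (is_derive1_powR_1subr q ltr01)).
Qed.

Lemma cvg_beta_primitive1 p q : 0 < q ->
  u `^ p * (1 - u) `^ q @[u --> 1^'-] --> (0 : R).
Proof.
move=> q0; rewrite -[X in _ --> X](mulr0 (1 `^ p)); apply: cvgM.
  apply: cvg_at_left_filter.
  exact: (is_derive1_continuous (is_derive1_powR p ltr01)).
apply/cvg_at_leftP => u [u_lt1 cvg_u].
have /cvg_at_rightP := powR_cvg0 q0; apply; split; first by move=> n; rewrite subr_gt0.
by rewrite -[X in _ --> X](subrr (1 : R)); apply: cvgB => //; exact: cvg_cst.
Qed.

Lemma Beta_by_parts p q : 0 < p -> 0 < q ->
  (p%:E * Beta p (q + 1) = q%:E * Beta (p + 1) q)%E.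
Proof.
move=> p0 q0; have ge0 r p' q' u : 0 < r -> 0 <= r * beta_integrand p' q' u.
  by move=> r0; rewrite mulr_ge0 ?beta_integrand_ge0// ltW.
have cont r p' q' u : 0 < u < 1 -> {for u, continuous (fun v => r * beta_integrand p' q' v)}.
  by move=> u01; apply: continuousM; [exact: cst_continuous|exact: continuous_beta_integrand].
have scale r p' q' : 0 < r -> (r%:E * Beta p' q' =
    \int[mu]_(u in `]0%R, 1%R[) (r * beta_integrand p' q' u)%:E)%E.
  move=> r0; rewrite /Beta -ge0_integralZl_EFin ?(ltW r0)//.
    by move=> u _; rewrite lee_fin beta_integrand_ge0.
  exact: measurable_beta_integrand.
have := @ge0_FTC2_ooB R _ _ _ 0 1 0 0 ltr01 (fun u _ => ge0 p p (q + 1) u p0)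
  (fun u _ => ge0 q (p + 1) q u q0) (cont _ _ _) (cont _ _ _)
  (@is_derive1_beta_primitive p q) (cvg_beta_primitive0 q p0) (cvg_beta_primitive1 p q0).
by rewrite subrr adde0 !scale.
Qed.

Let proportional_share p q (x y z : \bar R) :
  0 < p -> 0 < q -> (0 <= x)%E -> (0 <= y)%E ->
  (x + y = z -> p%:E * y = q%:E * x -> x = (p / (p + q))%:E * z)%E.
Proof.
move=> p0 q0 x0 y0 <- pyqx; have pq0 : 0 < p + q by rewrite addr_gt0.
rewrite mulrC EFinM -muleA ge0_muleDr// pyqx -ge0_muleDl ?lee_fin ?(ltW p0) ?(ltW q0)//.
by rewrite -EFinD muleA -EFinM mulVf ?mul1e// gt_eqF.
Qed.

Lemma BetaSl p q : 0 < p -> 0 < q ->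
  (Beta (p + 1) q = (p / (p + q))%:E * Beta p q)%E.
Proof.
move=> p0 q0; apply: (proportional_share p0 q0 (Beta_ge0 _ _) (Beta_ge0 _ _)).
  exact: BetaD.
exact: Beta_by_parts.
Qed.

Lemma BetaSr p q : 0 < p -> 0 < q ->
  (Beta p (q + 1) = (q / (p + q))%:E * Beta p q)%E.
Proof.
move=> p0 q0; rewrite [p + q]addrC.
apply: (proportional_share q0 p0 (Beta_ge0 _ _) (Beta_ge0 (p + 1) q)).
  by rewrite addeC BetaD.
by rewrite Beta_by_parts.
Qed.

Definition rising c (j : nat) : R := \prod_(i < j) (c + i%:R).

Lemma rising0 c : rising c 0 = 1.
Proof. exact: big_ord0. Qed.

Lemma risingS c j : rising c j.+1 = rising c j * (c + j%:R).
Proof. exact: big_ord_recr. Qed.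

Lemma rising_gt0 c j : 0 < c -> 0 < rising c j.
Proof. by move=> c0; apply: prodr_gt0 => i _; rewrite ltr_pwDl. Qed.

Lemma rising_ge_expr c j : 0 <= c -> c ^+ j <= rising c j.
Proof.
move=> c0; elim: j => [|j IH]; first by rewrite rising0.
by rewrite exprSr risingS; apply: ler_pM => //; [exact: exprn_ge0|rewrite lerDl].
Qed.

Lemma Beta_risingl c q j : 0 < c -> 0 < q ->
  (Beta (c + j%:R) q = (rising c j / rising (c + q) j)%:E * Beta c q)%E.
Proof.
move=> c0 q0; elim: j => [|j IH]; first by rewrite addr0 !rising0 divr1 mul1e.
have cj : 0 < c + j%:R by rewrite ltr_wpDr.
rewrite -natr1 addrA (BetaSl cj q0) IH muleA -EFinM !risingS; congr (_%:E * _)%E.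
have cq := addr_gt0 c0 q0.
by rewrite (addrAC c j%:R q); field; rewrite !gt_eqF ?rising_gt0// ltr_wpDr.
Qed.

Lemma Beta_rising c q j l : 0 < c -> 0 < q -> (Beta (c + j%:R) (q + l%:R) =
  (rising c j * rising q l / rising (c + q) (j + l))%:E * Beta c q)%E.
Proof.
move=> c0 q0; elim: l => [|l IH].
  by rewrite addr0 addn0 rising0 mulr1 Beta_risingl.
have cj : 0 < c + j%:R by rewrite ltr_wpDr.
have ql : 0 < q + l%:R by rewrite ltr_wpDr.
rewrite -[l.+1%:R]natr1 addrA (BetaSr cj ql) IH muleA -EFinM; congr (_%:E * _)%E.
have cq := addr_gt0 c0 q0.
by rewrite addnS !risingS natrD addrACA; field; rewrite !gt_eqF ?rising_gt0// ltr_wpDr ?addr_ge0.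
Qed.

Lemma Beta_scale p q (r : R) : 0 < r ->
  (\int[mu]_(u in `]0%R, r[) (u `^ (p - 1) * (r - u) `^ (q - 1))%:E =
  (r `^ (p + q - 1))%:E * Beta p q)%E.
Proof.
move=> r0; pose h (u : R) : \bar R := (u `^ (p - 1) * (r - u) `^ (q - 1))%:E.
have h0 u : (0 <= h u)%E by rewrite lee_fin mulr_ge0 ?powR_ge0.
have mh : measurable_fun setT h.
  apply/measurable_EFinP; apply: measurable_funM => //.
  by apply: (measurableT_comp (measurable_powR _)); exact: measurable_funB.
have := @change_of_variables R ( *%R r) (fun=> r) 0 1 ltr01 (@mulrl_continuous _ r)
  (fun x => @cst_continuous _ _ r x) (fun x _ => is_derive1_mull r x) (fun _ _ => ltW r0).
rewrite mulr0 mulr1 => /(_ _ h h0 mh) ->; last by move=> x y _ _; rewrite ltr_pM2l.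
rewrite /Beta -ge0_integralZl_EFin ?powR_ge0//; last 2 first.
- by move=> u _; rewrite lee_fin beta_integrand_ge0.
- exact: measurable_beta_integrand.
apply: eq_integral => u; rewrite inE/= in_itv/= => /andP[u0 u1].
rewrite /h -!EFinM /beta_integrand; congr EFin.
rewrite -[X in X - r * u]mulr1 -mulrBr !powRM ?(ltW r0) ?(ltW u0) ?subr_ge0 ?(ltW u1)//.
have -> : r `^ (p + q - 1) = r `^ (p - 1) * r `^ (q - 1) * r.
  rewrite -[X in _ = _ * X]powRr1 ?(ltW r0)// -!powRD ?(gt_eqF r0) ?implybT//.
  by congr (_ `^ _); ring.
by ring.
Qed.

Definition pos_power p u : R := u `^ (p - 1) * (0 < u)%R%:R.

Lemma pos_power_ge0 p u : 0 <= pos_power p u.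
Proof. by rewrite mulr_ge0 ?powR_ge0. Qed.

Lemma pos_power_eq0 p u : u <= 0 -> pos_power p u = 0.
Proof. by rewrite /pos_power ltNge => ->; rewrite mulr0. Qed.

Lemma pos_power1 p : pos_power p 1 = 1.
Proof. by rewrite /pos_power powR1 ltr01 mulr1. Qed.

Lemma measurable_pos_power p : measurable_fun setT (pos_power p).
Proof.
apply: measurable_funM; first exact: measurable_powR.
rewrite (_ : (fun u => _) = \1_(`]0%R, +oo[%classic : set R)); first exact: measurable_indic.
by apply/funext => u; rewrite indicE mem_setE in_itv/= andbT.
Qed.

Lemma pos_powerDn p (m : nat) u : pos_power (p + m%:R) u = pos_power p u * u ^+ m.
Proof.
have [u0|u0] := leP u 0; first by rewrite !pos_power_eq0// mul0r.
rewrite /pos_power u0 !mulr1 addrAC [LHS]powRD ?(gt_eqF u0) ?implybT//.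
by rewrite powR_mulrn// ltW.
Qed.

Lemma pos_power_convolution p q (r : R) :
  (\int[mu]_u (pos_power p u * pos_power q (r - u))%:E = (pos_power (p + q) r)%:E * Beta p q)%E.
Proof.
have [r0|r0] := leP r 0.
  rewrite pos_power_eq0// mul0e integral0_eq// => u _.
  have [u0|u0] := leP u 0; first by rewrite pos_power_eq0// mul0r.
  by rewrite [pos_power q _]pos_power_eq0 ?mulr0// subr_le0 (le_trans r0)// ltW.
rewrite [pos_power _ r]/pos_power r0 mulr1 -Beta_scale// [RHS]integral_mkcond.
apply: eq_integral => u _; rewrite patchE mem_setE in_itv/= /pos_power subr_gt0.
by case: ifP => [/andP[-> ->]|/negbT]; rewrite ?mulr1// negb_and => /orP[]/negbTE ->;
  rewrite !(mulr0, mul0r).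
Qed.

End beta_integral.

(** * Moments of the Dirichlet law *)

Section centered_power_sums.
Context (R : realFieldType) (n : nat).
Hypothesis n0 : (0 < n)%N.
Implicit Types (x : 'I_n -> R) (m : nat).

Definition power_mean x : R := power_sum x 1 / n%:R.

Definition centered x i : R := x i - power_mean x.

Let nR0 : 0 < n%:R :> R. Proof. by rewrite ltr0n. Qed.

Let power_sumZl x m (k : R) : \sum_i k * x i ^+ m = k * power_sum x m.
Proof. by rewrite -mulr_sumr. Qed.

Let power_sum1E x : power_sum x 1 = n%:R * power_mean x.
Proof. by rewrite mulrC divfK// gt_eqF. Qed.

Let sum_cst (k : R) : \sum_(i < n) k = n%:R * k.
Proof. by rewrite sumr_const card_ord mulr_natl. Qed.

Lemma centered_power_sum2 x :
  power_sum (centered x) 2 = power_sum x 2 - n%:R * power_mean x ^+ 2.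
Proof.
transitivity (\sum_i (x i ^+ 2 + (- (2 * power_mean x)) * x i ^+ 1 + power_mean x ^+ 2)).
  by apply: eq_bigr => i _; rewrite /centered; ring.
rewrite !big_split/= sum_cst power_sumZl power_sum1E -/(power_sum x 2).
by ring.
Qed.

Lemma centered_power_sum4 x : power_sum (centered x) 4 = power_sum x 4 -
  4 * power_mean x * power_sum x 3 + 6 * power_mean x ^+ 2 * power_sum x 2 -
  3 * n%:R * power_mean x ^+ 4.
Proof.
transitivity (\sum_i (x i ^+ 4 + (- (4 * power_mean x)) * x i ^+ 3 +
    6 * power_mean x ^+ 2 * x i ^+ 2 + (- (4 * power_mean x ^+ 3)) * x i ^+ 1 +
    power_mean x ^+ 4)).
  by apply: eq_bigr => i _; rewrite /centered; ring.
rewrite !big_split/= sum_cst !power_sumZl power_sum1E -/(power_sum x 4).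
by ring.
Qed.

(* The difference is [n] times the centered sum of squares of [x ^+ m]. *)
Lemma power_sum_sqr_le x m : power_sum x m ^+ 2 <= n%:R * power_sum x (m * 2).
Proof.
pose xm i := x i ^+ m.
have : 0 <= power_sum (centered xm) 2 by apply: sumr_ge0 => i _; exact: sqr_ge0.
rewrite centered_power_sum2 subr_ge0 => /(ler_wpM2l (ltW nR0)).
rewrite [power_sum xm 2](eq_bigr (fun i => x i ^+ (m * 2))) => [|i _]; last by rewrite exprM.
apply: le_trans; rewrite mulrA -expr2 -exprMn -power_sum1E le_eqVlt; apply/predU1P; left.
by congr (_ ^+ 2); apply: eq_bigr => i _; rewrite expr1.
Qed.

Lemma centered_power_sum4_le x : (forall i, 0 <= x i) ->
  power_sum (centered x) 4 <= 2 * power_sum x 4.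
Proof.
move=> x0; have m0 : 0 <= power_mean x.
  by rewrite divr_ge0// sumr_ge0// => i _; rewrite exprn_ge0.
have mean4 : n%:R * power_mean x ^+ 4 <= power_sum x 4.
  have sqr_mean : n%:R * power_mean x ^+ 2 <= power_sum x 2.
    by rewrite -subr_ge0 -centered_power_sum2 sumr_ge0// => i _; exact: sqr_ge0.
  rewrite -(ler_pM2l nR0); apply: le_trans (power_sum_sqr_le x 2).
  have nm2 : 0 <= n%:R * power_mean x ^+ 2 by rewrite mulr_ge0 ?sqr_ge0.
  have -> : n%:R * (n%:R * power_mean x ^+ 4) = (n%:R * power_mean x ^+ 2) ^+ 2 by ring.
  by rewrite lerXn2r// nnegrE// (le_trans nm2).
have pointwise i : centered x i ^+ 4 <= x i ^+ 4 + power_mean x ^+ 4.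
  rewrite /centered; move: (power_mean x) m0 (x i) (x0 i) => m m0 y y0.
  have ym0 : 0 <= y * m by rewrite mulr_ge0.
  rewrite -subr_ge0 (_ : _ - _ = y * m * (4 * (y - m) ^+ 2 + 2 * (y * m))); last by ring.
  by apply: mulr_ge0 => //; have := sqr_ge0 (y - m); lra.
apply: (le_trans (ler_sum _ (fun i _ => pointwise i))).
by rewrite big_split/= sum_cst -/(power_sum x 4); move: mean4; lra.
Qed.

End centered_power_sums.

Section dirichlet_moments.
Local Open Scope ereal_scope.
Context (R : realType).
Notation mu := (@lebesgue_measure R).
Variable c : R.
Hypothesis c0 : (0 < c)%R.
Implicit Types (r : R) (y : nat -> R) (u : seq R) (k m : nat).

(* The Dirichlet density on the simplex of total mass [r] and the sum of the weights against
   [y], in the first [k] of the [k.+1] barycentric coordinates. *)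
Definition simplex_dens k r u : R :=
  ((\prod_(i < k) pos_power c u`_i) * pos_power c (r - \sum_(i < k) u`_i))%R.

Definition simplex_dot k r y u : R :=
  (\sum_(i < k) u`_i * y i + (r - \sum_(i < k) u`_i) * y k)%R.

Lemma simplex_dens_cons k r x u :
  simplex_dens k.+1 r (x :: u) = (pos_power c x * simplex_dens k (r - x) u)%R.
Proof. by rewrite /simplex_dens !big_ord_recl/= opprD addrA mulrA. Qed.

Lemma simplex_dot_cons k r y x u :
  simplex_dot k.+1 r y (x :: u) = (x * y 0%N + simplex_dot k (r - x) (fun i => y i.+1) u)%R.
Proof. by rewrite /simplex_dot !big_ord_recl/= opprD !addrA. Qed.

Lemma simplex_dens_ge0 k r u : (0 <= simplex_dens k r u)%R.
Proof. by rewrite mulr_ge0 ?pos_power_ge0// prodr_ge0// => i _; exact: pos_power_ge0. Qed.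

Lemma simplex_dens_neq0 k r u : simplex_dens k r u != 0%R ->
  (forall i : 'I_k, 0 < u`_i)%R /\ (0 < r - \sum_(i < k) u`_i)%R.
Proof.
rewrite mulf_eq0 negb_or => /andP[/prodf_neq0 prod_neq0 last_neq0]; split => [i|].
  by move: (prod_neq0 i isT); apply: contraNT; rewrite -leNgt => /pos_power_eq0 ->.
by move: last_neq0; apply: contraNT; rewrite -leNgt => /pos_power_eq0 ->.
Qed.

Lemma simplex_dens_dot_ge0 k r y u m : (forall i, 0 <= y i)%R ->
  (0 <= simplex_dens k r u * simplex_dot k r y u ^+ m)%R.
Proof.
move=> y0; have [->|/simplex_dens_neq0[u0 r0]] := eqVneq (simplex_dens k r u) 0%R.
  by rewrite mul0r.
rewrite mulr_ge0 ?simplex_dens_ge0// exprn_ge0// addr_ge0 ?mulr_ge0 ?(ltW r0)//.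
by apply: sumr_ge0 => i _; rewrite mulr_ge0// ltW.
Qed.

Lemma measurable_simplex_dens k r :
  measurable_fun setT (fun t : k.-tuple R => simplex_dens k r t).
Proof.
apply: measurable_funM.
  apply: measurable_prod => i _; apply: (measurableT_comp (measurable_pos_power c)).
  exact: measurable_nth.
apply: (measurableT_comp (measurable_pos_power c)); apply: measurable_funB => //.
by apply: measurable_sum => i; exact: measurable_nth.
Qed.

Lemma measurable_simplex_dot k r y :
  measurable_fun setT (fun t : k.-tuple R => simplex_dot k r y t).
Proof.
apply: measurable_funD.
  by apply: measurable_sum => i; apply: measurable_funM => //; exact: measurable_nth.
apply: measurable_funM => //; apply: measurable_funB => //.
by apply: measurable_sum => i; exact: measurable_nth.
Qed.

Lemma measurable_simplex_dens_dot k r y m :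
  measurable_at k (fun u => (simplex_dens k r u * simplex_dot k r y u ^+ m)%:E).
Proof.
apply/measurable_EFinP; apply: measurable_funM; first exact: measurable_simplex_dens.
by apply: measurable_funX; exact: measurable_simplex_dot.
Qed.

(* The sum of [m! / (m_0! ... m_k!) * \prod_i rising c m_i * y_i ^+ m_i] over the tuples [m_i] of
   sum [m]. *)
Fixpoint rising_multinomial k y m : R :=
  if k is k'.+1 then
    (\sum_(i < m.+1) 'C(m, i)%:R * (rising c (m - i) * y 0%N ^+ (m - i)) *
       rising_multinomial k' (fun i => y i.+1) i)%R
  else (rising c m * y 0%N ^+ m)%R.

Lemma rising_multinomial_ge0 k y m : (forall i, 0 <= y i)%R ->
  (0 <= rising_multinomial k y m)%R.
Proof.
elim: k y m => [|k IH] y m y0 /=.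
  by rewrite mulr_ge0 ?exprn_ge0// ltW// rising_gt0.
apply: sumr_ge0 => i _; rewrite !mulr_ge0 ?exprn_ge0//; last exact: IH.
by rewrite ltW// rising_gt0.
Qed.

Fixpoint simplex_mass k : \bar R :=
  if k is k'.+1 then Beta c (k'.+1%:R * c) * simplex_mass k' else 1.

Lemma simplex_mass_ge0 k : 0 <= simplex_mass k.
Proof. by elim: k => [|k IH] //=; rewrite mule_ge0// Beta_ge0. Qed.

Lemma iint_simplex_slice k r x y m : (forall i, 0 <= y i)%R ->
  iint k (fun u => (simplex_dens k.+1 r (x :: u) * simplex_dot k.+1 r y (x :: u) ^+ m)%:E) =
  \sum_(i < m.+1) ('C(m, i)%:R * y 0%N ^+ (m - i) * pos_power (c + (m - i)%:R) x)%:E *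
    iint k (fun u => (simplex_dens k (r - x) u *
      simplex_dot k (r - x) (fun i => y i.+1) u ^+ i)%:E).
Proof.
move=> y0; set y' := fun i => y i.+1.
have y'0 i : (0 <= y' i)%R by exact: y0.
pose q (i : 'I_m.+1) : R :=
  ('C(m, i)%:R * y 0%N ^+ (m - i) * pos_power (c + (m - i)%:R) x)%R.
have q0 i : (0 <= q i)%R by rewrite mulr_ge0 ?pos_power_ge0// mulr_ge0 ?exprn_ge0.
pose G (i : 'I_m.+1) u : \bar R :=
  (simplex_dens k (r - x) u * simplex_dot k (r - x) y' u ^+ i)%:E.
have G0 i u : 0 <= G i u by rewrite lee_fin simplex_dens_dot_ge0.
have mG i : measurable_at k (G i) by exact: measurable_simplex_dens_dot.
transitivity (\sum_(i < m.+1) iint k (fun u => (q i)%:E * G i u)); last first.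
  by apply: eq_bigr => i _; rewrite iintZl.
rewrite -iint_sum; last 2 first.
- by move=> i u; apply: mule_ge0; [rewrite lee_fin|].
- by move=> i; apply: emeasurable_funM => //; exact: mG.
apply: eq_iint => u _; under eq_bigr do rewrite -EFinM.
rewrite sumEFin simplex_dens_cons simplex_dot_cons exprDn mulr_sumr; congr EFin.
apply: eq_bigr => i _; rewrite /q pos_powerDn exprMn -mulr_natl -/y'.
by ring.
Qed.

Lemma integral_simplex_slice (p q r A M : R) (Z : \bar R) (j l : nat) :
  (0 < p)%R -> (0 < q)%R -> (0 <= A)%R -> (0 <= M)%R -> 0 <= Z ->
  \int[mu]_x ((A * pos_power (p + j%:R) x)%:E *
    ((pos_power (q + l%:R) (r - x) * (M / rising q l))%:E * Z)) =
  (pos_power (p + q + (j + l)%:R) r * (A * rising p j * M / rising (p + q) (j + l)))%:E *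
    (Beta p q * Z).
Proof.
move=> p0 q0 A0 M0 Z0.
have B0 : (0 <= A * (M / rising q l))%R by rewrite !mulr_ge0// invr_ge0 ltW// rising_gt0.
under eq_integral => x _.
  rewrite muleA -EFinM [(pos_power _ (r - x) * _)%R]mulrC mulrACA EFinM muleAC; over.
rewrite ge0_integralZl//; last 3 first.
- apply/measurable_EFinP; apply: measurable_funM; first exact: measurable_pos_power.
  by apply: (measurableT_comp (measurable_pos_power _)); exact: measurable_funB.
- by move=> x _; rewrite lee_fin mulr_ge0 ?pos_power_ge0.
- by rewrite mule_ge0.
rewrite pos_power_convolution Beta_rising// natrD addrACA.
rewrite [X in _ * X = _]muleA -EFinM muleACA -EFinM [Z * _]muleC; congr (_%:E * _).
by field; rewrite !gt_eqF ?rising_gt0// addr_gt0.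
Qed.

Lemma iint_simplex_moment k r y m : (forall i, 0 <= y i)%R ->
  iint k (fun u => (simplex_dens k r u * simplex_dot k r y u ^+ m)%:E) =
  (pos_power (k.+1%:R * c + m%:R) r *
    (rising_multinomial k y m / rising (k.+1%:R * c) m))%:E * simplex_mass k.
Proof.
elim: k r y m => [|k IH] r y m y0 /=.
  rewrite /simplex_dens /simplex_dot !big_ord0 subr0 mul1r add0r mule1 mul1r.
  congr EFin; rewrite pos_powerDn exprMn; field.
  by rewrite gt_eqF// rising_gt0.
have kc : (0 < k.+1%:R * c)%R by rewrite mulr_gt0.
have ck : (k.+2%:R * c = c + k.+1%:R * c)%R by rewrite -[in LHS]natr1 mulrDl mul1r addrC.
have A0 (i : 'I_m.+1) : (0 <= 'C(m, i)%:R * y 0%N ^+ (m - i))%R.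
  by rewrite mulr_ge0 ?exprn_ge0.
have M0 i : (0 <= rising_multinomial k (fun j => y j.+1) i)%R.
  exact: rising_multinomial_ge0.
under eq_integral => x _.
  rewrite iint_simplex_slice//; under eq_bigr => i _ do rewrite IH//.
  over.
rewrite ge0_integral_sum//; last 2 first.
- move=> i; apply: emeasurable_funM; last apply: emeasurable_funM => //.
    apply/measurable_EFinP; apply: measurable_funM => //; exact: measurable_pos_power.
  apply/measurable_EFinP; apply: measurable_funM => //.
  by apply: (measurableT_comp (measurable_pos_power _)); exact: measurable_funB.
- move=> i x _; apply: mule_ge0.
    by rewrite lee_fin; apply: mulr_ge0; [exact: A0|exact: pos_power_ge0].
  apply: mule_ge0; last exact: simplex_mass_ge0.
  by rewrite lee_fin mulr_ge0 ?pos_power_ge0// divr_ge0// ltW// rising_gt0.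
transitivity (\sum_(i < m.+1) (pos_power (k.+2%:R * c + m%:R) r *
    ('C(m, i)%:R * y 0%N ^+ (m - i) * rising c (m - i) *
      rising_multinomial k (fun j => y j.+1) i / rising (k.+2%:R * c) m))%:E *
    (Beta c (k.+1%:R * c) * simplex_mass k)).
  apply: eq_bigr => i _. apply: (etrans (integral_simplex_slice r _ _ c0 kc (A0 i) (M0 i) _)).
    exact: simplex_mass_ge0.
  have -> : (m - i + i)%N = m by rewrite subnK// -ltnS.
  by rewrite -ck.
rewrite -ge0_sume_distrl; last first.
  move=> i _; rewrite lee_fin mulr_ge0 ?pos_power_ge0// divr_ge0//.
    by apply: mulr_ge0 => //; rewrite mulr_ge0// ltW// rising_gt0.
  by rewrite ltW// rising_gt0// mulr_gt0.
rewrite sumEFin -mulr_sumr -mulr_suml; congr ((_ * (_ / _))%:E * _).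
by apply: eq_bigr => i _; rewrite -(mulrA _ (y 0%N ^+ _)%R) [(y 0%N ^+ _ * _)%R]mulrC.
Qed.

Definition dirichlet_moment k y m : R :=
  (rising_multinomial k y m / rising (k.+1%:R * c) m)%R.

Definition restrict_ord k y (i : 'I_k.+1) : R := y i.
Arguments restrict_ord : clear implicits.

Let psum k y j : R := power_sum (restrict_ord k y) j.

Let psum0E y j : psum 0 y j = (y 0%N ^+ j)%R.
Proof. exact: big_ord1. Qed.

Let psumSE k y j : psum k.+1 y j = (y 0%N ^+ j + psum k (fun i => y i.+1) j)%R.
Proof. exact: big_ord_recl. Qed.

Lemma rising_multinomial0 k y : rising_multinomial k y 0 = 1%R.
Proof.
elim: k y => [|k IH] y /=; first by rewrite rising0 mulr1.
by rewrite big_ord1/= IH rising0 !mulr1.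
Qed.

Lemma rising_multinomial1 k y : rising_multinomial k y 1 = (c * psum k y 1)%R.
Proof.
elim: k y => [|k IH] y; first by rewrite /= !psum0E !risingS rising0; ring.
pose M := rising_multinomial k (fun i => y i.+1).
have -> : (rising_multinomial k.+1 y 1 =
    1%:R * (rising c 1 * y 0%N ^+ 1) * M 0%N +
    (1%:R * (rising c 0 * y 0%N ^+ 0) * M 1%N + 0))%R.
  by rewrite [LHS]/= !big_ord_recl big_ord0.
by rewrite /M !psumSE IH rising_multinomial0 !risingS rising0; ring.
Qed.

Lemma rising_multinomial2 k y :
  rising_multinomial k y 2 = (c ^+ 2 * psum k y 1 ^+ 2 + c * psum k y 2)%R.
Proof.
elim: k y => [|k IH] y; first by rewrite /= !psum0E !risingS rising0; ring.
pose M := rising_multinomial k (fun i => y i.+1).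
have -> : (rising_multinomial k.+1 y 2 =
    1%:R * (rising c 2 * y 0%N ^+ 2) * M 0%N +
    (2%:R * (rising c 1 * y 0%N ^+ 1) * M 1%N +
    (1%:R * (rising c 0 * y 0%N ^+ 0) * M 2%N + 0)))%R.
  by rewrite [LHS]/= !big_ord_recl big_ord0.
by rewrite /M !psumSE IH rising_multinomial0 rising_multinomial1 !risingS rising0; ring.
Qed.

Lemma rising_multinomial3 k y : rising_multinomial k y 3 = (c ^+ 3 * psum k y 1 ^+ 3 +
  3 * c ^+ 2 * psum k y 1 * psum k y 2 + 2 * c * psum k y 3)%R.
Proof.
elim: k y => [|k IH] y; first by rewrite /= !psum0E !risingS rising0; ring.
pose M := rising_multinomial k (fun i => y i.+1).
have -> : (rising_multinomial k.+1 y 3 =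
    1%:R * (rising c 3 * y 0%N ^+ 3) * M 0%N +
    (3%:R * (rising c 2 * y 0%N ^+ 2) * M 1%N +
    (3%:R * (rising c 1 * y 0%N ^+ 1) * M 2%N +
    (1%:R * (rising c 0 * y 0%N ^+ 0) * M 3%N + 0))))%R.
  by rewrite [LHS]/= !big_ord_recl big_ord0.
rewrite /M !psumSE IH rising_multinomial0 rising_multinomial1 rising_multinomial2.
by rewrite !risingS rising0; ring.
Qed.

Lemma rising_multinomial4 k y : rising_multinomial k y 4 = (c ^+ 4 * psum k y 1 ^+ 4 +
  6 * c ^+ 3 * psum k y 1 ^+ 2 * psum k y 2 + 3 * c ^+ 2 * psum k y 2 ^+ 2 +
  8 * c ^+ 2 * psum k y 1 * psum k y 3 + 6 * c * psum k y 4)%R.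
Proof.
elim: k y => [|k IH] y; first by rewrite /= !psum0E !risingS rising0; ring.
pose M := rising_multinomial k (fun i => y i.+1).
have -> : (rising_multinomial k.+1 y 4 =
    1%:R * (rising c 4 * y 0%N ^+ 4) * M 0%N +
    (4%:R * (rising c 3 * y 0%N ^+ 3) * M 1%N +
    (6%:R * (rising c 2 * y 0%N ^+ 2) * M 2%N +
    (4%:R * (rising c 1 * y 0%N ^+ 1) * M 3%N +
    (1%:R * (rising c 0 * y 0%N ^+ 0) * M 4%N + 0)))))%R.
  by rewrite [LHS]/= !big_ord_recl big_ord0.
rewrite /M !psumSE IH rising_multinomial0 rising_multinomial1 rising_multinomial2.
by rewrite rising_multinomial3 !risingS rising0; ring.
Qed.

Definition centered_dirichlet_moment4 k y : R := (dirichlet_moment k y 4 -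
  4 * power_mean (restrict_ord k y) * dirichlet_moment k y 3 +
  6 * power_mean (restrict_ord k y) ^+ 2 * dirichlet_moment k y 2 -
  4 * power_mean (restrict_ord k y) ^+ 3 * dirichlet_moment k y 1 +
  power_mean (restrict_ord k y) ^+ 4)%R.

Lemma centered_dirichlet_moment4E k y : centered_dirichlet_moment4 k y =
  ((6 * c * power_sum (centered (restrict_ord k y)) 4 +
    3 * c ^+ 2 * power_sum (centered (restrict_ord k y)) 2 ^+ 2) / rising (k.+1%:R * c) 4)%R.
Proof.
rewrite /centered_dirichlet_moment4 /dirichlet_moment.
rewrite rising_multinomial4 rising_multinomial3 rising_multinomial2 rising_multinomial1.
rewrite centered_power_sum4// centered_power_sum2//.
have n0 : (0 < k.+1%:R :> R)%R by rewrite ltr0n.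
have -> : (psum k y 1 = k.+1%:R * power_mean (restrict_ord k y))%R.
  by rewrite mulrC divfK// gt_eqF.
rewrite /psum -/(restrict_ord k y) !risingS rising0; move: (power_mean (restrict_ord k y)) => q.
move: (power_sum (restrict_ord k y) 2) (power_sum (restrict_ord k y) 3).
move: (power_sum (restrict_ord k y) 4) => p4 p2 p3.
have s0 : (0 < k.+1%:R * c)%R by rewrite mulr_gt0.
move: (k.+1%:R : R)%R n0 s0 => n n0 s0.
by field; rewrite !gt_eqF// addr_gt0.
Qed.

Definition dirichlet_fourth_bound : R := ((12 * c + 6 * c ^+ 2) / c ^+ 4)%R.

Lemma dirichlet_fourth_bound_ge0 : (0 <= dirichlet_fourth_bound)%R.
Proof.
by rewrite divr_ge0 ?exprn_ge0 ?(ltW c0)// addr_ge0// mulr_ge0 ?sqr_ge0// ltW.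
Qed.

Lemma centered_dirichlet_moment4_le k y : (forall i, 0 <= y i)%R ->
  (centered_dirichlet_moment4 k y <=
   dirichlet_fourth_bound * power_sum (restrict_ord k y) 4 / k.+1%:R ^+ 3)%R.
Proof.
move=> y0; rewrite centered_dirichlet_moment4E.
have n0 : (0 < k.+1%:R :> R)%R by rewrite ltr0n.
have n1 : (1 <= k.+1%:R :> R)%R by rewrite ler1n.
have kc : (0 < k.+1%:R * c)%R by rewrite mulr_gt0.
have q4_le := centered_power_sum4_le (ltn0Sn k) (fun i : 'I_k.+1 => y0 i).
have q2_le := power_sum_sqr_le (ltn0Sn k) (centered (restrict_ord k y)) 2.
have p40 : (0 <= power_sum (restrict_ord k y) 4)%R.
  by apply: sumr_ge0 => i _; rewrite exprn_ge0// y0.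
rewrite ler_pdivrMr ?rising_gt0//.
apply: (@le_trans _ _ ((12 * c + 6 * c ^+ 2) * (k.+1%:R * power_sum (restrict_ord k y) 4))%R).
  have c2 := sqr_ge0 c; have p4n : (power_sum (restrict_ord k y) 4 <=
      k.+1%:R * power_sum (restrict_ord k y) 4)%R by rewrite ler_peMl.
  have {}q2_le := ler_wpM2l c2 (le_trans q2_le (ler_wpM2l (ltW n0) q4_le)).
  have {}q4_le := ler_wpM2l (ltW c0) (le_trans q4_le (ler_wpM2l (ler0n _ 2) p4n)).
  by rewrite -!mulrA [leRHS]mulrDl -!mulrA; lra.
apply: (@le_trans _ _ (dirichlet_fourth_bound * power_sum (restrict_ord k y) 4 /
    k.+1%:R ^+ 3 * (k.+1%:R * c) ^+ 4)%R).
  rewrite /dirichlet_fourth_bound le_eqVlt; apply/predU1P; left.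
  move: (power_sum _ 4) (k.+1%:R : R)%R n0 => p4 n n0.
  by field; rewrite !gt_eqF.
apply: ler_wpM2l (rising_ge_expr 4 (ltW kc)).
apply: divr_ge0; last exact: exprn_ge0 (ltW n0).
by rewrite mulr_ge0// dirichlet_fourth_bound_ge0.
Qed.

Lemma iint_simplex_dens k : iint k (fun u => (simplex_dens k 1 u)%:E) = simplex_mass k.
Proof.
have := @iint_simplex_moment k 1 (fun=> 0%R) 0 (fun _ => lexx 0%R).
rewrite pos_power1 rising_multinomial0 rising0 divr1 mul1r mul1e => <-.
by apply: eq_iint => u _; rewrite expr0 mulr1.
Qed.

Let measurable_centered_dens k y (q : R) : measurable_at k (fun u =>
  ((simplex_dot k 1 y u - q) ^+ 4 * simplex_dens k 1 u)%:E).
Proof.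
apply/measurable_EFinP; apply: measurable_funM; last exact: measurable_simplex_dens.
by apply: measurable_funX; apply: measurable_funB => //; exact: measurable_simplex_dot.
Qed.

(* Moving the odd terms of the binomial expansion to the left keeps all the terms
   nonnegative. *)
Lemma iint_centered_moment4 k y z : (forall i, 0 <= y i)%R -> simplex_mass k = z%:E ->
  iint k (fun u => ((simplex_dot k 1 y u - power_mean (restrict_ord k y)) ^+ 4 *
    simplex_dens k 1 u)%:E) = (centered_dirichlet_moment4 k y * z)%:E.
Proof.
move=> y0 massE; rewrite /centered_dirichlet_moment4.
set q := power_mean _; set X := iint _ _.
have q0 : (0 <= q)%R.
  by rewrite divr_ge0//; apply: sumr_ge0 => i _; rewrite exprn_ge0// y0.
pose F m u : \bar R := (simplex_dens k 1 u * simplex_dot k 1 y u ^+ m)%:E.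
have F0 m u : 0 <= F m u by rewrite lee_fin simplex_dens_dot_ge0.
have mF m : measurable_at k (F m) by exact: measurable_simplex_dens_dot.
have mZF m (r : R) : measurable_at k (fun u => r%:E * F m u).
  by apply: emeasurable_funM => //; exact: mF.
have ZF0 m (r : R) u : (0 <= r)%R -> 0 <= r%:E * F m u.
  by move=> r0; apply: mule_ge0; [rewrite lee_fin|].
have iintF m (r : R) : (0 <= r)%R ->
    iint k (fun u => r%:E * F m u) = (r * (dirichlet_moment k y m * z))%:E.
  by move=> r0; rewrite iintZl// iint_simplex_moment// massE pos_power1 mul1r.
have [q1 q2 q3 q4] : [/\ 0 <= 4 * q, 0 <= 6 * q ^+ 2, 0 <= 4 * q ^+ 3 & 0 <= q ^+ 4]%R.
  by rewrite !exprn_ge0//; split=> //; rewrite mulr_ge0// exprn_ge0.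
have balance : X + ((4 * q * (dirichlet_moment k y 3 * z))%:E +
      (4 * q ^+ 3 * (dirichlet_moment k y 1 * z))%:E) =
    (1 * (dirichlet_moment k y 4 * z))%:E + ((6 * q ^+ 2 * (dirichlet_moment k y 2 * z))%:E +
      (q ^+ 4 * (dirichlet_moment k y 0 * z))%:E).
  rewrite -!iintF// -!iintD//; try by move=> u; rewrite ?adde_ge0// ZF0.
  - by apply: eq_iint => u _; rewrite /F -!EFinM -!EFinD; congr EFin; ring.
  - by apply: emeasurable_funD; exact: mZF.
  - by move=> u; rewrite lee_fin mulr_ge0 ?simplex_dens_ge0// exprn_even_ge0.
  - by apply: emeasurable_funD; exact: mZF.
have moment0 : dirichlet_moment k y 0 = 1%R.
  by rewrite /dirichlet_moment rising_multinomial0 rising0 divr1.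
move: balance; rewrite -!EFinD moment0; case: X => [v| |]//= [vE]; congr EFin.
apply: (addIr (4 * q * (dirichlet_moment k y 3 * z) +
  4 * q ^+ 3 * (dirichlet_moment k y 1 * z))%R).
by rewrite vE; ring.
Qed.

Lemma dir_dens_simplex_dens k u : size u = k -> dir_dens c u = simplex_dens k 1 u.
Proof.
move=> uk; rewrite (dir_densE c uk) /simplex_dens.
rewrite mulrACA -big_split/=; congr (_ * _)%R; first apply: eq_bigr => i _.
  by rewrite /pos_power indicE mem_setE in_itv/= andbT.
by rewrite /pos_power indicE mem_setE in_itv/= subr_gt0.
Qed.

Lemma dir_ext_simplex_dot k y u :
  (\sum_(i < k.+1) dir_ext u i * y i = simplex_dot k 1 y u)%R.
Proof.
rewrite /simplex_dot big_ord_recr/=; congr (_ + _)%R.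
  by apply: eq_bigr => i _; rewrite /dir_ext/= ltn_ord.
by rewrite /dir_ext/= ltnn.
Qed.

Lemma dir_law_centered_moment4_le n (x : 'I_n -> R) : (0 < n)%N -> (forall i, 0 <= x i)%R ->
  dir_law c n setT = 1 ->
  \int[dir_law c n]_v ((\sum_i tnth v i * x i - power_mean x) ^+ 4)%:E <=
  (dirichlet_fourth_bound * power_sum x 4 / n%:R ^+ 3)%:E.
Proof.
case: n x => [//|k] x _ x0 law1; pose y j := x (inord j).
have y0 j : (0 <= y j)%R by exact: x0.
have -> : x = restrict_ord k y by apply/funext => i; rewrite /restrict_ord /y inord_val.
have [z z0 massE] : exists2 z : R, (0 < z)%R & density_mass k (dir_dens c) = z%:E.
  exact: (@density_mass_gt0 _ _ _ _ _ (@measurable_dir_tuple R k.+1)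
    (@measurable_dir_dens R k c) (dir_dens_ge0 c) law1).
have simplex_massE : simplex_mass k = z%:E.
  rewrite -massE -iint_simplex_dens.
  by apply: eq_iint => u uk; rewrite (dir_dens_simplex_dens uk).
rewrite integral_density_law/= ?massE; last 2 first.
- by move=> v; rewrite lee_fin exprn_even_ge0.
- apply/measurable_EFinP; apply: measurable_funX; apply: measurable_funB => //.
  by apply: measurable_sum => i; apply: measurable_funM => //; exact: measurable_tnth.
rewrite (eq_iint (G := fun u => ((simplex_dot k 1 y u - power_mean (restrict_ord k y)) ^+ 4 *
    simplex_dens k 1 u)%:E)); last first.
  move=> u uk; rewrite -EFinM (dir_dens_simplex_dens uk) -dir_ext_simplex_dot.
  by congr (((_ - _) ^+ 4 * _)%:E); apply: eq_bigr => i _; rewrite tnth_mktuple.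
rewrite (iint_centered_moment4 y0 simplex_massE) -EFinM lee_fin mulfK ?gt_eqF//.
exact: centered_dirichlet_moment4_le.
Qed.

End dirichlet_moments.

(** * Concentration of the weighted moments *)

Definition weighted_moment (R : realType) n (m x : 'I_n -> R) k : R := \sum_i m i * x i ^+ k.

Lemma weighted_momentZ (R : realType) n (m x : 'I_n -> R) (z : R) k :
  weighted_moment m (fun i => z * x i) k = z ^+ k * weighted_moment m x k.
Proof. by rewrite mulr_sumr; apply: eq_bigr => i _; rewrite exprMn mulrCA. Qed.

Lemma weighted_moment_uniform (R : realType) (a b : nat -> R) (x : forall n, 'I_n -> R) k n :
  weighted_moment (fun=> n%:R^-1) (x n) k / eigenvalue_scale a b n ^+ k =
  scaled_moment a b x k n.
Proof. by rewrite /weighted_moment -mulr_sumr /scaled_moment invfM mulrA [_^-1 * _]mulrC. Qed.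

Section weight_fluctuation.
Context (R : realType) (d : measure_display) (T : measurableType d).
Variables (P : probability T R) (beta a b c : R) (n : nat) (lam w : T -> 'I_n -> R).
Hypothesis ensP : jacobi_ensemble P beta a b c lam w.
Hypothesis c0 : 0 < c.
Hypothesis n0 : (0 < n)%N.
Variable g : R -> R.
Hypothesis mg : measurable_fun setT g.
Hypothesis g0 : forall y, 0 <= g y.

Let gx (x : n.-tuple R) i := g (tnth x i).

Let mgx i : measurable_fun setT (gx ^~ i).
Proof. exact: (measurableT_comp mg (measurable_tnth i)). Qed.

Let measurable_gx_power_sum k : measurable_fun setT (fun x => power_sum (gx x) k).
Proof. by apply: measurable_sum => i; apply: measurable_funX; exact: mgx. Qed.

Let fluctuation (xv : n.-tuple R * n.-tuple R) : \bar R :=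
  ((\sum_i tnth xv.2 i * gx xv.1 i - power_mean (gx xv.1)) ^+ 4)%:E.

Let bound x : \bar R := (dirichlet_fourth_bound c * power_sum (gx x) 4 / n%:R ^+ 3)%:E.

Let fluctuation_ge0 xv : (0 <= fluctuation xv)%E.
Proof. by rewrite lee_fin exprn_even_ge0. Qed.

Let bound_ge0 x : (0 <= bound x)%E.
Proof.
rewrite lee_fin; apply: divr_ge0; last exact: exprn_ge0.
apply: mulr_ge0; last by apply: sumr_ge0 => i _; exact: exprn_ge0 (g0 _).
exact: dirichlet_fourth_bound_ge0.
Qed.

Let measurable_fluctuation : measurable_fun setT fluctuation.
Proof.
apply/measurable_EFinP; apply: measurable_funX; apply: measurable_funB.
  apply: measurable_sum => i; apply: measurable_funM.
    exact: (measurableT_comp (measurable_tnth i)).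
  exact: (measurableT_comp (mgx i)).
by apply: measurable_funM => //; exact: (measurableT_comp (measurable_gx_power_sum 1)).
Qed.

Let measurable_bound : measurable_fun setT bound.
Proof. by apply/measurable_EFinP; apply: measurable_funM => //; exact: measurable_funM. Qed.

(* Given the eigenvalues, the weights follow the Dirichlet law. *)
Lemma weighted_sum_fourth_le :
  (\int[P]_t ((\sum_i w t i * g (lam t i) - power_mean (fun i => g (lam t i))) ^+ 4)%:E <=
   \int[P]_t (dirichlet_fourth_bound c * power_sum (fun i => g (lam t i)) 4 / n%:R ^+ 3)%:E)%E.
Proof.
have gx_lam t : gx (eigenvalue_tuple lam t) = fun i => g (lam t i).
  by apply/funext => i; rewrite /gx tnth_mktuple.
rewrite [leLHS](eq_integral (fluctuation \o eigenvalue_weight lam w)); last first.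
  move=> t _; rewrite /fluctuation/= gx_lam; congr ((_ - _) ^+ 4)%:E.
  by apply: eq_bigr => i _; rewrite tnth_mktuple.
rewrite [leRHS](eq_integral (bound \o eigenvalue_tuple lam)); last first.
  by move=> t _; rewrite /bound/= gx_lam.
rewrite (ensemble_integral ensP)// (ensemble_integral_eigenvalue ensP)//.
apply: ge0_le_integral => //.
- by move=> x _; exact: integral_ge0.
- exact: measurable_fun_fubini_tonelli_F.
- move=> x _; have gx0 i : 0 <= gx x i by exact: g0.
  by apply: le_trans (dir_law_centered_moment4_le c0 n0 gx0 (ensemble_dir_law_setT ensP)).
Qed.

End weight_fluctuation.

Section weight_concentration.
Context (R : realType) (d : measure_display) (T : measurableType d).
Variables (P : probability T R) (beta tau : R) (a b : nat -> R) (c : R).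
Variables (lam w : forall n : nat, T -> 'I_n -> R).
Arguments lam : clear implicits.
Arguments w : clear implicits.
Hypothesis regP : jacobi_regime beta tau a b.
Hypothesis ensP : forall n, jacobi_ensemble P beta (a n) (b n) c (lam n) (w n).
Hypothesis c0 : 0 < c.
Local Notation theta := (eigenvalue_scale a b).
Local Notation x n t := (clamped (lam n) t).
Implicit Types n k : nat.

Definition weight_fluctuation k n t : R :=
  weighted_moment (w n t) (x n t) k - power_sum (x n t) k / n%:R.

Lemma measurable_weight_fluctuation k n : measurable_fun setT (weight_fluctuation k n).
Proof.
apply: measurable_funB; last first.
  by apply: measurable_funM => //; exact: (measurable_power_sum (ensP n)).
apply: measurable_sum => i; apply: measurable_funM; first exact: (measurable_weight (ensP n)).
by apply: measurable_funX; exact: (measurable_clamped (ensP n)).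
Qed.

Lemma weight_fluctuation_fourth_le k n : (0 < n)%N ->
  (\int[P]_t (weight_fluctuation k n t ^+ 4)%:E <=
   (dirichlet_fourth_bound c * mean_power_sum P lam n (4 * k) / n%:R ^+ 3)%:E)%E.
Proof.
move=> n0; have mg : measurable_fun setT (fun y : R => clamp y ^+ k).
  by apply: measurable_funX; exact: measurable_clamp.
have g0 y : 0 <= clamp y ^+ k :> R by rewrite exprn_ge0//; have /andP[/ltW] := clamp_itv y.
have := weighted_sum_fourth_le (ensP n) c0 n0 mg g0.
under eq_integral => t _.
  rewrite (_ : power_mean _ = power_sum (x n t) k / n%:R); last first.
    by congr (_ / _); apply: eq_bigr => i _; rewrite expr1.
  over.
move=> /le_trans; apply; under eq_integral => t _.
  rewrite (_ : power_sum _ 4 = power_sum (x n t) (4 * k)); last first.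
    by apply: eq_bigr => i _; rewrite -exprM mulnC.
  rewrite mulrAC EFinM; over.
have i_sum := integrable_power_sum (ensP n) (4 * k).
rewrite ge0_integralZl_EFin//; last 3 first.
- by move=> t _; rewrite lee_fin power_sum_ge0// => i; have /andP[/ltW] := clamped_itv (lam n) t i.
- by have /integrableP[] := i_sum.
- by rewrite divr_ge0 ?exprn_ge0// dirichlet_fourth_bound_ge0.
rewrite -[X in (_ * X)%E]fineK; last exact: integrable_fin_num i_sum.
by rewrite -EFinM mulrAC.
Qed.

Lemma scaled_fluctuation_fourth_le k : exists C : R, \forall n \near \oo,
  (\int[P]_t ((weight_fluctuation k n t / theta n ^+ k) ^+ 4)%:E <= (C / n%:R ^+ 2)%:E)%E.
Proof.
have [C C0 mean_le] := mean_power_sum_le regP ensP (4 * k).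
exists (dirichlet_fourth_bound c * C).
apply: filterS2 mean_le (nbhs_infty_gt 0) => n {}mean_le n0.
have nR0 : 0 < n%:R :> R by rewrite ltr0n.
have tk0 : 0 < theta n ^+ (4 * k) by rewrite exprn_gt0// (eigenvalue_scale_gt0 regP).
have K0 := dirichlet_fourth_bound_ge0 c0.
rewrite (_ : (fun t => _) = (fun t => (theta n ^- (4 * k))%:E *
    (weight_fluctuation k n t ^+ 4)%:E)%E); last first.
  by apply/funext => t; rewrite -EFinM exprMn mulrC exprVn -exprM mulnC.
rewrite ge0_integralZl_EFin//; last 3 first.
- by move=> t _; rewrite lee_fin exprn_even_ge0.
- by apply/measurable_EFinP; apply: measurable_funX; exact: measurable_weight_fluctuation.
- by rewrite invr_ge0 ltW.
have inv_tk0 : (0 <= (theta n ^- (4 * k))%:E)%E by rewrite lee_fin invr_ge0 ltW.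
apply: (le_trans (lee_wpmul2l inv_tk0 (weight_fluctuation_fourth_le k n0))).
rewrite -EFinM lee_fin mulrC ler_pdivrMr// ler_pdivrMr ?exprn_gt0//.
apply: (le_trans (ler_wpM2l K0 mean_le)).
rewrite le_eqVlt; apply/predU1P; left.
move: (theta n ^+ (4 * k)) => tk.
by field; rewrite gt_eqF.
Qed.

Lemma weighted_moment_ae_cvg : {ae P, forall t, forall k,
  weighted_moment (w n t) (x n t) k / theta n ^+ k -
    scaled_moment a b (fun m => x m t) k n @[n --> \oo] --> (0 : R)}.
Proof.
apply: ae_foralln => k; have [C fourth_le] := scaled_fluctuation_fourth_le k.
have : {ae P, forall t,
    (weight_fluctuation k n t / theta n ^+ k) ^+ 4 @[n --> \oo] --> (0 : R)}.
  apply: (ae_cvg0_of_mean_le_inv_sqr (C := C)) => //.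
  - move=> n; apply: measurable_funX; apply: measurable_funM => //.
    exact: measurable_weight_fluctuation.
  - by move=> n t; rewrite exprn_even_ge0.
apply: filterS => t /(@cvg0_of_even_power _ _ 2 isT); apply: cvg_trans; apply: near_eq_cvg.
apply: nearW => n; rewrite /scaled_moment /weight_fluctuation.
by rewrite mulrBl invfM mulrA.
Qed.

End weight_concentration.

(** * Moments of the Marchenko-Pastur law *)

(* With [H = 2 tau X M + (1 - tau) X - 1], where [M] is the generating polynomial of the moments,
   the linear recursion reads [2 D H' = D' H] for the discriminant [D]; hence [(H ^ 2 / D)' = 0]
   and [H ^ 2 = D], which is the quadratic recursion. *)
Section quadratic_recursion.
Context (R : realFieldType).
Variables (tau : R) (m : nat -> R).
Hypothesis tau0 : tau != 0.
Hypothesis m0 : m 0%N = 1.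
Hypothesis m1 : m 1%N = 1.
Hypothesis linear_recursion : forall j, (j%:R + 3) * m j.+2 =
  (2 * j%:R + 3) * (1 + tau) * m j.+1 - j%:R * (1 - tau) ^+ 2 * m j.

Variable N : nat.
Let M : {poly R} := \poly_(i < N.+2) m i.
Let H : {poly R} := (2 * tau) *: ('X * M) + (1 - tau) *: 'X - 1.
Let quadratic (A B : R) : {poly R} := 1 + A *: 'X + B *: 'X^2.
Let D := quadratic (- 2 * (1 + tau)) ((1 - tau) ^+ 2).

Let coef_quadraticM A B (p : {poly R}) k : (quadratic A B * p)`_k =
  p`_k + A * (if k is k'.+1 then p`_k' else 0) + B * (if k is k'.+2 then p`_k' else 0).
Proof.
rewrite /quadratic (mulrDl _ _ p) (mulrDl _ _ p) mul1r -!scalerAl 2!coefD 2!coefZ.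
rewrite coefXM coefXnM.
by case: k => [|[|k]] //=; rewrite ?subSS ?subn0.
Qed.

Let coef_deriv_quadraticM A B (p : {poly R}) k : ((quadratic A B)^`() * p)`_k =
  A * p`_k + 2 * B * (if k is k'.+1 then p`_k' else 0).
Proof.
have -> : (quadratic A B)^`() = A%:P + (2 * B) *: 'X.
  rewrite /quadratic !derivD -[1]/(1%:P) derivC add0r !derivZ derivX derivXn /= expr1.
  by rewrite alg_polyC -scaler_nat scalerA mulrC.
rewrite mulrDl -scalerAl coefD coefZ coefXM coefCM.
by case: k.
Qed.

Let coefH0 : H`_0 = -1.
Proof. by rewrite /H !(coefD, coefZ, coefXM, coefX, coefN, coef1)/= !mulr0 !add0r. Qed.

Let coefH1 : H`_1 = 1 + tau.
Proof.
by rewrite /H !(coefD, coefZ, coefXM, coefX, coefN, coef1)/= coef_poly/= m0; ring.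
Qed.

Let coefHS j : (j.+1 < N.+2)%N -> H`_j.+2 = 2 * tau * m j.+1.
Proof.
by move=> jN; rewrite /H !(coefD, coefZ, coefXM, coefX, coefN, coef1)/= coef_poly jN; ring.
Qed.

Let residual := (D * H^`()) *+ 2 - D^`() * H.

Let coef_residual j : (j < N.+2)%N -> residual`_j = 0.
Proof.
move=> jN; rewrite /residual coefB coefMn coef_quadraticM coef_deriv_quadraticM.
case: j jN => [|[|[|j]]] jN; rewrite !coef_deriv.
- by rewrite coefH0 coefH1; ring.
- by rewrite coefHS// coefH0 coefH1 m1; ring.
- have m2 : m 2%N = 1 + tau.
    apply: (@mulfI _ 3%:R); first by rewrite pnatr_eq0.
    by have := linear_recursion 0; rewrite m1 add0r => ->; ring.
  by rewrite coefH1 !coefHS// m1 m2; ring.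
have jN' := ltnW jN; rewrite !coefHS//; last exact: ltnW.
have -> : m j.+3 = ((2 * j.+1%:R + 3) * (1 + tau) * m j.+2 -
    j.+1%:R * (1 - tau) ^+ 2 * m j.+1) / (j.+1%:R + 3).
  have j3 : j.+1%:R + 3 != 0 :> R by rewrite -natrD pnatr_eq0.
  by apply: (canRL (mulfK j3)); rewrite mulrC linear_recursion.
have j3 : 1 + j%:R + 3 != 0 :> R by rewrite gt_eqF// addr_gt0// ltr_pwDl.
by field.
Qed.

Let U := H * H - D.

Let DU : D * U^`() - D^`() * U = H * residual.
Proof. by rewrite /U /residual derivB derivM; ring. Qed.

Let coefU j : (j <= N.+2)%N -> U`_j = 0.
Proof.
elim/ltn_ind: j => -[|j] IH jN.
  rewrite /U coefB coefM big_ord1 coefH0 /D /quadratic !(coefD, coefZ, coefX, coefXn, coef1)/=.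
  by ring.
have : (H * residual)`_j = 0.
  rewrite coefM big1// => i _; rewrite coef_residual ?mulr0//.
  by rewrite (leq_ltn_trans (leq_subr _ _)).
rewrite -DU coefB coef_quadraticM coef_deriv_quadraticM coef_deriv (IH j)//; last exact: ltnW.
case: j IH jN => [|j] IH jN; first by rewrite !mulr0 !addr0 subr0 mulr1n.
rewrite !coef_deriv (IH j.+1) ?(IH j) ?(ltnW jN)// ?(ltnW (ltnW jN))//.
have -> : (if j is k'.+1 then (U^`())`_k' else 0) = 0.
  case: j IH jN => [//|j] IH jN.
  by rewrite coef_deriv IH ?mul0rn// ltnW// ltnW// ltnW.
by rewrite !(mulr0, mul0rn, addr0, subr0) => /eqP; rewrite mulrn_eq0/= => /eqP.
Qed.

Lemma quadratic_of_linear_recursion :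
  m N.+1 = (1 - tau) * m N + tau * \sum_(p < N.+1) m (N - p)%N * m p.
Proof.
pose Q := tau *: ('X * (M * M)) + (1 - tau) *: ('X * M) - M + 1.
have UQ : U = (4 * tau) *: ('X * Q).
  by rewrite /U /H /Q /D /quadratic -!mul_polyC !polyCM !polyCB !polyCD; ring.
have : Q`_N.+1 = 0.
  have : U`_N.+2 = 0 by exact: coefU.
  by rewrite UQ coefZ coefXM/= => /eqP; rewrite !mulf_eq0 (negbTE tau0) pnatr_eq0/= => /eqP.
rewrite /Q !coefD coefN !coefZ !coefXM coef1/= addr0 !coef_poly ltnSn (ltnW (ltnSn _)) coefM.
have -> : \sum_(j < N.+1) M`_j * M`_(N - j) = \sum_(p < N.+1) m (N - p)%N * m p.
  apply: eq_bigr => i _; rewrite !coef_poly mulrC.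
  by rewrite (leq_trans (ltn_ord i))// ltnS (leq_trans (leq_subr _ _)).
by move=> coefQ; lra.
Qed.

End quadratic_recursion.

Section marchenko_pastur.
Context (R : realType).
Notation mu := (@lebesgue_measure R).
Variable tau : R.
Hypothesis tau01 : 0 < tau <= 1.
Implicit Types (t x : R) (k : nat).

Let r : R := Num.sqrt tau.
Let tau0 : 0 < tau. Proof. by case/andP: tau01. Qed.
Let r0 : 0 < r. Proof. by rewrite sqrtr_gt0. Qed.
Let r2 : r ^+ 2 = tau. Proof. by rewrite sqr_sqrtr// ltW. Qed.
Let r1 : r <= 1.
Proof. by rewrite -(@ler_pXn2r _ 2) ?nnegrE ?(ltW r0)// r2 expr1n; case/andP: tau01. Qed.

Let pi_neq0 : pi != 0 :> R. Proof. by rewrite gt_eqF// pi_gt0. Qed.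

Lemma mp_dens_ge0 x : 0 <= mp_dens tau x.
Proof.
rewrite /mp_dens indicE mem_setE in_itv/=.
have [/andP[x_gt _]|_] := boolP (_ < x < _); last by rewrite mulr0.
have x0 : 0 < x by apply: (le_lt_trans _ x_gt); rewrite sqr_ge0.
by rewrite mulr1 divr_ge0// !mulr_ge0// ?pi_ge0// ltW.
Qed.

Lemma measurable_mp_dens : measurable_fun setT (mp_dens tau).
Proof.
have -> : mp_dens tau = fun x => Num.sqrt ((x - mp_minus tau) * (mp_plus tau - x)) *
    ((2 * pi * tau)^-1 * x `^ (-1)) * \1_`]mp_minus tau, mp_plus tau[ x.
  apply/funext => x; rewrite /mp_dens indicE mem_setE in_itv/=.
  have [/andP[x_gt _]|_] := boolP (_ < x < _); last by rewrite !mulr0.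
  by rewrite powR_inv1 ?invfM// ltW// (le_lt_trans _ x_gt)// sqr_ge0.
apply: measurable_funM; last exact: measurable_indic.
apply: measurable_funM; last exact: measurable_funM.
apply: measurableT_comp; first by apply: continuous_measurable_fun; exact: sqrt_continuous.
by apply: measurable_funM; exact: measurable_funB.
Qed.

(* The support is parametrised by [t] in [0, pi]. *)
Definition mp_arc t : R := 1 + tau - 2 * r * cos t.

Lemma is_derive1_mp_arc t : is_derive t (1 : R) mp_arc (2 * r * sin t).
Proof.
apply: (is_derive_eq (is_derive1B (is_derive1_cst (1 + tau) t)
  (is_derive1Zl (2 * r) (is_derive_cos t)))).
by rewrite mulrN opprK add0r.
Qed.

Lemma continuous_mp_arc : continuous mp_arc.
Proof. by move=> t; exact: is_derive1_continuous (is_derive1_mp_arc t). Qed.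

Lemma mp_arc0 : mp_arc 0 = mp_minus tau.
Proof. by rewrite /mp_arc /mp_minus cos0 -/r -r2; ring. Qed.

Lemma mp_arcpi : mp_arc pi = mp_plus tau.
Proof. by rewrite /mp_arc /mp_plus cospi -/r -r2; ring. Qed.

Lemma mp_arc_lt s t : 0 <= s -> t <= pi -> s < t -> mp_arc s < mp_arc t.
Proof.
move=> s0 tpi st; rewrite ltrD2l ltrN2 ltr_pM2l ?mulr_gt0//.
have t0 := le_trans s0 (ltW st); have spi := le_trans (ltW st) tpi.
by rewrite ltr_cos// in_itv/= ?s0 ?spi ?t0 ?tpi.
Qed.

Lemma mp_arc_gt0 t : 0 < t < pi -> 0 < mp_arc t.
Proof.
move=> /andP[t0 tpi]; apply: (le_lt_trans _ (mp_arc_lt (lexx 0) (ltW tpi) t0)).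
by rewrite mp_arc0 sqr_ge0.
Qed.

Lemma mp_arc_discriminant t :
  (mp_arc t - mp_minus tau) * (mp_plus tau - mp_arc t) = (2 * r * sin t) ^+ 2.
Proof. by rewrite -mp_arc0 -mp_arcpi /mp_arc cos0 cospi [RHS]exprMn sin2cos2; ring. Qed.

Lemma mp_dens_arc t : 0 < t < pi ->
  mp_dens tau (mp_arc t) * (2 * r * sin t) = 2 / pi * (sin t ^+ 2 / mp_arc t).
Proof.
move=> t01; have /andP[t0 tpi] := t01.
have arc0 := mp_arc_gt0 t01; have sin0 := sin_gt0_pi t01.
rewrite /mp_dens indicE mem_setE in_itv/= mp_arc_discriminant sqrtr_sqr.
rewrite ger0_norm; last by rewrite !mulr_ge0 ?(ltW r0)// ltW.
rewrite -mp_arc0 -mp_arcpi (mp_arc_lt (lexx 0) (ltW tpi) t0).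
rewrite (mp_arc_lt (ltW t0) (lexx _) tpi)/= -r2.
move: (mp_arc t) arc0 => y y0; move: (pi) pi_neq0 => p p0.
by field; rewrite p0 !gt_eqF.
Qed.

Lemma integral_mp_dens (g : R -> R) : (forall x, 0 <= g x) -> measurable_fun setT g ->
  (\int[mu]_x (g x * mp_dens tau x)%:E =
   \int[mu]_(t in `]0%R, pi[) (2 / pi * (g (mp_arc t) / mp_arc t * sin t ^+ 2))%:E)%E.
Proof.
move=> g0 mg; pose h x : \bar R := (g x * mp_dens tau x)%:E.
have h0 x : (0 <= h x)%E by rewrite lee_fin mulr_ge0// mp_dens_ge0.
have mh : measurable_fun setT h.
  by apply/measurable_EFinP; apply: measurable_funM => //; exact: measurable_mp_dens.
have c_sin : continuous (fun t => 2 * r * sin t).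
  by move=> t; apply: cvgM; [exact: cvg_cst|exact: continuous_sin].
have sin_ge0 t : 0 < t < pi -> 0 <= 2 * r * sin t.
  by move=> /sin_gt0_pi/ltW sin_ge0; rewrite !mulr_ge0// ltW.
have := change_of_variables (pi_gt0 R) continuous_mp_arc c_sin
  (fun t _ => is_derive1_mp_arc t) sin_ge0 mp_arc_lt h0 mh.
rewrite mp_arc0 mp_arcpi => arcE.
transitivity (\int[mu]_(x in `]mp_minus tau, mp_plus tau[) h x)%E.
  rewrite [RHS]integral_mkcond; apply: eq_integral => x _; rewrite patchE.
  case: ifPn => // /negbTE; rewrite mem_setE => xD.
  by rewrite /h /mp_dens indicE mem_setE xD !mulr0.
rewrite arcE; apply: eq_integral => t; rewrite inE/= in_itv/= => t01.
by rewrite /h -EFinM -[X in X%:E = _]mulrA (mp_dens_arc t01); congr EFin; ring.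
Qed.

Definition arc_moment k : R := \int[mu]_(t in `[0%R, pi]) (mp_arc t ^+ k * sin t ^+ 2).

Let continuous_arc_integrand k : continuous (fun t => mp_arc t ^+ k * sin t ^+ 2).
Proof.
have c_power (f : R -> R) j : continuous f -> continuous (fun t => f t ^+ j).
  move=> cf t; apply: (@continuous_comp _ _ _ f (fun y => y ^+ j)); first exact: cf.
  exact: exprn_continuous.
by move=> t; apply: cvgM; apply: c_power; [exact: continuous_mp_arc|exact: continuous_sin].
Qed.

Let continuous_scaled_arc_integrand (z : R) k :
  continuous (fun t => z * (mp_arc t ^+ k * sin t ^+ 2)).
Proof. by move=> t; apply: cvgM; [exact: cvg_cst|exact: continuous_arc_integrand]. Qed.

Let continuous_integrable_0pi (f : R -> R) : continuous f ->
  mu.-integrable `[0%R, pi] (EFin \o f).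
Proof.
move=> cf; apply: continuous_compact_integrable; first exact: segment_compact.
exact: continuous_subspaceT.
Qed.

Let Rintegral_arc (z : R) k :
  \int[mu]_(t in `[0%R, pi]) (z * (mp_arc t ^+ k * sin t ^+ 2)) = z * arc_moment k.
Proof. by rewrite RintegralZl//; exact: continuous_integrable_0pi. Qed.

Let Rintegral_0pi_FTC2 (F f : R -> R) : continuous f -> (forall t, is_derive t (1 : R) F (f t)) ->
  \int[mu]_(t in `[0%R, pi]) f t = F pi - F 0.
Proof.
move=> cf dF; rewrite /Rintegral.
by rewrite (integral_segment_FTC2 (pi_gt0 R) (fun t _ => cf t) (fun t _ => dF t)).
Qed.

Lemma arc_moment0 : arc_moment 0 = pi / 2.
Proof.
have dF t : is_derive t (1 : R) (fun t => 2^-1 * (t - sin t * cos t))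
    (mp_arc t ^+ 0 * sin t ^+ 2).
  apply: (is_derive_eq (is_derive1Zl _ (is_derive1B (is_derive_id t 1)
    (is_derive1M (is_derive_sin t) (is_derive_cos t))))).
  by have := cos2Dsin2 t; rewrite expr0 !mul1r -!expr2; lra.
rewrite /arc_moment (Rintegral_0pi_FTC2 (@continuous_arc_integrand 0) dF).
by rewrite sinpi sin0; ring.
Qed.

Lemma arc_moment1 : arc_moment 1 = (1 + tau) * arc_moment 0.
Proof.
pose f t := (1 + tau) * (mp_arc t ^+ 0 * sin t ^+ 2) - 1 * (mp_arc t ^+ 1 * sin t ^+ 2).
have cf : continuous f.
  by move=> t; apply: cvgB; exact: continuous_scaled_arc_integrand.
have dF t : is_derive t (1 : R) (fun t => 2 * r / 3 * sin t ^+ 3) (f t).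
  apply: (is_derive_eq (is_derive1Zl _ (is_derive1X 2 (is_derive_sin t)))).
  by rewrite /f /mp_arc; field.
have := Rintegral_0pi_FTC2 cf dF; rewrite sinpi sin0 /f.
rewrite RintegralB//; try exact: continuous_integrable_0pi (@continuous_scaled_arc_integrand _ _).
by rewrite !Rintegral_arc mul1r !expr0n/= !mulr0 subr0 => /subr0_eq.
Qed.

Lemma arc_momentS k : (k%:R + 4) * arc_moment k.+2 =
  (2 * k%:R + 5) * (1 + tau) * arc_moment k.+1 - (k%:R + 1) * (1 - tau) ^+ 2 * arc_moment k.
Proof.
pose f t := (2 * k%:R + 5) * (1 + tau) * (mp_arc t ^+ k.+1 * sin t ^+ 2) -
    (k%:R + 1) * (1 - tau) ^+ 2 * (mp_arc t ^+ k * sin t ^+ 2).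
pose g t := (k%:R + 4) * (mp_arc t ^+ k.+2 * sin t ^+ 2).
have cf : continuous f.
  by move=> t; apply: cvgB; exact: continuous_scaled_arc_integrand.
have cg : continuous g by exact: continuous_scaled_arc_integrand.
have dF t : is_derive t (1 : R) (fun t => 2 * r * (mp_arc t ^+ k.+1 * sin t ^+ 3)) (f t - g t).
  apply: (is_derive_eq (is_derive1Zl _ (is_derive1M (is_derive1X k (is_derive1_mp_arc t))
    (is_derive1X 2 (is_derive_sin t))))).
  have -> : sin t ^+ 3 * (k.+1%:R * mp_arc t ^+ k * (2 * r * sin t)) =
     k.+1%:R * mp_arc t ^+ k * (2 * r) * (sin t ^+ 2) ^+ 2 by ring.
  rewrite /f /g !sin2cos2 !(exprS (mp_arc t)); move: (mp_arc t ^+ k) => y.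
  by rewrite /mp_arc -r2 -!natr1; move: (cos t) => z; ring.
have cfg : continuous (fun t => f t - g t) by move=> t; apply: cvgB; [exact: cf|exact: cg].
have := Rintegral_0pi_FTC2 cfg dF; rewrite sinpi sin0 RintegralB//;
  try exact: continuous_integrable_0pi.
rewrite RintegralB//; try exact: continuous_integrable_0pi (@continuous_scaled_arc_integrand _ _).
by rewrite !Rintegral_arc !expr0n/= !mulr0 subr0 => /subr0_eq.
Qed.

(* The argument of [1 - r * exp (- i t)], whose derivative brings in [1 / mp_arc]. *)
Definition arc_angle t : R := atan (r * sin t / (1 - r * cos t)).

Let dist_cos_gt0 t : 0 < t < pi -> 0 < 1 - r * cos t.
Proof.
move=> /andP[t0 tpi]; rewrite subr_gt0.
have cos_lt1 : cos t < 1.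
  by rewrite -cos0 ltr_cos// in_itv/= ?lexx ?pi_ge0// (ltW t0) (ltW tpi).
have [cos_le0|cos_gt0] := leP (cos t) 0.
  by rewrite (le_lt_trans _ ltr01)// pmulr_rle0.
by rewrite (le_lt_trans _ cos_lt1)// ler_piMl// ltW.
Qed.

Let mp_arc_sqr t : mp_arc t = (1 - r * cos t) ^+ 2 + (r * sin t) ^+ 2.
Proof. by rewrite exprMn sin2cos2 /mp_arc -r2; ring. Qed.

Let mp_arc_gt0_den t : 1 - r * cos t != 0 -> 0 < mp_arc t.
Proof.
by move=> den0; rewrite mp_arc_sqr; apply: ltr_pwDl (sqr_ge0 _); rewrite exprn_even_gt0.
Qed.

Lemma is_derive1_arc_angle t : 1 - r * cos t != 0 ->
  is_derive t (1 : R) arc_angle ((r * cos t - tau) / mp_arc t).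
Proof.
move=> den0; pose ratio u := r * sin u * (1 - r * cos u)^-1.
have d_den : is_derive t (1 : R) (fun u => 1 - r * cos u) (r * sin t).
  apply: (is_derive_eq (is_derive1B (is_derive1_cst 1 t) (is_derive1Zl r (is_derive_cos t)))).
  by rewrite mulrN opprK add0r.
have d_ratio := is_derive1M (is_derive1Zl r (is_derive_sin t)) 
  (@is_derive1V R (fun u => 1 - r * cos u) t _ den0 d_den).
apply: (is_derive_eq (@is_derive1_comp R atan ratio t _ _ (is_derive1_atan _) d_ratio)).
have arc0 := mp_arc_gt0_den den0.
have -> : 1 + ratio t ^+ 2 = mp_arc t / (1 - r * cos t) ^+ 2.
  by rewrite mp_arc_sqr /ratio; move: (sin t) (cos t) den0 => y z den0; field.
have -> : r * cos t - tau = r * cos t * (1 - r * cos t) - r ^+ 2 * sin t ^+ 2.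
  by rewrite sin2cos2 -r2; ring.
move: (mp_arc t) arc0 (sin t) (cos t) den0 => y y0 s z den0.
by field; rewrite den0 gt_eqF.
Qed.

Definition mp_primitive t : R := (2 * pi * tau)^-1 *
  ((1 + tau) * t + 2 * r * sin t - (1 - tau) * (t + 2 * arc_angle t)).

Lemma is_derive1_mp_primitive t : 1 - r * cos t != 0 -> mp_arc t != 0 ->
  is_derive t (1 : R) mp_primitive (2 / pi * (1 / mp_arc t * sin t ^+ 2)).
Proof.
move=> den0 arc0.
apply: (is_derive_eq (is_derive1Zl _ (is_derive1B (is_derive1D (is_derive1_mull (1 + tau) t)
  (is_derive1Zl (2 * r) (is_derive_sin t)))
  (is_derive1Zl (1 - tau) (is_derive1D (is_derive_id t 1)
    (is_derive1Zl 2 (is_derive1_arc_angle den0))))))).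
have rn : r != 0 by rewrite gt_eqF.
rewrite sin2cos2 -r2; move: arc0; rewrite /mp_arc -r2 => arc0.
move: (pi) pi_neq0 (cos t) arc0 => p p0 z arc0.
by field; rewrite p0 arc0 rn.
Qed.

Let cvg_mp_primitive t : 1 - r * cos t != 0 -> {for t, continuous mp_primitive}.
Proof.
move=> den0; apply: (is_derive1_continuous (is_derive1_mp_primitive den0 _)).
by rewrite gt_eqF// mp_arc_gt0_den.
Qed.

(* For [tau = 1] the angle jumps at 0, but its coefficient vanishes. *)
Lemma cvg_mp_primitive0 : mp_primitive t @[t --> 0^'+] --> (0 : R).
Proof.
have prim0 : mp_primitive 0 = 0.
  by rewrite /mp_primitive /arc_angle sin0 !(mulr0, mul0r) atan0 mulr0 !addr0 mulr0 subr0 mulr0.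
rewrite -[X in _ --> X]prim0; have [r11|r11] := eqVneq r 1; last first.
  apply: cvg_at_right_filter; apply: cvg_mp_primitive.
  by rewrite cos0 mulr1 subr_eq0 eq_sym.
have -> : mp_primitive = fun t => (2 * pi * tau)^-1 * ((1 + tau) * t + 2 * r * sin t).
  by apply/funext => t; rewrite /mp_primitive -r2 r11 expr1n subrr mul0r subr0.
apply: cvg_at_right_filter; apply: cvgM; first exact: cvg_cst.
apply: cvgD; apply: cvgM; try exact: cvg_cst; first exact: cvg_id.
exact: continuous_sin.
Qed.

Lemma cvg_mp_primitivepi : mp_primitive t @[t --> pi^'-] --> (1 : R).
Proof.
have primpi : mp_primitive pi = 1.
  rewrite /mp_primitive /arc_angle sinpi !(mulr0, mul0r) atan0 mulr0 !addr0.
  by move: (pi) pi_neq0 => p p0; field; rewrite p0 gt_eqF.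
rewrite -[X in _ --> X]primpi; apply: cvg_at_left_filter; apply: cvg_mp_primitive.
by rewrite cospi mulrN1 opprK gt_eqF// addr_gt0.
Qed.

Lemma integral_mp_dens_setT : (\int[mu]_x (mp_dens tau x)%:E = 1)%E.
Proof.
transitivity (\int[mu]_x ((fun=> 1 : R) x * mp_dens tau x)%:E)%E.
  by apply: eq_integral => x _; rewrite mul1r.
rewrite integral_mp_dens//.
have := @ge0_FTC2_oo R (fun t => 2 / pi * (1 / mp_arc t * sin t ^+ 2)) mp_primitive 0 pi 0 1.
rewrite subr0; apply.
- exact: pi_gt0.
- move=> t /mp_arc_gt0 arc0; apply: mulr_ge0; first by rewrite divr_ge0// pi_ge0.
  by rewrite mulr_ge0 ?sqr_ge0// divr_ge0// ltW.
- move=> t /mp_arc_gt0 arc0; apply: cvgM; first exact: cvg_cst.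
  apply: cvgM; first apply: cvgM; first exact: cvg_cst.
    by apply: cvgV; [rewrite gt_eqF|exact: continuous_mp_arc].
  by apply: cvgM; exact: continuous_sin.
- move=> t t01; apply: is_derive1_mp_primitive; rewrite gt_eqF ?mp_arc_gt0//.
  exact: dist_cos_gt0.
- exact: cvg_mp_primitive0.
- exact: cvg_mp_primitivepi.
Qed.

Lemma integral_mp_dens_exprS k :
  (\int[mu]_x (x ^+ k.+1 * mp_dens tau x)%:E = (2 / pi * arc_moment k)%:E)%E.
Proof.
transitivity (\int[mu]_x (`|x| ^+ k.+1 * mp_dens tau x)%:E)%E.
  apply: eq_integral => x _; rewrite /mp_dens indicE mem_setE in_itv/=.
  have [/andP[x0 _]|_] := boolP (_ < x < _); last by rewrite !mulr0.
  by rewrite ger0_norm// ltW// (le_lt_trans _ x0)// sqr_ge0.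
have m_norm : measurable_fun setT (fun x : R => `|x| ^+ k.+1).
  by apply: measurable_funX; apply: continuous_measurable_fun; exact: norm_continuous.
rewrite (integral_mp_dens (fun x => exprn_ge0 _ (normr_ge0 x)) m_norm).
have i_arc : mu.-integrable `[0%R, pi] (EFin \o (fun t => 2 / pi * (mp_arc t ^+ k * sin t ^+ 2))).
  exact: continuous_integrable_0pi (@continuous_scaled_arc_integrand _ _).
have arcE t : 0 < t < pi -> 2 / pi * (`|mp_arc t| ^+ k.+1 / mp_arc t * sin t ^+ 2) =
    2 / pi * (mp_arc t ^+ k * sin t ^+ 2).
  by move=> /mp_arc_gt0 arc0; rewrite gtr0_norm// exprSr mulfK// gt_eqF.
rewrite -Rintegral_arc /Rintegral fineK; last exact: integrable_fin_num i_arc.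
rewrite [RHS](@integral_itv_bndoo _ _ _ _ true false).
  by apply: eq_integral => t; rewrite inE/= in_itv/= => /arcE ->.
by apply: measurable_funS (measurable_int _ i_arc) => //; exact: subset_itv_oo_cc.
Qed.

Lemma mp_int_recursion : let m k := mp_int tau (fun x => x ^+ k) in
  m 0%N = 1 /\
  forall k, m k.+1 = (1 - tau) * m k + tau * \sum_(p < k.+1) m (k - p)%N * m p.
Proof.
move=> m.
have m0 : m 0%N = 1.
  rewrite /m /mp_int /Rintegral (_ : (fun x => _) = EFin \o mp_dens tau) ?integral_mp_dens_setT//.
  by apply/funext => x; rewrite expr0 mul1r.
have mS k : m k.+1 = 2 / pi * arc_moment k.
  by rewrite /m /mp_int /Rintegral integral_mp_dens_exprS.
have m1 : m 1%N = 1 by rewrite mS arc_moment0; move: (pi) pi_neq0 => p p0; field.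
split => // k; apply: quadratic_of_linear_recursion => //; first by rewrite gt_eqF.
case=> [|j]; rewrite !mS; first by rewrite arc_moment1; ring.
have j1 : j.+1%:R = j%:R + 1 :> R by rewrite natr1.
rewrite mulrCA (_ : j.+1%:R + 3 = j%:R + 4); last by rewrite j1; ring.
by rewrite arc_momentS j1; ring.
Qed.

End marchenko_pastur.

(** * From moments to weak convergence *)

Section bernstein.
Context (R : realType).
Implicit Types (g h : nat -> R) (x : R).

(* The Bernstein polynomial, i.e. the sum of the [g k * 'C(n, k) * x ^+ k * (1 - x) ^+ (n - k)],
   computed by Pascal's rule. *)
Fixpoint bernstein n g x : R :=
  if n is n'.+1 then (1 - x) * bernstein n' g x + x * bernstein n' (fun k => g k.+1) x
  else g 0%N.

Lemma bernstein_poly n g : exists p : {poly R}, forall x, bernstein n g x = p.[x].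
Proof.
elim: n g => [|n IH] g; first by exists (g 0%N)%:P => x; rewrite hornerC.
have [p pE] := IH g; have [q qE] := IH (fun k => g k.+1).
by exists ((1 - 'X) * p + 'X * q) => x; rewrite /= pE qE !hornerE.
Qed.

Lemma le_bernstein n g h x : 0 <= x <= 1 -> (forall k, (k <= n)%N -> g k <= h k) ->
  bernstein n g x <= bernstein n h x.
Proof.
move=> /andP[x0 x1]; elim: n g h => [|n IH] g h gh /=; first exact: gh.
apply: lerD; apply: ler_wpM2l; rewrite ?subr_ge0//; apply: IH => k kn; apply: gh => //.
exact: ltnW.
Qed.

Lemma bernstein_quadratic n (a b c x : R) :
  bernstein n (fun k => a + b * (k%:R - c) ^+ 2) x =
  a + b * ((n%:R * x - c) ^+ 2 + n%:R * (x * (1 - x))).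
Proof.
elim: n c => [|n IH] c /=; first by ring.
rewrite IH (_ : (fun k : nat => _) = (fun k : nat => a + b * (k%:R - (c - 1)) ^+ 2)); last first.
  by apply/funext => k; rewrite -natr1; ring.
by rewrite IH -natr1; ring.
Qed.

Lemma dist_bernstein_le n g (x y e K : R) : 0 <= x <= 1 ->
  (forall k, `|y - g k| <= e + K * (k%:R - n%:R * x) ^+ 2) ->
  `|y - bernstein n g x| <= e + K * (n%:R * (x * (1 - x))).
Proof.
move=> x01 gy; have variance (z s : R) :
    bernstein n (fun k => z + s * (k%:R - n%:R * x) ^+ 2) x = z + s * (n%:R * (x * (1 - x))).
  by rewrite bernstein_quadratic subrr expr0n/= add0r.
rewrite ler_distlC; apply/andP; split.
  rewrite opprD addrA -mulNr -variance; apply: le_bernstein => // k _.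
  by have := gy k; rewrite ler_distlC mulNr opprD addrA => /andP[].
rewrite addrA -variance; apply: le_bernstein => // k _.
by have := gy k; rewrite ler_distlC addrA => /andP[].
Qed.

Lemma unif_continuous01 (f : R -> R) (e : R) : continuous f -> 0 < e ->
  exists2 d : R, 0 < d &
    forall x y, 0 <= x <= 1 -> `|x - y| < d -> `|f x - f y| < e.
Proof.
move=> cf e0.
pose close (d x : R) := forall y, `|x - y| < d -> `|f x - f y| < e.
have /compact_near_coveringP/(_ R (0^'+) close) := @segment_compact R 0 1.
have near_close x : `[0, 1]%classic x -> \forall x' \near x & d \near 0^'+, close d x'.
  move=> _; have e2 : 0 < e / 2 by rewrite divr_gt0.
  have /cvgrPdist_lt/(_ _ e2)[r /= r0 f_r] := cf x.
  exists (ball x (r / 2), [set d : R | d < r / 2]).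
    split => /=; first by apply: nbhsx_ballx; rewrite divr_gt0.
    by apply: nbhs_right_lt; rewrite divr_gt0.
  move=> [x' d] /= [xx' dr] y x'y; rewrite -ball_normE /= in xx'.
  have fxx' : `|f x - f x'| < e / 2.
    by apply: f_r => /=; rewrite (lt_trans xx')// ltr_pdivrMr// ltr_pMr// ltr1n.
  have fxy : `|f x - f y| < e / 2.
    apply: f_r => /=; rewrite -[x - y](subrKA x').
    by rewrite (le_lt_trans (ler_normD _ _))// [r]splitr ltrD// (lt_trans x'y).
  rewrite (_ : f x' - f y = (f x - f y) - (f x - f x')); last by ring.
  by rewrite (le_lt_trans (ler_normB _ _))// [e]splitr ltrD.
move=> /(_ _ near_close) [d /= d0 close_d].
exists (d / 2); first by rewrite divr_gt0.
move=> x y x01 xy; apply: (close_d (d / 2)) => //=; rewrite ?divr_gt0//.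
by rewrite sub0r normrN gtr0_norm ?divr_gt0// ltr_pdivrMr// ltr_pMr// ltr1n.
Qed.

Lemma dist_le_quadratic (f : R -> R) (M e : R) :
  continuous f -> (forall x, `|f x| <= M) -> 0 < e ->
  exists2 K : R, 0 <= K & forall x y, 0 <= x <= 1 -> `|f x - f y| <= e + K * (y - x) ^+ 2.
Proof.
move=> cf fM e0; have M0 : 0 <= M by exact: le_trans (fM 0).
have [d d0 f_d] := unif_continuous01 cf e0.
have K0 : 0 <= 2 * M / d ^+ 2 by exact: divr_ge0 (mulr_ge0 _ M0) (sqr_ge0 d).
exists (2 * M / d ^+ 2) => // x y x01.
have [xy|xy] := ltP `|x - y| d.
  by rewrite (le_trans (ltW (f_d _ _ x01 xy)))// lerDl mulr_ge0// sqr_ge0.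
apply: (@le_trans _ _ (2 * M / d ^+ 2 * (y - x) ^+ 2)); last by rewrite lerDr ltW.
apply: (@le_trans _ _ (2 * M)).
  by have := ler_normB (f x) (f y); have := fM x; have := fM y; lra.
rewrite mulrAC ler_pdivlMr ?exprn_gt0//; apply: ler_wpM2l; first by rewrite mulr_ge0.
by rewrite -[leRHS]real_normK ?num_real// distrC lerXn2r ?nnegrE// ltW.
Qed.

Lemma weierstrass01 (f : R -> R) (M e : R) : continuous f -> (forall x, `|f x| <= M) -> 0 < e ->
  exists p : {poly R}, forall x, 0 <= x <= 1 -> `|f x - p.[x]| <= e.
Proof.
move=> cf fM e0; have e2 : 0 < e / 2 by rewrite divr_gt0.
have [K K0 f_K] := dist_le_quadratic cf fM e2.
have [n Kn] : exists n : nat, K / n.+1%:R <= e / 2.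
  exists (Num.truncn (K / (e / 2))); rewrite ler_pdivrMr// mulrC -ler_pdivrMr//.
  by rewrite ltW// truncnS_gt.
pose N : R := n.+1%:R; have N0 : 0 < N by [].
have [p pE] := bernstein_poly n.+1 (fun k => f (k%:R / N)).
exists p => x x01; rewrite -pE.
have close k : `|f x - f (k%:R / N)| <= e / 2 + K / N ^+ 2 * (k%:R - N * x) ^+ 2.
  apply: (le_trans (f_K _ _ x01)); rewrite lerD2l le_eqVlt; apply/predU1P; left.
  by field; rewrite gt_eqF.
apply: (le_trans (dist_bernstein_le x01 close)); rewrite [leRHS]splitr lerD2l.
have -> : K / N ^+ 2 * (N * (x * (1 - x))) = K / N * (x * (1 - x)).
  by field; rewrite gt_eqF.
apply: le_trans Kn; apply: ler_piMr; first exact: divr_ge0 K0 (ltW N0).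
by have /andP[x0 x1] := x01; rewrite mulr_ile1 ?subr_ge0// gerBl.
Qed.

Lemma weierstrass (f : R -> R) (A M e : R) : 0 < A -> continuous f ->
  (forall x, `|f x| <= M) -> 0 < e ->
  exists p : {poly R}, forall x, 0 <= x <= A -> `|f x - p.[x]| <= e.
Proof.
move=> A0 cf fM e0; have c_scaled : continuous (fun x => f (A * x)).
  move=> x; apply: (@continuous_comp _ _ _ (fun x => A * x) f); last exact: cf.
  exact: mulrl_continuous.
have [p f_p] := weierstrass01 c_scaled (fun x => fM (A * x)) e0.
exists (p \Po (A^-1 *: 'X)) => x /andP[x0 xA].
rewrite horner_comp !hornerE.
have := f_p (A^-1 * x); rewrite mulVKf ?gt_eqF//; apply.
by rewrite mulr_ge0 ?invr_ge0 ?(ltW A0)//= mulrC ler_pdivrMr// mul1r.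
Qed.

Lemma norm_horner_le (p : {poly R}) (y : R) : 1 <= y ->
  `|p.[y]| <= (\sum_(i < size p) `|p`_i|) * y ^+ size p.
Proof.
move=> y1; rewrite horner_coef (le_trans (ler_norm_sum _ _ _))// mulr_suml.
apply: ler_sum => i _; rewrite normrM ler_wpM2l// ger0_norm.
  by rewrite ler_weXn2l// ltnW.
by rewrite exprn_ge0// (le_trans _ y1).
Qed.

(* Beyond [A + 1] the error is dominated by [C y ^ d (y / (A + 1)) ^ j], which for large [j] is
   small on [0, A]. *)
Lemma poly_approx_half_line (f : R -> R) (A M e : R) : 0 <= A -> continuous f ->
  (forall x, `|f x| <= M) -> 0 < e ->
  exists (p : {poly R}) (K : R) (k : nat), [/\ 0 <= K, K * A ^+ k <= e &
    forall y, 0 <= y -> `|f y - p.[y]| <= e + K * y ^+ k].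
Proof.
move=> A0 cf fM e0; have M0 : 0 <= M by exact: le_trans (fM 0).
have B0 : 0 < A + 1 by rewrite ltr_wpDl.
have [p f_p] := weierstrass B0 cf fM e0.
pose C : R := M + \sum_(i < size p) `|p`_i|.
have C0 : 0 <= C by rewrite addr_ge0// sumr_ge0.
have [j small] : exists j : nat, C * A ^+ size p * (A / (A + 1)) ^+ j <= e.
  have ratio_lt1 : `|A / (A + 1)| < 1.
    by rewrite ger0_norm ?divr_ge0 ?(ltW B0)// ltr_pdivrMr// mul1r ltrDl.
  have : C * A ^+ size p * (A / (A + 1)) ^+ n @[n --> \oo] --> C * A ^+ size p * 0.
    by apply: cvgM; [exact: cvg_cst|exact: cvg_expr].
  rewrite mulr0 => /cvgrPdist_le/(_ _ e0)[j _ /(_ j (leqnn j))].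
  by rewrite sub0r normrN => /(le_trans (ler_norm _)) ?; exists j.
have K0 : 0 <= C / (A + 1) ^+ j by rewrite divr_ge0// exprn_ge0// ltW.
have KE y : C / (A + 1) ^+ j * y ^+ (size p + j) = C * y ^+ size p * (y / (A + 1)) ^+ j.
  by rewrite exprD exprMn exprVn; move: (y ^+ _) (y ^+ j) ((A + 1) ^- j) => u v z; ring.
exists p, (C / (A + 1) ^+ j), (size p + j)%N; split => // [|y y0]; first by rewrite KE.
have [yB|yB] := leP y (A + 1).
  by rewrite (le_trans (f_p _ _)) ?y0// lerDl mulr_ge0// exprn_ge0.
have y1 : 1 <= y by apply: le_trans (ltW yB); rewrite lerDr.
rewrite KE; apply: (@le_trans _ _ (C * y ^+ size p)).
  rewrite (le_trans (ler_normB _ _))// mulrDl lerD ?norm_horner_le//.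
  by rewrite (le_trans (fM y))// ler_peMr// exprn_ege1.
apply: (@le_trans _ _ (C * y ^+ size p * (y / (A + 1)) ^+ j)); last by rewrite lerDr ltW.
by rewrite ler_peMr ?mulr_ge0 ?exprn_ge0// exprn_ege1// ler_pdivlMr// mul1r ltW.
Qed.

End bernstein.

Section method_of_moments.
Context (R : realType).
Notation mu := (@lebesgue_measure R).
Variables (rho : R -> R) (A : R).
Hypothesis A0 : 0 <= A.
Hypothesis mrho : measurable_fun setT rho.
Hypothesis rho0 : forall x, 0 <= rho x.
Hypothesis rho1 : (\int[mu]_x (rho x)%:E = 1)%E.
Hypothesis rho_support : forall x, rho x != 0 -> 0 <= x <= A.
Implicit Types (f g : R -> R) (C D x y : R).

Definition density_mean f : R := \int[mu]_x (f x * rho x).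

Let integrable_rho : mu.-integrable setT (EFin \o rho).
Proof.
apply/integrableP; split; first exact/measurable_EFinP.
by under eq_integral => x _ do rewrite /= ger0_norm//; rewrite rho1 ltry.
Qed.

Let integrableZ C g : mu.-integrable setT (EFin \o g) ->
  mu.-integrable setT (EFin \o (fun x => C * g x)).
Proof.
move=> ig; rewrite (_ : EFin \o _ = (fun x => C%:E * (EFin \o g) x)%E); first exact: integrableZl.
by apply/funext => x; rewrite /= EFinM.
Qed.

Let norm_mul_density_le g C x : (forall y, 0 <= y <= A -> `|g y| <= C) ->
  `|g x * rho x| <= C * rho x.
Proof.
move=> gC; rewrite normrM (ger0_norm (rho0 x)).
have [->|/rho_support xA] := eqVneq (rho x) 0; first by rewrite !mulr0.
by rewrite ler_wpM2r// gC.
Qed.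

Let integrable_mul_density g C : measurable_fun setT g ->
  (forall y, 0 <= y <= A -> `|g y| <= C) ->
  mu.-integrable setT (EFin \o (fun x => g x * rho x)).
Proof.
move=> mg gC; apply: le_integrable (integrableZ C integrable_rho) => //.
  by apply/measurable_EFinP; exact: measurable_funM.
move=> x _ /=; rewrite lee_fin (le_trans (norm_mul_density_le _ gC))//.
exact: ler_norm.
Qed.

Lemma norm_density_mean_le g C : measurable_fun setT g ->
  (forall y, 0 <= y <= A -> `|g y| <= C) -> `|density_mean g| <= C.
Proof.
move=> mg gC; have ig := integrable_mul_density mg gC.
apply: (le_trans (le_normr_Rintegral _ ig)) => //.
have -> : C = \int[mu]_x (C * rho x).
  by rewrite RintegralZl// /Rintegral rho1 mulr1.
apply: le_Rintegral => //.
- by have /integrable_abse := ig.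
- exact: integrableZ.
- by move=> x _; exact: norm_mul_density_le.
Qed.

Lemma density_meanB f g C D :
  measurable_fun setT f -> (forall y, 0 <= y <= A -> `|f y| <= C) ->
  measurable_fun setT g -> (forall y, 0 <= y <= A -> `|g y| <= D) ->
  density_mean (fun x => f x - g x) = density_mean f - density_mean g.
Proof.
move=> mf fC mg gD; rewrite /density_mean -RintegralB//.
- by apply: eq_Rintegral => x _; rewrite mulrBl.
- exact: integrable_mul_density mf fC.
- exact: integrable_mul_density mg gD.
Qed.

Let norm_expr_le k y : 0 <= y <= A -> `|y ^+ k| <= A ^+ k.
Proof.
by move=> /andP[y0 yA]; rewrite ger0_norm ?exprn_ge0// lerXn2r ?nnegrE.
Qed.

Lemma density_mean_expr_le k : density_mean (fun y => y ^+ k) <= A ^+ k.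
Proof.
apply: (le_trans (ler_norm _)); apply: norm_density_mean_le (@norm_expr_le k).
exact: measurable_funX.
Qed.

Lemma density_mean_poly (p : {poly R}) :
  density_mean (fun x => p.[x]) = \sum_(i < size p) p`_i * density_mean (fun x => x ^+ i).
Proof.
have i_mono i : mu.-integrable setT (EFin \o (fun x => p`_i * (x ^+ i * rho x))).
  by apply: integrableZ; apply: integrable_mul_density (@norm_expr_le i); exact: measurable_funX.
transitivity (\int[mu]_x (\sum_(i < size p) p`_i * (x ^+ i * rho x))).
  apply: eq_Rintegral => x _; rewrite horner_coef mulr_suml.
  by apply: eq_bigr => i _; exact/esym/mulrA.
elim: (size p) => [|n IH].
  rewrite big_ord0 -[RHS](mul0r (fine (mu setT))) -Rintegral_cst//.
  by apply: eq_Rintegral => x _; rewrite big_ord0.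
rewrite big_ord_recr/= -IH /density_mean -RintegralZl//; last first.
  by apply: integrable_mul_density (@norm_expr_le n); exact: measurable_funX.
rewrite -RintegralD//.
  by apply: eq_Rintegral => x _; rewrite big_ord_recr.
rewrite (_ : _ \o _ = (fun x => \sum_(i < n) (p`_i * (x ^+ i * rho x))%:E)%E); last first.
  by apply/funext => x /=; rewrite sumEFin.
by apply: integrable_sum => // i _; exact: i_mono.
Qed.

Variables m x : forall n, 'I_n -> R.
Arguments m : clear implicits.
Arguments x : clear implicits.
Hypothesis m0 : forall n i, 0 <= m n i.
Hypothesis x0 : forall n i, 0 <= x n i.
Hypothesis cvg_moment : forall k,
  weighted_moment (m n) (x n) k @[n --> \oo] --> density_mean (fun y => y ^+ k).

Let atomic_mean f n : R := \sum_i m n i * f (x n i).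

Lemma cvg_atomic_mean_poly (p : {poly R}) :
  atomic_mean (fun y => p.[y]) n @[n --> \oo] --> density_mean (fun y => p.[y]).
Proof.
rewrite density_mean_poly.
have -> : atomic_mean (fun y => p.[y]) =
    fun n => \sum_(k < size p) p`_k * weighted_moment (m n) (x n) k.
  apply/funext => n; rewrite /atomic_mean; under eq_bigr do rewrite horner_coef mulr_sumr.
  rewrite exchange_big/=; apply: eq_bigr => k _; rewrite mulr_sumr.
  by apply: eq_bigr => i _; rewrite mulrCA.
by apply: cvg_sumr => k; apply: cvgM; [exact: cvg_cst|exact: cvg_moment].
Qed.

Lemma atomic_mean_dist_le f g (h K : R) k n :
  (forall y, 0 <= y -> `|f y - g y| <= h + K * y ^+ k) ->
  `|atomic_mean g n - atomic_mean f n| <=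
  h * weighted_moment (m n) (x n) 0 + K * weighted_moment (m n) (x n) k.
Proof.
move=> fg; rewrite /atomic_mean -sumrB (le_trans (ler_norm_sum _ _ _))//.
rewrite !mulr_sumr -big_split/=; apply: ler_sum => i _.
rewrite -mulrBr normrM ger0_norm// distrC.
apply: (le_trans (ler_wpM2l (m0 i) (fg _ (x0 i)))).
by rewrite le_eqVlt; apply/predU1P; left; rewrite expr0; ring.
Qed.

Lemma cvg_atomic_mean f : continuous f -> (exists M, forall y, `|f y| <= M) ->
  atomic_mean f n @[n --> \oo] --> density_mean f.
Proof.
move=> cf [M fM]; apply/cvgrPdist_le => e e0.
pose h : R := e / 6; have h0 : 0 < h by rewrite divr_gt0.
have [p [K [k [K0 KA f_p]]]] := poly_approx_half_line A0 cf fM h0.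
have mf : measurable_fun setT f by exact: continuous_measurable_fun.
have mp : measurable_fun setT (fun y : R => p.[y]).
  by apply: continuous_measurable_fun; exact: continuous_horner.
have K_pow y : 0 <= y <= A -> K * y ^+ k <= h.
  by move=> yA; apply: le_trans KA; rewrite ler_wpM2l// (le_trans (ler_norm _)) ?norm_expr_le.
have f_p_support y : 0 <= y <= A -> `|f y - p.[y]| <= 2 * h.
  move=> yA; have /andP[y0 _] := yA; apply: (le_trans (f_p y y0)).
  by have := K_pow y yA; lra.
have mean_f_p : `|density_mean f - density_mean (fun y => p.[y])| <= 2 * h.
  rewrite -(density_meanB (C := M) (D := M + 2 * h))//.
    by apply: norm_density_mean_le f_p_support; exact: measurable_funB.
  move=> y yA; rewrite (_ : p.[y] = f y - (f y - p.[y])); last by ring.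
  by rewrite (le_trans (ler_normB _ _))// lerD// f_p_support.
pose error n : R := h * weighted_moment (m n) (x n) 0 + K * weighted_moment (m n) (x n) k.
pose error_limit : R := h * density_mean (fun y => y ^+ 0) + K * density_mean (fun y => y ^+ k).
have cvg_error : error n @[n --> \oo] --> error_limit.
  by apply: cvgD; (apply: cvgM; [exact: cvg_cst|exact: cvg_moment]).
have error_limit_le : error_limit <= 2 * h.
  have := lerD (ler_wpM2l (ltW h0) (density_mean_expr_le 0))
    (le_trans (ler_wpM2l K0 (density_mean_expr_le k)) KA).
  by rewrite expr0 mulr1 -/error_limit; lra.
near=> n.
have near_p : `|density_mean (fun y => p.[y]) - atomic_mean (fun y => p.[y]) n| <= h.
  by near: n; move/cvgrPdist_le : (@cvg_atomic_mean_poly p); apply.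
have near_error : error n <= 3 * h.
  have : `|error_limit - error n| <= h by near: n; move/cvgrPdist_le : cvg_error; apply.
  by rewrite ler_distl => /andP[+ _]; move: error_limit_le; lra.
have := ler_distD (atomic_mean (fun y => p.[y]) n) (density_mean (fun y => p.[y]))
  (atomic_mean f n).
have := ler_distD (density_mean (fun y => p.[y])) (density_mean f) (atomic_mean f n).
have -> : e = 6 * h by rewrite /h; field.
have := atomic_mean_dist_le n f_p; rewrite -/(error n).
by move: mean_f_p near_p near_error; lra.
Unshelve. all: by end_near. Qed.

End method_of_moments.

Lemma mp_dens_support (R : realType) (tau x : R) : 0 < tau <= 1 ->
  mp_dens tau x != 0 -> 0 <= x <= 4.
Proof.
move=> /andP[tau0 tau1]; rewrite /mp_dens indicE mem_setE in_itv/=.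
have [/andP[x_gt x_lt] _|_] := boolP (_ < x < _); last by rewrite mulr0 eqxx.
rewrite ltW ?(le_lt_trans _ x_gt) ?sqr_ge0//= ltW// (lt_le_trans x_lt)//.
have s1 : Num.sqrt tau <= 1 by rewrite -sqrtr1 ler_sqrt.
rewrite /mp_plus (_ : 4 = 2 ^+ 2 :> R); last by ring.
by rewrite lerXn2r ?nnegrE ?addr_ge0 ?sqrtr_ge0//; lra.
Qed.

Lemma weak_cvg_MP_of_moments (R : realType) (tau : R) (m x : forall n, 'I_n -> R) :
  0 < tau <= 1 -> (forall n i, 0 <= m n i) -> (forall n i, 0 <= x n i) ->
  (forall k, weighted_moment (m n) (x n) k @[n --> \oo] --> mp_int tau (fun y => y ^+ k)) ->
  weak_cvg_MP m x tau.
Proof.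
move=> tau01 m0 x0 cvg_moment f cf fM.
exact: (cvg_atomic_mean (ler0n _ 4) (measurable_mp_dens tau) (mp_dens_ge0 tau01)
  (integral_mp_dens_setT tau01) (fun y => mp_dens_support tau01) m0 x0 cvg_moment cf fM).
Qed.

Theorem theorem2p2 (R : realType) (d : measure_display) (T : measurableType d)
    (P : probability T R) (beta tau : R) (a b : nat -> R)
    (lam w : forall n : nat, T -> 'I_n -> R) :
  0 < beta ->
  0 < tau <= 1 ->
  (forall n : nat, beta / 2 * (n.-1)%:R < a n /\ beta / 2 * (n.-1)%:R < b n) ->
  (fun n : nat => beta / 2 * n%:R / a n) @ \oo --> tau ->
  (fun n : nat => b n / n%:R) @ \oo --> +oo ->
  (forall (n : nat) (i : 'I_n), measurable_fun setT (fun t => lam n t i)) ->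
  (forall (n : nat) (i : 'I_n), measurable_fun setT (fun t => w n t i)) ->
  (forall (n : nat) (A B : 'I_n -> set R),
      (forall i, measurable (A i)) -> (forall i, measurable (B i)) ->
      P [set t | forall i : 'I_n, A i (lam n t i) /\ B i (w n t i)] =
      (jac_prob beta (a n) (b n) A * dir_prob (beta / 2) B)%E) ->
  {ae P, forall t,
    weak_cvg_MP (fun n i => w n t i) (fun n i => b n / a n * lam n t i) tau /\
    weak_cvg_MP (fun n _ => n%:R^-1) (fun n i => b n / a n * lam n t i) tau}.
Proof.
move=> beta0 tau01 ab_gt a_tau b_infty mlam mw law.
have /andP[tau0 _] := tau01; have c0 : 0 < beta / 2 by rewrite divr_gt0.
have regP := JacobiRegime beta0 tau0 ab_gt a_tau b_infty.
have ensP n := JacobiEnsemble (mlam n) (mw n) (law n).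
have [m0 mS] := mp_int_recursion tau01.
have support := ae_foralln (fun n => ensemble_support (ensP n)).
have loop := scaled_loop_ae_cvg0 regP ensP.
have weight := weighted_moment_ae_cvg regP ensP c0.
apply: filterS3 support loop weight => t support loop weight.
have moment := cvg_scaled_moment regP m0 mS loop.
have clampE n : clamped (lam n) t = lam n t.
  by apply/funext => i; apply: clamp_id; have [] := support n i.
have momentE n (m : 'I_n -> R) k : weighted_moment m (fun i => b n / a n * lam n t i) k =
    weighted_moment m (clamped (lam n) t) k / eigenvalue_scale a b n ^+ k.
  by rewrite weighted_momentZ clampE -exprVn invf_div mulrC.
have x0 n i : 0 <= b n / a n * lam n t i.
  have [/andP[/ltW lam0 _] _] := support n i.
  by rewrite mulr_ge0// divr_ge0// ltW ?(regime_a_gt0 regP) ?(regime_b_gt0 regP).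
split; apply: weak_cvg_MP_of_moments => //.
- by move=> n i; have [_ /ltW] := support n i.
- move=> k; rewrite -[X in _ --> X]add0r; apply: cvg_trans (cvgD (weight k) (moment k)).
  by under [X in _ --> X @ _]eq_fun do rewrite subrK -momentE.
- move=> k; under eq_fun do
    rewrite momentE (weighted_moment_uniform a b (fun n => clamped (lam n) t)).
  exact: moment.
Qed.
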